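(* Consider the EC-SDCA algorithm described in the context, where $Q$ is a contraction compressor with parameter $\delta$, each $\phi_{i\tau}$ is $\frac1\gamma$-smooth, $g$ is $1$-strongly convex, and $\frac{R^2}\gamma\ge\lambda>0$. Assume $\delta<1$. Define $$\Psi_3^k:=\epsilon_D^k+\frac{2(\rho+\theta\lambda)}{\delta n}\sum_{\tau=1}^n\|e_\tau^k\|^2 ,\qquad \epsilon_D^k:=D(\alpha^* )-D(\alpha^k),$$ where $\rho=\frac{\delta\lambda R}{2\sqrt{a_1}}$ and $a_1=(1-\delta)(2\bar R^2+\delta R_m^2)$. Choose $$\theta=\min\left\{\frac{2\delta\lambda\gamma}{\delta\lambda\gamma m+\sqrt{\delta^2\lambda^2\gamma^2m^2+48\lambda\gamma a_1}},\ \frac{N\lambda\gamma p_{i\tau}}{3v_{i\tau}+N\lambda\gamma},\ \frac{\delta\lambda\gamma}{\delta\lambda\gamma m+12R\sqrt{a_1}}\right\},$$ where $p_{i\tau}=\frac1m$ and $v_{i\tau}=R_m^2+nR^2$ for all $i,\tau$. Then $\mathbb{E}[\Psi_3^k]\le\left(1-\min\{\theta,\frac\delta4\}\right)^k\Psi_3^0$, and $\mathbb{E}[\Psi_3^k]\le\epsilon$ as long as $$k\ge O\left(\left(\frac1\delta+m+\frac{R_m^2}{n\lambda\gamma}+\frac{R^2}{\lambda\gamma}+\frac{\sqrt{1-\delta}\,R\bar R}{\delta\lambda\gamma}+\frac{\sqrt{1-\delta}\,RR_m}{\lambda\gamma\sqrt\delta}\right)\ln\frac1\epsilon\right).\qquad(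 * )$$ Let $w_k=\left(1-\min\{\theta,\frac\delta4\}\right)^{-k}$, $W_k=\sum_{i=1}^kw_i$, and $\bar x^k=\frac1{W_k}\sum_{i=1}^kw_ix^i$. Then $$\mathbb{E}[P(\bar x^k)-P(x^* )]\le\frac{\left(1-\min\{\theta,\frac\delta4\}\right)^k\epsilon_D^0}{1-\left(1-\min\{\theta,\frac\delta4\}\right)^k},$$ and for $\epsilon\le\epsilon_D^0$, $\mathbb{E}[P(\bar x^k)-P(x^* )]\le\epsilon$ as long as $k$ satisfies $( * )$.
   Context: Problem: $N=mn$, $A_{i\tau}\in\mathbb{R}^{d\times t}$ for $1\le i\le m$, $1\le\tau\le n$; $\phi_{i\tau}:\mathbb{R}^t\to\mathbb{R}$ convex; $g:\mathbb{R}^d\to\mathbb{R}\cup\{+\infty\}$ proper closed convex; $\gamma>0$. Primal: $\min_{x\in\mathbb{R}^d}P(x)=\frac1N\sum_{\tau=1}^n\sum_{i=1}^m\phi_{i\tau}(A_{i\tau}^\top x)+\lambda g(x)$. Dual: $\max_{\alpha\in\mathbb{R}^{tN}}D(\alpha)=-\lambda g^*\big(\frac1{\lambda N}\sum_{\tau}\sum_iA_{i\tau}\alpha_{i\tau}\big)-\frac1N\sum_\tau\sum_i\phi_{i\tau}^*(-\alpha_{i\tau})$, where $\alpha$ consists of blocks $\alpha_{i\tau}\in\mathbb{R}^t$ and $\phi_{i\tau}^*,g^*$ are convex conjugates. $x^*$ and $\alpha^*$ are optimal solutions of the primal and dual problems. ''$\frac1\gamma$-smooth'' means differentiable with $\frac1\gamma$-Lipschitz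 gradient; ''$1$-strongly convex'' means $g-\frac12\|\cdot\|^2$ is convex. $\|\cdot\|$ is the Euclidean norm for vectors and the spectral norm for matrices. $R_m=\max_{i,\tau}\|A_{i\tau}\|$; $\bar R^2=\max_\tau\frac1m\lambda_{\max}(\sum_iA_{i\tau}A_{i\tau}^\top)$; $R^2=\frac1N\lambda_{\max}(\sum_\tau\sum_iA_{i\tau}A_{i\tau}^\top)$, with $R,\bar R\ge0$. A possibly randomized map $Q:\mathbb{R}^d\to\mathbb{R}^d$ is a contraction compressor with parameter $\delta\in(0,1]$ if $\mathbb{E}\|x-Q(x)\|^2\le(1-\delta)\|x\|^2$ for all $x\in\mathbb{R}^d$. EC-SDCA algorithm. Parameter $\theta>0$; $p_{i\tau}=\frac1m$. Initialization: $\alpha^0\in\mathbb{R}^{tN}$, $x^0\in\mathbb{R}^d$, $u^0=\frac1{\lambda N}\sum_\tau\sum_iA_{i\tau}\alpha_{i\tau}^0$, $e_\tau^0=0$. For $k=0,1,2,\dots$: $x^{k+1}=\nabla g^*(u^k)$; for each $\tau$ sample $i_k^\tau$ uniformly and independently from $\{1,\dots,m\}$, set $\Delta\alpha^{k+1}_{i_k^\tau\tau}=-\theta p_{i_k^\tau\tau}^{-1}\alpha^k_{i_k^\tau\tau}-\theta p_{i_k^\tau\tau}^{-1}\nabla\phi_{i_k^\tau\tau}(A_{i_k^\tau\tau}^\top x^{k+1})$, $\alpha^{k+1}_{i_k^\tau\tau}=\alpha^k_{i_k^\tau\tau}+\Delta\alpha^{k+1}_{i_k^\tau\tau}$ and $\alpha^{k+1}_{i\tau}=\alpha^k_{i\tau}$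 for $i\ne i_k^\tau$; $y_\tau^k=Q\big(\frac1{\lambda m}A_{i_k^\tau\tau}\Delta\alpha^{k+1}_{i_k^\tau\tau}+e_\tau^k\big)$; $e_\tau^{k+1}=e_\tau^k+\frac1{\lambda m}A_{i_k^\tau\tau}\Delta\alpha^{k+1}_{i_k^\tau\tau}-y_\tau^k$; finally $u^{k+1}=u^k+\frac1n\sum_\tau y_\tau^k$. Here $\alpha^k\in\mathbb{R}^{tN}$ is the vector with blocks $\alpha^k_{i\tau}$. *)

(* Defs.v *)
From HB Require Import structures.
From mathcomp Require Import all_boot all_order all_algebra finmap.
From mathcomp Require Import all_classical all_reals all_analysis.

Set Implicit Arguments.
Unset Strict Implicit.
Unset Printing Implicit Defensive.

Import Order.TTheory GRing.Theory Num.Theory.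
Import numFieldNormedType.Exports.

Local Open Scope classical_set_scope.
Local Open Scope ring_scope.

(* The norm `|x| that the library puts on matrices is the max norm; it is used
   below only for topology and differentiability, which do not depend on the
   choice of the norm. *)

Definition dotv {R : realType} {d : nat} (x y : 'cV[R]_d) : R :=
  \sum_(j < d) x j 0 * y j 0.

Definition enorm {R : realType} {d : nat} (x : 'cV[R]_d) : R :=
  Num.sqrt (dotv x x).

Definition spectral_norm {R : realType} {d t : nat} (M : 'M[R]_(d, t)) : R :=
  sup [set enorm (M *m x) | x in [set x : 'cV[R]_t | enorm x <= 1]].

Definition lambda_max {R : realType} {d : nat} (S : 'M[R]_d) : R :=
  sup [set a : R | eigenvalue S a].

Definition gradient {R : realType} {d : nat} (f : 'cV[R]_d -> R)
    (x : 'cV[R]_d) : 'cV[R]_d :=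
  \col_j 'D_(delta_mx j 0) f x.

Definition smooth {R : realType} {d : nat} (L : R) (f : 'cV[R]_d -> R) : Prop :=
  (forall x, differentiable f x) /\
  forall x y, enorm (gradient f x - gradient f y) <= L * enorm (x - y).

(* With the convention 0 * +oo = 0, this is the usual inequality for functions
   that never take the value -oo. *)
Definition convexe {R : realType} {d : nat} (f : 'cV[R]_d -> \bar R) : Prop :=
  forall (x y : 'cV[R]_d) (s : R), 0 <= s <= 1 ->
    (f (s *: x + (1 - s) *: y)%R <= s%:E * f x + (1 - s)%:E * f y)%E.

Definition propere {R : realType} {d : nat} (f : 'cV[R]_d -> \bar R) : Prop :=
  (forall x, f x != -oo%E) /\ exists x, (f x < +oo)%E.

Definition strongly_convexe {R : realType} {d : nat} (mu : R)
    (f : 'cV[R]_d -> \bar R) : Prop :=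
  convexe (fun x => (f x - (mu / 2 * enorm x ^+ 2)%:E)%E).

Definition conjugate {R : realType} {d : nat} (f : 'cV[R]_d -> \bar R)
    (y : 'cV[R]_d) : \bar R :=
  ereal_sup [set ((dotv y x)%:E - f x)%E | x in [set: 'cV[R]_d]].

Record erm_data (R : realType) (m n d t : nat) := ErmData {
  mat : 'I_m -> 'I_n -> 'M[R]_(d, t);
  loss : 'I_m -> 'I_n -> 'cV[R]_t -> R;
  reg : 'cV[R]_d -> \bar R;
  lam : R }.

Section Problem.
Context {R : realType} {m n d t : nat} (pb : erm_data R m n d t).

Definition dual_point : Type := 'I_m -> 'I_n -> 'cV[R]_t.

Definition nfun : R := (m * n)%:R.

Definition primal (x : 'cV[R]_d) : \bar R :=
  ((nfun^-1 * \sum_(tau < n) \sum_(i < m) loss pb i tau ((mat pb i tau)^T *m x))%:E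
   + (lam pb)%:E * reg pb x)%E.

Definition dual_average (alpha : dual_point) : 'cV[R]_d :=
  (lam pb * nfun)^-1 *: \sum_(tau < n) \sum_(i < m) mat pb i tau *m alpha i tau.

Definition dual (alpha : dual_point) : \bar R :=
  (- ((lam pb)%:E * conjugate (reg pb) (dual_average alpha))
   - (nfun^-1)%:E * \sum_(tau < n) \sum_(i < m)
       conjugate (EFin \o loss pb i tau) (- alpha i tau)%R)%E.

Definition Rmax : R :=
  \big[Num.max/0]_(i < m) \big[Num.max/0]_(tau < n) spectral_norm (mat pb i tau).

Definition Rbar : R :=
  Num.sqrt (\big[Num.max/0]_(tau < n)
    (m%:R^-1 * lambda_max (\sum_(i < m) mat pb i tau *m (mat pb i tau)^T))).

Definition Rall : R :=
  Num.sqrt (nfun^-1 *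
    lambda_max (\sum_(tau < n) \sum_(i < m) mat pb i tau *m (mat pb i tau)^T)).

End Problem.

(* A randomized map is a jointly measurable map of an auxiliary random seed and
   of its argument; [mu] is the law of the seed. Deterministic compressors are
   the case where Q does not depend on the seed. *)
Definition contraction_compressor {R : realType} {d : nat} {dZ : measure_display}
    {Z : measurableType dZ} (mu : probability Z R) (delta : R)
    (Q : Z -> 'cV[R]_d -> 'cV[R]_d) : Prop :=
  measurable_fun [set: Z * g_sigma_algebraType (@open 'cV[R]_d)]
    (fun zx => Q zx.1 zx.2 : g_sigma_algebraType (@open 'cV[R]_d)) /\
  forall x : 'cV[R]_d,
    (\int[mu]_z (enorm (x - Q z x) ^+ 2)%:E <=
       ((1 - delta) * enorm x ^+ 2)%:E)%E.

Section Algorithm.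
Context {R : realType} {m n d t : nat} (pb : erm_data R m n d t).
Context {Z : Type} (Q : Z -> 'cV[R]_d -> 'cV[R]_d) (theta : R).

Definition prob_idx : R := m%:R^-1.

Record ec_state := EcState {
  st_alpha : 'I_m -> 'I_n -> 'cV[R]_t;
  st_x : 'cV[R]_d;
  st_u : 'cV[R]_d;
  st_e : 'I_n -> 'cV[R]_d }.

Definition ec_init (alpha0 : 'I_m -> 'I_n -> 'cV[R]_t) (x0 : 'cV[R]_d) :=
  EcState alpha0 x0 (dual_average pb alpha0) (fun=> 0).

(* [fine] only drops the extended-real type: the conjugate of a proper closed
   strongly convex function is finite everywhere. *)
Definition grad_conj_reg (u : 'cV[R]_d) : 'cV[R]_d :=
  gradient (fun v => fine (conjugate (reg pb) v)) u.

(* One iteration, where worker tau has drawn the index [i tau] and calls the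
   compressor with the seed [z tau]. *)
Definition ec_step (i : 'I_n -> 'I_m) (z : 'I_n -> Z) (s : ec_state) : ec_state :=
  let x' := grad_conj_reg (st_u s) in
  let Dalpha tau :=
    - (theta * prob_idx^-1) *: st_alpha s (i tau) tau
    - (theta * prob_idx^-1) *:
        gradient (loss pb (i tau) tau) ((mat pb (i tau) tau)^T *m x') in
  let alpha' j tau :=
    if j == i tau then st_alpha s j tau + Dalpha tau else st_alpha s j tau in
  let c tau := (lam pb * m%:R)^-1 *: (mat pb (i tau) tau *m Dalpha tau) in
  let y tau := Q (z tau) (c tau + st_e s tau) in
  EcState alpha' x'
    (st_u s + n%:R^-1 *: \sum_(tau < n) y tau)
    (fun tau => st_e s tau + c tau - y tau).

Fixpoint ec_sdca (idx : nat -> 'I_n -> 'I_m) (seed : nat -> 'I_n -> Z)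
    (s0 : ec_state) (k : nat) : ec_state :=
  if k is k'.+1 then ec_step (idx k') (seed k') (ec_sdca idx seed s0 k')
  else s0.

End Algorithm.

Definition mutually_independent {R : realType} {dO : measure_display}
    {Omega : measurableType dO} (Pr : probability Omega R) {I : choiceType}
    (F : I -> set_system Omega) : Prop :=
  forall (J : {fset I}) (E : I -> set Omega),
    (forall j, j \in J -> F j (E j)) ->
    Pr (\bigcap_(j in [set` J]) E j) = (\prod_(j <- J) Pr (E j))%E.

(* All index draws are uniform, all seeds have law [mu], and all these random
   elements, over all iterations and all workers, are mutually independent. *)
Definition ec_randomness {R : realType} {m n : nat} {dO dZ : measure_display}
    {Omega : measurableType dO} {Z : measurableType dZ}
    (Pr : probability Omega R) (mu : probability Z R)
    (idx : nat -> 'I_n -> Omega -> 'I_m) (seed : nat -> 'I_n -> Omega -> Z)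
    : Prop :=
  [/\ forall k tau i, measurable (idx k tau @^-1` [set i]),
      forall k tau i, Pr (idx k tau @^-1` [set i]) = (m%:R^-1)%:E,
      forall k tau, measurable_fun setT (seed k tau),
      forall k tau (B : set Z), measurable B -> Pr (seed k tau @^-1` B) = mu B
    & mutually_independent Pr
        (fun j : (nat * 'I_n) + (nat * 'I_n) =>
           match j with
           | inl (k, tau) => [set idx k tau @^-1` B | B in [set: set 'I_m]]
           | inr (k, tau) => [set seed k tau @^-1` B | B in @measurable _ Z]
           end)].

Section Rates.
Context {R : realType} {m n d t : nat} (pb : erm_data R m n d t).
Context (gamma delta : R).

Let l := lam pb.
Let N : R := @nfun R m n.

Definition a1 : R := (1 - delta) * (2 * Rbar pb ^+ 2 + delta * Rmax pb ^+ 2).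

Definition rho : R := delta * l * Rall pb / (2 * Num.sqrt a1).

Definition eso_v : R := Rmax pb ^+ 2 + n%:R * Rall pb ^+ 2.

Definition theta_choice : R :=
  Num.min
    (2 * delta * l * gamma /
      (delta * l * gamma * m%:R +
       Num.sqrt (delta ^+ 2 * l ^+ 2 * gamma ^+ 2 * m%:R ^+ 2
                 + 48 * l * gamma * a1)))
    (Num.min
      (N * l * gamma * @prob_idx R m / (3 * eso_v + N * l * gamma))
      (delta * l * gamma /
        (delta * l * gamma * m%:R + 12 * Rall pb * Num.sqrt a1))).

Definition rate : R := 1 - Num.min theta_choice (delta / 4).

Definition epsD (alphas alpha : 'I_m -> 'I_n -> 'cV[R]_t) : \bar R :=
  (dual pb alphas - dual pb alpha)%E.

Definition Psi3 (alphas : 'I_m -> 'I_n -> 'cV[R]_t) (s : @ec_state R m n d t)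
    : \bar R :=
  (epsD alphas (st_alpha s) +
   (2 * (rho + theta_choice * l) / (delta * n%:R) *
      \sum_(tau < n) enorm (st_e s tau) ^+ 2)%:E)%E.

Definition complexity : R :=
  delta^-1 + m%:R + Rmax pb ^+ 2 / (n%:R * l * gamma)
  + Rall pb ^+ 2 / (l * gamma)
  + Num.sqrt (1 - delta) * Rall pb * Rbar pb / (delta * l * gamma)
  + Num.sqrt (1 - delta) * Rall pb * Rmax pb / (l * gamma * Num.sqrt delta).

Definition weight (k : nat) : R := (rate ^+ k)^-1.

(* Weighted average of x^1, ..., x^k; meaningful for k > 0 only. *)
Definition xbar (x : nat -> 'cV[R]_d) (k : nat) : 'cV[R]_d :=
  (\sum_(1 <= i < k.+1) weight i)^-1 *:
    \sum_(1 <= i < k.+1) weight i *: x i.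

End Rates.

(* Main.v *)
(** The dual suboptimality decreases in conditional expectation like for exact
    SDCA, up to the perturbation caused by evaluating [x] at
    [u = dual_average alpha - mean e] instead of [dual_average alpha]. Since
    the conjugate of [g] is 1-smooth, this perturbation costs at most a multiple
    of the mean of the [|e_tau|^2], which itself contracts by [1 - delta / 2]
    per step up to a term in [|alpha - target|^2]; the step size makes the
    strong convexity of the conjugate losses absorb all the terms in
    [|alpha - target|^2]. Hence
    E Psi^(k+1) + theta E (P x^(k+1) - D alpha^* ) <= rate * E Psi^k.
    Weak duality makes the gap nonnegative, which gives the linear rate;
    telescoping the gaps with weights [rate^-i] and Jensen's inequality give the
    bound on the averaged iterate.

    The conditional expectations are Tonelli integrals over two disjoint blocks
    of the noise variables: the sigma-algebras generated by two disjoint blocks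
    are independent by a pi-system argument. *)
Require Import Defs.
From HB Require Import structures.
From mathcomp Require Import all_boot all_order all_algebra finmap.
From mathcomp Require Import all_classical all_reals all_analysis.
From mathcomp Require Import measurable_realfun ring lra.

Set Implicit Arguments.
Unset Strict Implicit.
Unset Printing Implicit Defensive.

Import Order.TTheory GRing.Theory Num.Theory.
Import numFieldNormedType.Exports.

Local Open Scope classical_set_scope.
Local Open Scope ring_scope.

(** * Euclidean vectors and the largest eigenvalue *)

(** The constants of the step size come from one budget. Strong convexity of the conjugate losses
    offers theta gamma (1 - theta m) / 2 times the mean of |target - alpha|^2, and each of the three
    candidates in the minimum reserves a third of it: the first for the part theta lambda of the
    error weight, the second for the smoothness and sampling variance terms, the third for the two
    terms in rho. The value of rho is the one that makes these last two terms equal.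

    A recurring obstacle is that [sup], [gradient], [fine] and [Num.sqrt] are total functions with
    default values, so existence has to be earned before a formula can be used: eigenvalues are
    bounded and attained, the conjugate of g gets an explicit maximiser at each point, and a
    starting point outside the domain of the dual is treated apart, its initial Lyapunov value being
    +oo. The estimates for one step are then inequalities between reals and finite sums over index
    vectors. *)

Section Dot.
Context {R : realType} {d : nat}.
Implicit Types x y z : 'cV[R]_d.

Lemma dotvC x y : dotv x y = dotv y x.
Proof. by apply: eq_bigr => i _; rewrite mulrC. Qed.

Lemma dotvDl x y z : dotv (x + y) z = dotv x z + dotv y z.
Proof. by rewrite -big_split; apply: eq_bigr => i _; rewrite mxE mulrDl. Qed.

Lemma dotvDr x y z : dotv x (y + z) = dotv x y + dotv x z.
Proof. by rewrite !(dotvC x) dotvDl. Qed.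

Lemma dotvZl a x y : dotv (a *: x) y = a * dotv x y.
Proof. by rewrite mulr_sumr; apply: eq_bigr => i _; rewrite mxE mulrA. Qed.

Lemma dotvZr a x y : dotv x (a *: y) = a * dotv x y.
Proof. by rewrite !(dotvC x) dotvZl. Qed.

Lemma dotvNl x y : dotv (- x) y = - dotv x y.
Proof. by rewrite -scaleN1r dotvZl mulN1r. Qed.

Lemma dotvNr x y : dotv x (- y) = - dotv x y.
Proof. by rewrite !(dotvC x) dotvNl. Qed.

Lemma dotv0l x : dotv 0 x = 0.
Proof. by rewrite -(scale0r 0) dotvZl mul0r. Qed.

Lemma dotv0r x : dotv x 0 = 0.
Proof. by rewrite dotvC dotv0l. Qed.

Lemma dotv_suml (I : Type) (r : seq I) (P : pred I) (F : I -> 'cV[R]_d) y :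
  dotv (\sum_(i <- r | P i) F i) y = \sum_(i <- r | P i) dotv (F i) y.
Proof.
apply: (big_morph (fun x => dotv x y)); last exact: dotv0l.
by move=> a b; rewrite dotvDl.
Qed.

Lemma dotv_sumr (I : Type) (r : seq I) (P : pred I) (F : I -> 'cV[R]_d) y :
  dotv y (\sum_(i <- r | P i) F i) = \sum_(i <- r | P i) dotv y (F i).
Proof. by rewrite dotvC dotv_suml; apply: eq_bigr => i _; rewrite dotvC. Qed.

Lemma dotv_ge0 x : 0 <= dotv x x.
Proof. by apply: sumr_ge0 => i _; rewrite -expr2 sqr_ge0. Qed.

Lemma dotv_eq0 x : (dotv x x == 0) = (x == 0).
Proof.
apply/eqP/eqP => [|->]; last by rewrite dotv0l.
move=> /eqP; rewrite psumr_eq0; last by move=> i _; rewrite -expr2 sqr_ge0.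
move=> /allP h; apply/matrixP => i j; rewrite ord1 mxE.
by have /(_ i) := h _ (mem_index_enum _); rewrite -expr2 sqrf_eq0 => /eqP.
Qed.

Lemma dotv_gt0 x : x != 0 -> 0 < dotv x x.
Proof. by move=> x0; rewrite lt_def dotv_ge0 dotv_eq0 x0. Qed.

Lemma enorm_sqr x : enorm x ^+ 2 = dotv x x.
Proof. by rewrite /enorm sqr_sqrtr// dotv_ge0. Qed.

Lemma enorm_ge0 x : 0 <= enorm x.
Proof. exact: sqrtr_ge0. Qed.

Lemma dotvDD x y : dotv (x + y) (x + y) = dotv x x + 2 * dotv x y + dotv y y.
Proof. by rewrite !dotvDl !dotvDr (dotvC y x); ring. Qed.

Lemma dotvBB x y : dotv (x - y) (x - y) = dotv x x - 2 * dotv x y + dotv y y.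
Proof. by rewrite dotvDD !dotvNr !dotvNl; ring. Qed.

Lemma dotv_CS x y : dotv x y ^+ 2 <= dotv x x * dotv y y.
Proof.
have [->|y0] := eqVneq y 0; first by rewrite !dotv0r mulr0 expr0n.
have p := dotv_gt0 y0.
have := dotv_ge0 (dotv y y *: x - dotv x y *: y).
rewrite dotvBB !dotvZl !dotvZr => h.
rewrite -(ler_pM2l p).
by move: h; lra.
Qed.

Lemma dotv_young (c : R) x y : 0 < c ->
  2 * dotv x y <= c * dotv x x + c^-1 * dotv y y.
Proof.
move=> c0; have := dotv_ge0 (c *: x - y).
rewrite dotvBB !dotvZl !dotvZr => h.
rewrite -(ler_pM2l c0) mulrDr [_ * (c^-1 * _)]mulrA mulfV ?gt_eqF// mul1r; lra.
Qed.

Lemma dotv_le_enorm x y : dotv x y <= enorm x * enorm y.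
Proof.
apply: (le_trans (ler_norm _)); rewrite -sqrtr_sqr -sqrtrM ?dotv_ge0//.
by rewrite ler_wsqrtr// dotv_CS.
Qed.

Lemma enormZ (a : R) x : enorm (a *: x) = `|a| * enorm x.
Proof. by rewrite /enorm dotvZl dotvZr mulrA -expr2 sqrtrM ?sqr_ge0// sqrtr_sqr. Qed.

Lemma enorm_le x y : (enorm x <= enorm y) = (dotv x x <= dotv y y).
Proof. by rewrite -!enorm_sqr ler_sqr ?nnegrE ?enorm_ge0. Qed.

End Dot.

Lemma dotv_mull {R : realType} {p q : nat} (A : 'M[R]_(p, q)) x y :
  dotv (A *m x) y = dotv x (A^T *m y).
Proof.
have E k (a b : 'cV[R]_k) : dotv a b = (a^T *m b) 0 0.
  by rewrite mxE; apply: eq_bigr => i _; rewrite mxE.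
by rewrite !E trmx_mul mulmxA.
Qed.

(** * Quadratic forms, operator norms and the Rayleigh quotient *)

Section Operators.
Context {R : realType}.

(** A crude Frobenius bound. [sup] is informative only on nonempty bounded sets, so [spectral_norm]
    and [lambda_max] become usable only after such a bound. The summand 1 keeps [C] positive. *)
Lemma dotv_mulmx_bound {p q : nat} (A : 'M[R]_(p, q)) :
  exists2 C : R, 0 < C & forall x, dotv (A *m x) (A *m x) <= C * dotv x x.
Proof.
exists (1 + \sum_(i < p) dotv (row i A)^T (row i A)^T).
  by rewrite ltr_pwDl// sumr_ge0// => i _; exact: dotv_ge0.
move=> x; rewrite mulrDl mul1r mulr_suml ler_wpDl ?dotv_ge0//.
rewrite {1}/dotv; apply: ler_sum => i _; rewrite -expr2.
suff -> : (A *m x) i 0 = dotv (row i A)^T x by exact: dotv_CS.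
by rewrite mxE; apply: eq_bigr => j _; rewrite !mxE.
Qed.

Lemma spectral_norm_ge0 {p q : nat} (A : 'M[R]_(p, q)) : 0 <= spectral_norm A.
Proof.
have [C C0 hC] := dotv_mulmx_bound A.
apply: (@le_trans _ _ (enorm (A *m 0))); first exact: enorm_ge0.
apply: ub_le_sup; last first.
  by exists 0 => //=; rewrite /enorm dotv0l sqrtr0.
exists (Num.sqrt C) => _ [x /= hx <-]; rewrite /enorm ler_wsqrtr//.
apply: (le_trans (hC x)); rewrite ger_pMr//.
by rewrite -enorm_sqr expr_le1// enorm_ge0.
Qed.

Lemma spectral_normP {p q : nat} (A : 'M[R]_(p, q)) x :
  dotv (A *m x) (A *m x) <= spectral_norm A ^+ 2 * dotv x x.
Proof.
have [C C0 hC] := dotv_mulmx_bound A.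
have [->|x0] := eqVneq x 0; first by rewrite mulmx0 !dotv0r mulr0.
have px : 0 < enorm x by rewrite sqrtr_gt0 dotv_gt0.
have : enorm (A *m ((enorm x)^-1 *: x)) <= spectral_norm A.
  apply: ub_le_sup; last first.
    exists ((enorm x)^-1 *: x) => //=.
    rewrite -(@expr_le1 _ 2)// ?enorm_ge0// enorm_sqr dotvZl dotvZr -enorm_sqr.
    by rewrite mulrA -invfM -expr2 mulVf// expf_neq0// gt_eqF.
  exists (Num.sqrt C) => _ [y /= hy <-]; rewrite /enorm ler_wsqrtr//.
  apply: (le_trans (hC y)); rewrite ger_pMr//.
  by rewrite -enorm_sqr expr_le1// enorm_ge0.
rewrite -ler_sqr ?nnegrE ?enorm_ge0 ?spectral_norm_ge0//.
rewrite enorm_sqr -scalemxAr dotvZl dotvZr mulrA -invfM -expr2 enorm_sqr.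
by rewrite mulrC ler_pdivrMr// dotv_gt0.
Qed.

(** A nearly vanishing quadratic form forces a nearly vanishing image. This turns an almost maximal
    Rayleigh quotient into an approximate eigenvector, without compactness of the sphere. *)
Lemma psd_mulmx_bound {p : nat} (B : 'M[R]_p) : B^T = B ->
  (forall x, 0 <= dotv x (B *m x)) ->
  exists2 C : R, 0 < C & forall x, dotv (B *m x) (B *m x) <= C * dotv x (B *m x).
Proof.
move=> sB pB; have [C C0 hC] := dotv_mulmx_bound B.
exists (1 + C); first by lra.
move=> x; set y := B *m x.
have hyx : dotv x (B *m y) = dotv y y by rewrite -[in B *m y]sB -dotv_mull.
(* discriminant of the nonnegative quadratic form along the line x - s y *)
have := pB ((1 + C) *: x - y).
rewrite mulmxBr -scalemxAr -/y !dotvDl !dotvDr !dotvNl !dotvNr !dotvZl !dotvZr hyx.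
have h1 : dotv y (B *m y) <= (1 + C) / 2 * dotv y y.
  have := @dotv_young R p 1 y (B *m y) ltr01.
  by rewrite invr1 !mul1r; have := hC y; lra.
have := dotv_ge0 y; set a := dotv y y in h1 *; set b := dotv x y.
have C1 : 0 < 1 + C by lra.
move=> a0 h; have : (1 + C) * a <= (1 + C) * ((1 + C) * b) by nra.
by rewrite ler_pM2l.
Qed.

(** The supremum [M] of the Rayleigh quotient is itself an eigenvalue: otherwise M I - S would be
    invertible, and unit vectors with quotient close to [M] would have an image bounded away from 0,
    against [psd_mulmx_bound]. *)
Lemma lambda_maxP {p : nat} (S : 'M[R]_p) x : S^T = S ->
  dotv x (S *m x) <= lambda_max S * dotv x x.
Proof.
move=> sS; have [->|x0] := eqVneq x 0; first by rewrite mulmx0 !dotv0r mulr0.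
have [C C0 hC] := dotv_mulmx_bound S.
pose A := [set dotv y (S *m y) | y in [set y : 'cV[R]_p | dotv y y = 1]].
have nrm y : y != 0 -> dotv ((enorm y)^-1 *: y) ((enorm y)^-1 *: y) = 1.
  move=> y0; rewrite dotvZl dotvZr mulrA -invfM -expr2 enorm_sqr mulVf//.
  by rewrite dotv_eq0.
have uA : has_ubound A.
  exists (1 + C) => _ [y /= hy <-].
  have := @dotv_young R p 1 y (S *m y) ltr01.
  by rewrite invr1 !mul1r; have := hC y; rewrite hy; lra.
have supA : has_sup A.
  split => //; eexists; exists ((enorm x)^-1 *: x) => //=.
  exact: nrm.
set M := sup A.
have hM y : dotv y (S *m y) <= M * dotv y y.
  have [->|y0] := eqVneq y 0; first by rewrite mulmx0 !dotv0r mulr0.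
  rewrite -ler_pdivrMr ?dotv_gt0//; apply: ub_le_sup => //.
  exists ((enorm y)^-1 *: y); first exact: nrm.
  by rewrite -scalemxAr dotvZl dotvZr mulrA -invfM -expr2 enorm_sqr mulrC.
pose B := M%:M - S.
have BE y : B *m y = M *: y - S *m y by rewrite mulmxBl mul_scalar_mx.
have BEd y : dotv y (B *m y) = M * dotv y y - dotv y (S *m y).
  by rewrite BE dotvDr dotvNr dotvZr.
have sB : B^T = B by rewrite linearB /= tr_scalar_mx sS.
have pB y : 0 <= dotv y (B *m y) by rewrite BEd subr_ge0.
have eM : eigenvalue S M.
  case: (boolP (eigenvalue S M)) => // nM; exfalso.
  have uB : B \in unitmx.
    rewrite unitmxE unitfE; apply/det0P => -[v v0 hv].
    move/negP: nM; apply; apply/eigenvalueP; exists v => //.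
    by move/eqP: hv; rewrite mulmxBr mul_mx_scalar subr_eq0 => /eqP ->.
  have [C1 C10 h1] := psd_mulmx_bound sB pB.
  have [C2 C20 h2] := dotv_mulmx_bound (invmx B).
  (* Invertibility forces the gap 1 / (C2 C1), by 1 = |y|^2 <= C2 |B y|^2 <= C2 C1 (M - <y, S
     y>). *)
  have [_ [y /= hy <-]] := sup_adherent (divr_gt0 ltr01 (mulr_gt0 C20 C10)) supA.
  rewrite -/M => hlt.
  have := h2 (B *m y); rewrite mulKmx// hy => h3.
  have := h1 y; rewrite BEd hy mulr1 => h4.
  have : 1 <= C2 * C1 * (M - dotv y (S *m y)).
    by apply: (le_trans h3); rewrite -mulrA ler_pM2l.
  by rewrite -ler_pdivrMl ?mulr_gt0// mulr1 => h5; move: hlt; rewrite mul1r; lra.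
apply: (le_trans (hM x)); rewrite ler_pM2r ?dotv_gt0//.
(* [M] also bounds every eigenvalue, so their supremum is genuine and dominates [M]. Eigenvectors
   are row vectors here, hence the transposes. *)
apply: ub_le_sup => //; exists M => a /eigenvalueP[v hv v0].
have vt : dotv v^T v^T != 0 by rewrite dotv_eq0 trmx_eq0.
have : dotv v^T (S *m v^T) = a * dotv v^T v^T.
  by rewrite -[in S *m _]sS -trmx_mul hv linearZ /= dotvZr.
move=> h; have := hM v^T; rewrite h ler_pM2r// lt_def vt; exact: dotv_ge0.
Qed.

(** A block row and its adjoint y -> (A_i^T y) have the same norm, and the latter is read off the
    Rayleigh quotient. An upper bound [c] replaces the eigenvalue because the radii are square
    roots, cut off at 0. *)
Lemma dotv_sum_lambda_max {p q : nat} (I : finType) (A : I -> 'M[R]_(p, q))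
    (v : I -> 'cV[R]_q) (c : R) :
  0 <= c -> lambda_max (\sum_i A i *m (A i)^T) <= c ->
  dotv (\sum_i A i *m v i) (\sum_i A i *m v i) <= c * \sum_i dotv (v i) (v i).
Proof.
move=> c0 hc; set y := \sum_i _; set V := \sum_i dotv _ _; set S := \sum_i _ in hc.
have V0 : 0 <= V by apply: sumr_ge0 => i _; exact: dotv_ge0.
have sS : S^T = S.
  rewrite /S linear_sum /=; apply: eq_bigr => i _.
  by rewrite trmx_mul trmxK.
have hS : \sum_i dotv ((A i)^T *m y) ((A i)^T *m y) <= c * dotv y y.
  apply: (@le_trans _ _ (lambda_max S * dotv y y)); last first.
    by rewrite ler_wpM2r ?dotv_ge0.
  apply: le_trans (lambda_maxP y sS); rewrite /S mulmx_suml dotv_sumr.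
  by apply: ler_sum => i _; rewrite -mulmxA dotv_mull trmxK dotvC.
have [y0|y0] := eqVneq (dotv y y) 0; first by rewrite y0 mulr_ge0.
have py : 0 < dotv y y by rewrite lt_def y0 dotv_ge0.
(* The Young inequality below divides by [c]; when [c] is 0, every A_i^T y vanishes and hence so
   does y. *)
have [c00|c00] := eqVneq c 0.
  have z i : (A i)^T *m y = 0.
    apply/eqP; rewrite -dotv_eq0; move: hS; rewrite c00 mul0r => hS.
    have : \sum_i dotv ((A i)^T *m y) ((A i)^T *m y) == 0.
      by rewrite eq_le hS sumr_ge0// => j _; exact: dotv_ge0.
    rewrite psumr_eq0 => [/allP /(_ i)|j _]; last exact: dotv_ge0.
    by rewrite mem_index_enum => /(_ isT).
  have : dotv y y = 0.
    rewrite {1}/y dotv_suml big1// => i _.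
    by rewrite dotv_mull z dotv0r.
  by move=> e; rewrite e eqxx in y0.
have pc : 0 < c by rewrite lt_def c00.
(* <A_i v_i, y> = <v_i, A_i^T y> and Young with weight c *)
have : 2 * dotv y y <= c * V + c^-1 * (c * dotv y y).
  apply: (@le_trans _ _ (c * V + c^-1 * \sum_i dotv ((A i)^T *m y) ((A i)^T *m y))).
    rewrite {1}/y dotv_suml !mulr_sumr -big_split /=.
    by apply: ler_sum => i _; rewrite dotv_mull; exact: dotv_young.
  by rewrite lerD2l ler_wpM2l// invr_ge0.
by rewrite mulKf//; lra.
Qed.

End Operators.

(** * Smooth convex functions and their conjugates *)

Section SmoothConvex.
Context {R : realType} {d : nat}.
Implicit Types (f : 'cV[R]_d -> R) (x y h : 'cV[R]_d).

Lemma derive_gradient f x h : differentiable f x -> 'd f x h = dotv (gradient f x) h.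
Proof.
move=> df; have hE : h = \sum_(j < d) h j 0 *: delta_mx j 0.
  by rewrite [LHS]matrix_sum_delta; apply: eq_bigr => j _; rewrite big_ord1.
rewrite {1}hE linear_sum; apply: eq_bigr => j _.
by rewrite linearZ mxE deriveE// mulrC.
Qed.

Lemma is_derive_along f x h (t : R) : (forall y, differentiable f y) ->
  is_derive t 1 (fun s : R => f (x + s *: h)) (dotv (gradient f (x + t *: h)) h).
Proof.
move=> df.
have dl : is_diff t (fun s : R => x + s *: h) ( *:%R^~ h).
  have := is_diffD (is_diff_cst x t) (is_diff_scalel t h).
  by rewrite add0r.
have dx : differentiable (fun s : R => x + s *: h) t by [].
have dc : differentiable (fun s : R => f (x + s *: h)) t.
  by apply: (@differentiable_comp _ _ _ _ (fun s : R => x + s *: h) f).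
apply: DeriveDef; first exact: diff_derivable.
rewrite deriveE// (@diff_comp _ _ _ _ (fun s : R => x + s *: h) f)//=.
by rewrite diff_val scale1r derive_gradient.
Qed.

(** The upper bound needs the sharp constant L / 2, which fixes the modulus of the conjugates. The
    lower bound only serves to first order in |h|, so the cruder constant L is enough. *)
Lemma smooth_mean_value (L : R) f x h : smooth L f -> 0 <= L ->
  f (x + h) <= f x + dotv (gradient f x) h + L / 2 * dotv h h /\
  f x + dotv (gradient f x) h - L * dotv h h <= f (x + h).
Proof.
move=> [df gL] L0; set c := dotv (gradient f x) h; set n2 := dotv h h.
have gb (t : R) : 0 <= t -> `|dotv (gradient f (x + t *: h)) h - c| <= L * t * n2.
  move=> t0; rewrite /c -dotvNl -dotvDl.
  have cs : `|dotv (gradient f (x + t *: h) - gradient f x) h| <=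
      enorm (gradient f (x + t *: h) - gradient f x) * enorm h.
    rewrite ler_norml dotv_le_enorm andbT lerNl -dotvNr.
    apply: (le_trans (dotv_le_enorm _ _)).
    by rewrite /enorm dotvNl dotvNr opprK.
  apply: (le_trans cs).
  rewrite /n2 -enorm_sqr expr2 mulrA ler_wpM2r ?enorm_ge0//.
  apply: (le_trans (gL _ _)); rewrite -mulrA ler_wpM2l//.
  by rewrite addrC addKr enormZ ger0_norm.
have lin (a b : R) (t : R) : is_derive t (1 : R) (fun s : R => s * a + s ^+ 2 * b) (a + 2 * t * b).
  by apply: is_derive_eq; rewrite /GRing.scale /=; ring.
split.
(* Subtracting the expected quadratic makes the derivative nonpositive, so the mean value theorem
   yields the factor 1 / 2 that usually comes from integrating. *)
- pose F (t : R) := f (x + t *: h) - (t * c + t ^+ 2 * (L / 2 * n2)).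
  pose dF (t : R) := dotv (gradient f (x + t *: h)) h - (c + 2 * t * (L / 2 * n2)).
  have dFP t : is_derive t (1 : R) F (dF t).
    exact: is_deriveB (is_derive_along x h t df) (lin c (L / 2 * n2) t).
  have [|t] := @MVT R F dF 0 1 ltr01.
    by apply: derivable_within_continuous => t _; case: (dFP t).
  move=> t01; rewrite /F /dF !scale0r !scale1r !addr0 subr0 mulr1.
  move: t01; rewrite in_itv /= => /andP[t0 t1].
  have := gb t (ltW t0); rewrite ler_norml => /andP[_ h1].
  by move=> e; lra.
pose F (t : R) := f (x + t *: h).
have dFP t : is_derive t (1 : R) F (dotv (gradient f (x + t *: h)) h).
  exact: is_derive_along.
have [|t] := @MVT R F (fun t => dotv (gradient f (x + t *: h)) h) 0 1 ltr01.
  by apply: derivable_within_continuous => t _; case: (dFP t).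
move=> t01; rewrite /F !scale0r !scale1r !addr0 subr0 mulr1.
move: t01; rewrite in_itv /= => /andP[t0 t1].
have := gb t (ltW t0); rewrite ler_norml => /andP[h1 _].
have n0 : 0 <= n2 := dotv_ge0 h.
have : L * t * n2 <= L * n2 by rewrite ler_wpM2r// ler_piMr// ltW.
by move=> h2 e; lra.
Qed.

Lemma convex_functionP f x y (s : R) : convex_function setT f -> 0 <= s <= 1 ->
  f (s *: x + (1 - s) *: y) <= s * f x + (1 - s) * f y.
Proof.
move=> cf /andP[s0 s1].
have := cf (Itv01 s0 s1) x y; rewrite !inE => /(_ Logic.I Logic.I).
by rewrite convRE.
Qed.

Lemma convex_gradient (L : R) f x y : convex_function setT f -> smooth L f -> 0 <= L ->
  f x + dotv (gradient f x) (y - x) <= f y.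
Proof.
move=> cf sf L0; apply/ler_addgt0Pr => e e0.
set h := y - x; set M := L * dotv h h.
have M0 : 0 <= M by rewrite mulr_ge0// dotv_ge0.
(* This [t] brings the second-order remainder t M below e and also covers M = 0. *)
have [t [t0 t1 tM]] : exists t, [/\ 0 < t, t <= 1 & t * M <= e].
  exists (e / (e + M)); have eM : 0 < e + M by lra.
  split; first by rewrite divr_gt0.
    by rewrite ler_pdivrMr// mul1r; lra.
  by rewrite mulrAC ler_pdivrMr// ler_pM2l//; lra.
have [_ lo] := smooth_mean_value x (t *: h) sf L0.
have t01 : 0 <= t <= 1 by rewrite (ltW t0).
have := convex_functionP y x cf t01.
have -> : t *: y + (1 - t) *: x = x + t *: h.
  by rewrite /h scalerBr scalerBl scale1r addrCA.
move: lo; rewrite !dotvZr dotvZl => lo hi.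
rewrite -(ler_pM2l t0).
have E : L * (t * (t * dotv h h)) = t * (t * M) by rewrite /M; ring.
rewrite E in lo.
have : t * (t * M) <= t * e by rewrite ler_pM2l.
by lra.
Qed.

Lemma conjugate_ge (f : 'cV[R]_d -> \bar R) x y :
  ((dotv y x)%:E - f x <= conjugate f y)%E.
Proof. by apply: ereal_sup_ubound; exists x. Qed.

Lemma conjugate_le (f : 'cV[R]_d -> \bar R) y c :
  (forall x, (dotv y x)%:E - f x <= c)%E -> (conjugate f y <= c)%E.
Proof. by move=> h; apply: ge_ereal_sup => _ [x _ <-]. Qed.

Lemma conjugate_gradient (L : R) f x : convex_function setT f -> smooth L f -> 0 <= L ->
  conjugate (EFin \o f) (gradient f x) = (dotv (gradient f x) x - f x)%:E.
Proof.
move=> cf sf L0; apply/eqP; rewrite eq_le; apply/andP; split.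
  apply: conjugate_le => y; rewrite -EFinB lee_fin.
  by have := convex_gradient x y cf sf L0; rewrite dotvDr dotvNr; lra.
by have := conjugate_ge (EFin \o f) x (gradient f x); rewrite -EFinB.
Qed.

(** Sharpened Fenchel-Young inequality: the supremum is tested at the gradient step x + gamma (y -
    grad f x), which maximises the quadratic minorant given by the descent lemma. *)
Lemma conjugate_smooth_ge (gamma a : R) f x y : 0 < gamma -> smooth (1 / gamma) f ->
  (conjugate (EFin \o f) y <= a%:E)%E ->
  dotv y x - f x + gamma / 2 * dotv (y - gradient f x) (y - gradient f x) <= a.
Proof.
move=> g0 sf ya; set v := y - gradient f x.
have := le_trans (conjugate_ge (EFin \o f) (x + gamma *: v) y) ya.
rewrite -EFinB lee_fin.
have L0 : 0 <= 1 / gamma by rewrite divr_ge0// ltW.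
have [hi _] := smooth_mean_value x (gamma *: v) sf L0.
have e : dotv y v = dotv v v + dotv (gradient f x) v.
  by rewrite {2}/v dotvDl dotvNl subrK.
move: hi; rewrite dotvDr !dotvZr !dotvZl e.
have -> : 1 / gamma / 2 * (gamma * (gamma * dotv v v)) = gamma / 2 * dotv v v.
  by field; rewrite gt_eqF.
by lra.
Qed.

(** Obtained for each [x] separately from [conjugate_smooth_ge], without differentiating the
    conjugate. The real bounds [a] and [b] stand for values that could be infinite. *)
Lemma conjugate_strongly_convex (gamma a b s : R) f y z : 0 < gamma ->
  smooth (1 / gamma) f -> 0 <= s <= 1 ->
  (conjugate (EFin \o f) y <= a%:E)%E -> (conjugate (EFin \o f) z <= b%:E)%E ->
  (conjugate (EFin \o f) (s *: y + (1 - s) *: z) <=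
   (s * a + (1 - s) * b - gamma / 2 * (s * (1 - s)) * dotv (y - z) (y - z))%:E)%E.
Proof.
move=> g0 sf /andP[s0 s1] ya zb; apply: conjugate_le => x; rewrite -EFinB lee_fin.
have := conjugate_smooth_ge x g0 sf ya; have := conjugate_smooth_ge x g0 sf zb.
have -> : y - z = (y - gradient f x) - (z - gradient f x).
  by rewrite opprB addrA subrK.
move: (y - gradient f x) (z - gradient f x) => Y Z; rewrite dotvBB dotvDl !dotvZl => hz hy.
(* s |Y|^2 + (1 - s) |Z|^2 - s (1 - s) |Y - Z|^2 = |s Y + (1 - s) Z|^2 is nonnegative. *)
have n0 := dotv_ge0 (s *: Y + (1 - s) *: Z).
rewrite dotvDD !dotvZl !dotvZr in n0.
have h1 := ler_wpM2l s0 hy.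
have h2 : (1 - s) * (dotv z x - f x + gamma / 2 * dotv Z Z) <= (1 - s) * b.
  by apply: ler_wpM2l => //; lra.
have h3 := mulr_ge0 (ltW g0) n0.
by move: h1 h2 h3; lra.
Qed.

End SmoothConvex.

(** * Strongly convex functions and their conjugates *)

Section StronglyConvex.
Context {R : realType} {d : nat}.
Variable g : 'cV[R]_d -> \bar R.
Hypothesis propg : propere g.
Hypothesis lscg : lower_semicontinuous g.
Hypothesis scg : strongly_convexe 1 g.
Implicit Types x y u v : 'cV[R]_d.

Lemma strongly_convexe_real x y (a b s : R) : 0 <= s <= 1 ->
  g x = a%:E -> g y = b%:E ->
  (g (s *: x + (1 - s) *: y) <=
   (s * a + (1 - s) * b - s * (1 - s) / 2 * dotv (x - y) (x - y))%:E)%E.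
Proof.
move=> s01 gx gy; have := scg x y s01; rewrite gx gy.
rewrite -!EFinB -!EFinM -EFinD leeBlDr// -EFinD => /le_trans; apply.
rewrite lee_fin !enorm_sqr dotvBB dotvDl !dotvDr !dotvZl !dotvZr (dotvC y x).
by rewrite le_eqVlt; apply/orP; left; apply/eqP; field.
Qed.

Lemma reg_finite x b : (g x <= b%:E)%E -> exists2 a, g x = a%:E & a <= b.
Proof.
have [n0 _] := propg; move: (n0 x); case: (g x) => [a _||]//.
by rewrite lee_fin => ab; exists a.
Qed.

(* lower semicontinuity bounds g on a ball, and strong convexity along the
   segment leaving the ball gives quadratic growth outside *)
Lemma strongly_convexe_lower_bound u : exists c : R, forall x a, g x = a%:E ->
  c <= a - dotv u x.
Proof.
have [_ [x0 gx0]] := propg.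
have [a0 ga0] : exists a0, g x0 = a0%:E.
  have [n0 _] := propg; move: gx0 (n0 x0); case: (g x0) => [a _ _||]//.
  by exists a.
have [V nV hV] : exists2 V, nbhs x0 V & forall y, V y -> ((a0 - 1)%:E < g y)%E.
  by apply: lscg; rewrite ga0 lte_fin; lra.
have [r /= r0 hr] := (nbhs_ballP _ _).1 nV.
have inV y : enorm (y - x0) < r -> V y.
  move=> yr; apply: hr; split=> // i j; rewrite ord1; apply: le_lt_trans yr.
  rewrite distrC -sqrtr_sqr /enorm ler_wsqrtr//.
  rewrite /dotv (bigD1 i)//= -expr2 !mxE lerDl.
  by apply: sumr_ge0 => k _; rewrite -expr2 sqr_ge0.
(* [q] collects the linear losses in D = |x - x0|: 2 / r from the segment argument and |u| from the
   linear form. Completing the square in D^2 / 4 - q D leaves - q^2. *)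
pose q := 2 / r + enorm u.
exists (a0 - 1 - r ^+ 2 / 4 - dotv u x0 - q ^+ 2) => x a gx.
set D := enorm (x - x0).
have D0 : 0 <= D := enorm_ge0 _.
have ux : dotv u x <= dotv u x0 + enorm u * D.
  have -> : x = x0 + (x - x0) by rewrite addrC subrK.
  rewrite dotvDr lerD2l; exact: dotv_le_enorm.
have q0 : 0 <= (D / 2 - q) ^+ 2 by exact: sqr_ge0.
have r2 : 2 / r * D = 2 * D / r by rewrite mulrAC.
suff h : a0 - 1 - r ^+ 2 / 4 - 2 / r * D + D ^+ 2 / 4 <= a by rewrite /q in q0 *; nra.
have [Dr|rD] := ltP D r.
  have := hV _ (inV _ Dr); rewrite gx lte_fin => h1.
  have h2 : D ^+ 2 <= r ^+ 2 by rewrite ler_sqr ?nnegrE// ltW.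
  have h3 : 0 <= 2 / r * D by rewrite mulr_ge0// divr_ge0// ltW.
  by lra.
have Dp : 0 < D by apply: lt_le_trans r0 rD.
(* The point of the segment at distance r / 2 from [x0] lies in the ball where g > a0 - 1; strong
   convexity there, divided by [s], bounds [a] from below. *)
pose s := r / (2 * D).
have sD : s * D = r / 2 by rewrite /s; field; rewrite gt_eqF.
have s0 : 0 < s by rewrite divr_gt0// mulr_gt0.
have s1 : s <= 1 / 2 by rewrite ler_pdivrMr ?mulr_gt0//; lra.
have s01 : 0 <= s <= 1 by apply/andP; split; lra.
have := strongly_convexe_real s01 gx ga0.
have := hV (s *: x + (1 - s) *: x0).
have -> : s *: x + (1 - s) *: x0 = x0 + s *: (x - x0).
  by rewrite scalerBr scalerBl scale1r addrCA.
move=> h1 h2; have {h1} : ((a0 - 1)%:E < g (x0 + s *: (x - x0)))%E.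
  by apply/h1/inV; rewrite addrC addKr enormZ gtr0_norm// -/D sD; lra.
move=> /lt_le_trans /(_ h2).
rewrite lte_fin -enorm_sqr -/D => h3.
have e : s * (2 / r * D) = 1 by rewrite /s; field; rewrite !gt_eqF.
have h4 : s * (s * D ^+ 2) <= s * D ^+ 2 / 2.
  have : 0 <= s * D ^+ 2 by rewrite mulr_ge0 ?sqr_ge0// ltW.
  by nra.
have h5 : 0 <= s * (r ^+ 2) by rewrite mulr_ge0 ?sqr_ge0// ltW.
rewrite -(ler_pM2l s0).
by nra.
Qed.

(** Near-minimisers form a Cauchy filter by strong convexity, so completeness gives a limit, and
    lower semicontinuity makes this limit a minimiser. *)
Lemma strongly_convexe_minimizer u : exists x r, g x = r%:E /\
  forall y b, g y = b%:E -> r - dotv u x <= b - dotv u y.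
Proof.
have [c hc] := strongly_convexe_lower_bound u.
pose H := [set v | exists x a, g x = a%:E /\ v = a - dotv u x].
have hinf : has_inf H.
  split; last by exists c => _ [x [a [gx ->]]]; exact: hc.
  have [n0 [x0 gx0]] := propg; move: gx0 (n0 x0).
  case E : (g x0) => [a||]// _ _; exists (a - dotv u x0).
  by exists x0, a.
set i := inf H.
have iP x a : g x = a%:E -> i <= a - dotv u x.
  by move=> gx; apply: ge_inf; [case: hinf|exists x, a].
pose S (e : R) := [set x | (g x <= (i + dotv u x + e)%:E)%E].
pose F := filter_from [set e : R | 0 < e] S.
have FF : ProperFilter F.
  apply: filter_from_proper; first apply: filter_from_filter.
  - by exists 1 => /=.
  - move=> e1 e2 /= p1 p2; exists (Num.min e1 e2) => /=.
      by rewrite lt_min p1.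
    move=> x /= hx; split; apply: (le_trans hx); rewrite lee_fin lerD2l.
      by rewrite ge_min lexx.
    by rewrite ge_min lexx orbT.
  move=> e /= e0; have [_ [x [a [gx ->]]]] := inf_adherent e0 hinf.
  by rewrite -/i => h; exists x; rewrite /S /= gx lee_fin; lra.
(* The midpoint has value at least the infimum [i] and at most i + e - |x - y|^2 / 8. *)
have near_min e x y : S e x -> S e y -> dotv (x - y) (x - y) <= 8 * e.
  move=> /reg_finite[a gx ha] /reg_finite[b gy hb].
  have s01 : 0 <= (1 / 2 : R) <= 1 by lra.
  have /reg_finite[m gm hm] := strongly_convexe_real s01 gx gy.
  have := iP _ _ gm; rewrite (dotvDr u) !(dotvZr _ u); lra.
have cF : cauchy F.
  apply: cauchy_exP => e e0; pose e' := e ^+ 2 / 16.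
  have e'0 : 0 < e' by rewrite divr_gt0// exprn_gt0.
  have [x Sx] : S e' !=set0.
    have [_ [x [a [gx ->]]]] := inf_adherent e'0 hinf.
    by rewrite -/i => h; exists x; rewrite /S /= gx lee_fin; lra.
  exists x; exists e' => // y Sy; split=> // k j; rewrite ord1.
  have := near_min _ _ _ Sx Sy => h.
  rewrite /ball /= -ltr_sqr ?nnegrE ?(ltW e0)// real_normK ?num_real//.
  apply: (@le_lt_trans _ _ (dotv (x - y) (x - y))).
    rewrite /dotv (bigD1 k)//= -expr2 !mxE lerDl.
    by apply: sumr_ge0 => k' _; rewrite -expr2 sqr_ge0.
  apply: (le_lt_trans h); rewrite /e'.
  have : 0 < e ^+ 2 by rewrite exprn_gt0.
  by lra.
have xhP : F --> lim F by exact: cauchy_cvg.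
set xh := lim F in xhP.
(* Otherwise g would exceed its bound by 2 eta near [xh], whereas the points of [S eta] close to
   [xh] overshoot by at most eta, plus less than eta from the linear form. *)
have gxh : (g xh <= (i + dotv u xh)%:E)%E.
  rewrite leNgt; apply/negP => lt1.
  have [eta eta0 lt2] : exists2 eta : R, 0 < eta & ((i + dotv u xh + 2 * eta)%:E < g xh)%E.
    move: lt1; case: (g xh) => [a||]//; last by exists 1 => //; rewrite ltry.
    rewrite lte_fin => h; exists ((a - (i + dotv u xh)) / 3); first by lra.
    by rewrite lte_fin; lra.
  have [V nV hV] := lscg lt2.
  have cu : \forall x \near xh, dotv u x < dotv u xh + eta.
    pose rr := eta / (1 + \sum_(k < d) `|u k 0|).
    have sp : 0 < 1 + \sum_(k < d) `|u k 0| by rewrite ltr_pwDl// sumr_ge0.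
    apply/nbhs_ballP; exists rr => [|y hy] /=; first by rewrite divr_gt0.
    have -> : y = xh + (y - xh) by rewrite addrC subrK.
    rewrite dotvDr ltrD2l.
    apply: (@le_lt_trans _ _ (rr * \sum_(k < d) `|u k 0|)).
      rewrite mulr_sumr /dotv; apply: ler_sum => k _.
      apply: (le_trans (ler_norm _)); rewrite normrM mulrC ler_wpM2r// !mxE.
      by have := hy.2 k 0; rewrite /ball /= distrC => /ltW.
    by rewrite /rr mulrAC -mulrA gtr_pMr// ltr_pdivrMr// mul1r; lra.
  have [x [[Vx xu] Sx]] : ((V `&` [set x | dotv u x < dotv u xh + eta]) `&` S eta) !=set0.
    apply: (@filter_ex _ F); apply: filterI; last by exists eta.
    by apply: xhP; apply: filterI.
  have := lt_le_trans (hV _ Vx) Sx; rewrite lte_fin.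
  by move: xu => /=; lra.
have [r gr hr] := reg_finite gxh.
exists xh, r; split => // y b gy.
by have := iP _ _ gy; lra.
Qed.

(** Minimality is upgraded to quadratic growth by comparing with t y + (1 - t) x for small t. The
    value of g is carried along in [xr.2] so that later arithmetic is real. *)
Lemma strongly_convexe_argmax u : exists xr : 'cV[R]_d * R, g xr.1 = xr.2%:E /\
  forall y b, g y = b%:E ->
    xr.2 + dotv u (y - xr.1) + dotv (y - xr.1) (y - xr.1) / 2 <= b.
Proof.
have [x [r [gx xmin]]] := strongly_convexe_minimizer u.
exists (x, r); split => //= y b gy; apply/ler_addgt0Pr => e e0.
set M := dotv (y - x) (y - x); have M0 : 0 <= M := dotv_ge0 _.
have [t [t0 t1 tM]] : exists t, [/\ 0 < t, t <= 1 & t * M <= e].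
  exists (e / (e + M)); have eM : 0 < e + M by lra.
  split; first by rewrite divr_gt0.
    by rewrite ler_pdivrMr// mul1r; lra.
  by rewrite mulrAC ler_pdivrMr// ler_pM2l//; lra.
have t01 : 0 <= t <= 1 by rewrite (ltW t0).
have /reg_finite[m gm hm] := strongly_convexe_real t01 gy gx.
have := xmin _ _ gm; rewrite -/M in hm *.
rewrite !(dotvDr u) (dotvNr u) !(dotvZr _ u) => h; rewrite -(ler_pM2l t0).
have : t * (t * M) <= t * e by rewrite ler_pM2l.
have : 0 <= t * e by rewrite mulr_ge0// ltW.
by lra.
Qed.

End StronglyConvex.

(** * Smoothness of the conjugate of a strongly convex function *)

Section ConjugateStronglyConvex.
Context {R : realType} {d : nat}.
Variable g : 'cV[R]_d -> \bar R.
Hypothesis propg : propere g.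
Hypothesis lscg : lower_semicontinuous g.
Hypothesis scg : strongly_convexe 1 g.
Implicit Types u v x y : 'cV[R]_d.

Local Notation gs := (fun v => fine (conjugate g v)).
Local Notation X := (gradient gs).

Lemma conjugate_argmax u : exists xr : 'cV[R]_d * R,
  [/\ g xr.1 = xr.2%:E, conjugate g u = (dotv u xr.1 - xr.2)%:E &
   forall y b, g y = b%:E ->
    xr.2 + dotv u (y - xr.1) + dotv (y - xr.1) (y - xr.1) / 2 <= b].
Proof.
have [[x r] /= [gx hx]] := strongly_convexe_argmax propg lscg scg u.
exists (x, r); split => //=; apply/eqP; rewrite eq_le; apply/andP; split.
  apply: conjugate_le => y; have [n0 _] := propg; move: (n0 y).
  case E : (g y) => [b||]// _; last by rewrite /= leNye.
  rewrite -EFinB lee_fin; have := hx _ _ E; have := dotv_ge0 (y - x).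
  by rewrite !(dotvDr u) (dotvNr u); lra.
by have := conjugate_ge g x u; rewrite gx -EFinB.
Qed.

(** The maximiser at [u] is a subgradient of the conjugate, and the quadratic growth of g around it
    gives the upper bound. This is 1-smoothness, before any derivative is known to exist. *)
Lemma conjugate_expansion u : exists xr : 'cV[R]_d * R,
  [/\ g xr.1 = xr.2%:E, gs u = dotv u xr.1 - xr.2,
    forall v, gs u + dotv (v - u) xr.1 <= gs v &
    forall v, gs v <= gs u + dotv (v - u) xr.1 + dotv (v - u) (v - u) / 2].
Proof.
have [[x r] /= [gx gu hx]] := conjugate_argmax u.
exists (x, r); split => //= [|v|v]; rewrite ?gu//=.
  have [[y b] /= [gy gv hy]] := conjugate_argmax v.
  rewrite gv /=; have := hy _ _ gx; have := dotv_ge0 (x - y).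
  by rewrite !(dotvDl, dotvDr v, dotvNl, dotvNr v); lra.
have [[y b] /= [gy gv hy]] := conjugate_argmax v.
rewrite gv /=; have := hx _ _ gy.
(* This square gives <v - u, y - x> - |y - x|^2 / 2 <= |v - u|^2 / 2. *)
have := dotv_ge0 ((v - u) - (y - x)).
by rewrite dotvBB !(dotvDr (v - u)) !(dotvNr (v - u)) !(dotvDr u) !(dotvNr u)
  !(dotvDl, dotvNl); lra.
Qed.

(** The two bounds squeeze every partial difference quotient to within |h| of the coordinate of [x],
    so the limits that define [gradient] exist and are not default values. *)
Lemma gradient_conjugate_unique u x :
  (forall v, gs u + dotv (v - u) x <= gs v) ->
  (forall v, gs v <= gs u + dotv (v - u) x + dotv (v - u) (v - u) / 2) ->
  X u = x.
Proof.
move=> lo hi; apply/matrixP => j k; rewrite ord1 mxE.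
have de (h : R) : dotv (h *: delta_mx j 0) x = h * x j 0.
  rewrite dotvZl /dotv (bigD1 j)//= !mxE !eqxx mul1r big1 ?addr0// => i ij.
  by rewrite mxE (negbTE ij) mul0r.
have dd (h : R) : dotv (h *: delta_mx j 0) (h *: (delta_mx j 0 : 'cV[R]_d)) = h ^+ 2.
  rewrite dotvZl dotvZr /dotv (bigD1 j)//= !mxE !eqxx mul1r big1 ?addr0 ?mulr1// => i ij.
  by rewrite mxE (negbTE ij) mul0r.
apply: cvg_lim => //; apply/cvgrPdist_le => e e0.
near=> h; have h0 : h != 0 by near: h; exact: nbhs_dnbhs_neq.
have he : `|h| <= e.
  near: h; apply: nbhs_dnbhs; apply/nbhs_ballP; exists e => //= h.
  by rewrite /ball /= sub0r normrN => /ltW.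
have := lo (h *: delta_mx j 0 + u); have := hi (h *: delta_mx j 0 + u).
rewrite addrK de dd => h1 h2.
rewrite -[x j 0](mulKf h0) /GRing.scale /= -mulrBr normrM normfV.
rewrite ler_pdivrMl ?normr_gt0//; apply: (@le_trans _ _ (`|h| * `|h|)); last first.
  by rewrite ler_wpM2l.
rewrite -normrM -expr2 (ger0_norm (sqr_ge0 _)) ler_norml.
have h3 := sqr_ge0 h.
by apply/andP; split; lra.
Unshelve. all: by end_near. Qed.

Lemma reg_gradient_conjugate u : g (X u) = (dotv u (X u) - gs u)%:E.
Proof.
have [[x r] /= [gx gu lo hi]] := conjugate_expansion u.
by rewrite (gradient_conjugate_unique lo hi) gx gu; congr EFin; lra.
Qed.

Lemma conjugate_fine u : conjugate g u = (gs u)%:E.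
Proof. by have [[x r] /= [_ -> _]] := conjugate_argmax u. Qed.

Lemma conjugate_le_gradient u v :
  gs v <= gs u + dotv (v - u) (X u) + dotv (v - u) (v - u) / 2.
Proof.
have [[x r] /= [gx gu lo hi]] := conjugate_expansion u.
by rewrite (gradient_conjugate_unique lo hi).
Qed.

(** Adding the growth inequalities at the two maximisers gives |W|^2 <= <u - v, W> for W = X u - X
    v; the square |u - v - W|^2 >= 0 concludes. *)
Lemma gradient_conjugate_lipschitz u v : dotv (X u - X v) (X u - X v) <= dotv (u - v) (u - v).
Proof.
have key a b : gs a = dotv a (X a) - fine (g (X a)) /\
    fine (g (X a)) + dotv a (X b - X a) + dotv (X b - X a) (X b - X a) / 2
    <= fine (g (X b)).
  have [[x r] /= [gx gu hx]] := conjugate_argmax a.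
  have Xa : X a = x.
    have [[x' r'] /= [gx' gu' lo hi]] := conjugate_expansion a.
    rewrite (gradient_conjugate_unique lo hi).
    have := hx _ _ gx'; move: gu'; rewrite gu /= => e.
    rewrite !(dotvDr a) (dotvNr a) => h.
    apply/eqP; rewrite -subr_eq0 -dotv_eq0 eq_le dotv_ge0 andbT; lra.
  rewrite Xa gx gu /=; split=> //; apply: hx.
  by rewrite reg_gradient_conjugate.
have [_ h1] := key u v; have [_ h2] := key v u.
have e : dotv (X v - X u) (X v - X u) = dotv (X u - X v) (X u - X v).
  by rewrite -(opprB (X u)) dotvNl dotvNr opprK.
rewrite e -(opprB (X u) (X v)) dotvNr in h1.
move: (X u - X v) h1 h2 {e} => W h1 h2.
have := dotv_ge0 ((u - v) - W).
rewrite (dotvBB (u - v)) (dotvDl u (- v) W) (dotvNl v W).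
by move: (dotv (u - v) (u - v)) (dotv u W) (dotv v W) (dotv W W) h1 h2 => a b c w; lra.
Qed.

End ConjugateStronglyConvex.

(** * Uniform index draws and the radii *)

Section IndexMean.
Context {R : realType} {m n : nat}.
Hypothesis m0 : (0 < m)%N.

(** Expectation over one round of independent uniform draws. Finite functions make it a finite sum;
    [integral_index] identifies it with the integral over the noise. *)
Definition index_mean (f : {ffun 'I_n -> 'I_m} -> R) : R :=
  \sum_(i : {ffun 'I_n -> 'I_m}) m%:R^-1 ^+ n * f i.

Definition coord_mean (f : 'I_m -> R) : R := m%:R^-1 * \sum_(j < m) f j.

Let mR : (m%:R : R) != 0. Proof. by rewrite pnatr_eq0 -lt0n. Qed.

Lemma coord_mean_cst (c : R) : coord_mean (fun=> c) = c.
Proof.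
by rewrite /coord_mean sumr_const card_ord -[c *+ m]mulr_natl mulKf.
Qed.

(** Independence of the workers, as distributivity of products over sums. Means of functions of one
    or two coordinates follow by padding with factors 1. *)
Lemma index_mean_prod (F : 'I_n -> 'I_m -> R) :
  index_mean (fun i => \prod_(tau < n) F tau (i tau)) =
  \prod_(tau < n) coord_mean (F tau).
Proof.
rewrite /index_mean -mulr_sumr -bigA_distr_bigA /coord_mean big_split /=.
by rewrite prodr_const card_ord.
Qed.

Lemma index_meanD f1 f2 :
  index_mean (fun i => f1 i + f2 i) = index_mean f1 + index_mean f2.
Proof. by rewrite /index_mean -big_split; apply: eq_bigr => i _; rewrite mulrDr. Qed.

Lemma index_meanZ c f : index_mean (fun i => c * f i) = c * index_mean f.
Proof.
by rewrite /index_mean mulr_sumr; apply: eq_bigr => i _; rewrite mulrCA.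
Qed.

Lemma index_mean_sum (I : Type) (r : seq I) (P : pred I) F :
  index_mean (fun i => \sum_(k <- r | P k) F k i) = \sum_(k <- r | P k) index_mean (F k).
Proof.
rewrite /index_mean exchange_big /=; apply: eq_bigr => i _.
by rewrite mulr_sumr.
Qed.

Lemma index_mean_le f1 f2 : (forall i, f1 i <= f2 i) -> index_mean f1 <= index_mean f2.
Proof.
by move=> h; apply: ler_sum => i _; apply: ler_wpM2l.
Qed.

Lemma index_mean_coord (f : 'I_m -> R) tau :
  index_mean (fun i => f (i tau)) = coord_mean f.
Proof.
have := index_mean_prod (fun s j => if s == tau then f j else 1).
rewrite [RHS](bigD1 tau)//= eqxx [X in _ * X]big1 ?mulr1; last first.
  by move=> s /negbTE ->; rewrite coord_mean_cst.
move=> <-; apply: eq_bigr => i _; congr (_ * _).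
by rewrite (bigD1 tau)//= eqxx big1 ?mulr1// => s /negbTE ->.
Qed.

Lemma index_mean_cst (c : R) : (0 < n)%N -> index_mean (fun=> c) = c.
Proof.
move=> n0; rewrite -[RHS]coord_mean_cst.
exact: (index_mean_coord (fun=> c) (Ordinal n0)).
Qed.

Lemma index_mean_pair (f1 f2 : 'I_m -> R) s tau : s != tau ->
  index_mean (fun i => f1 (i s) * f2 (i tau)) = coord_mean f1 * coord_mean f2.
Proof.
move=> st; have ts : tau != s by rewrite eq_sym.
have := index_mean_prod (fun r j => if r == s then f1 j else if r == tau then f2 j else 1).
rewrite [RHS](bigD1 s)//= eqxx [in RHS](bigD1 tau)//= (negbTE ts) eqxx.
rewrite [X in _ * (_ * X)]big1 ?mulr1; last first.
  by move=> r /andP[/negbTE -> /negbTE ->]; rewrite coord_mean_cst.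
move=> <-; apply: eq_bigr => i _; congr (_ * _).
rewrite (bigD1 s)//= eqxx (bigD1 tau)//= (negbTE ts) eqxx big1 ?mulr1//.
by move=> r /andP[/negbTE -> /negbTE ->].
Qed.

Lemma index_mean_sqr (X : 'I_n -> 'I_m -> R) :
  index_mean (fun i => (\sum_tau X tau (i tau)) ^+ 2) =
  (\sum_tau coord_mean (X tau)) ^+ 2 +
  \sum_tau (coord_mean (fun j => X tau j ^+ 2) - coord_mean (X tau) ^+ 2).
Proof.
have -> : (fun i : {ffun 'I_n -> 'I_m} => (\sum_tau X tau (i tau)) ^+ 2) =
    (fun i => \sum_s \sum_tau X s (i s) * X tau (i tau)).
  by apply/funext => i; rewrite expr2 mulr_suml; apply: eq_bigr => s _; rewrite mulr_sumr.
rewrite index_mean_sum expr2 mulr_suml -big_split /=; apply: eq_bigr => s _.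
rewrite index_mean_sum (bigD1 s)//= [in RHS](bigD1 s)//=.
rewrite (index_mean_coord (fun j => X s j * X s j)).
have -> : \sum_(tau | tau != s) index_mean (fun i => X s (i s) * X tau (i tau)) =
    coord_mean (X s) * \sum_(tau | tau != s) coord_mean (X tau).
  by rewrite mulr_sumr; apply: eq_bigr => tau ts; rewrite index_mean_pair// eq_sym.
have -> : (fun j => X s j ^+ 2) = (fun j => X s j * X s j) by [].
by ring.
Qed.

(** Squared mean plus the sum of the variances, coordinate by coordinate. Covariances of distinct
    workers vanish, which is why [Rmax] will enter the dual estimate divided by n. *)
Lemma index_mean_dotv {d : nat} (c : 'I_n -> 'I_m -> 'cV[R]_d)
    (M : 'I_n -> 'cV[R]_d) :
  (forall tau, M tau = m%:R^-1 *: \sum_(j < m) c tau j) ->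
  index_mean (fun i => dotv (\sum_tau c tau (i tau)) (\sum_tau c tau (i tau))) =
  dotv (\sum_tau M tau) (\sum_tau M tau) +
  \sum_tau (coord_mean (fun j => dotv (c tau j) (c tau j)) - dotv (M tau) (M tau)).
Proof.
move=> hM; pose X k tau j := c tau j k 0.
have XM k tau : coord_mean (X k tau) = M tau k 0.
  by rewrite hM mxE summxE.
have -> : (fun i : {ffun 'I_n -> 'I_m} =>
      dotv (\sum_tau c tau (i tau)) (\sum_tau c tau (i tau))) =
    (fun i => \sum_(k < d) (\sum_tau X k tau (i tau)) ^+ 2).
  by apply/funext => i; apply: eq_bigr => k _; rewrite summxE expr2.
rewrite index_mean_sum /=.
under eq_bigr do rewrite index_mean_sqr.
rewrite big_split /=; congr (_ + _).
  by apply: eq_bigr => k _; rewrite expr2 summxE; under eq_bigr do rewrite XM.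
rewrite exchange_big /=; apply: eq_bigr => tau _.
rewrite big_split /= sumrN; congr (_ - _); last first.
  by apply: eq_bigr => k _; rewrite XM expr2.
rewrite /coord_mean -mulr_sumr exchange_big /=; congr (_ * _).
Qed.

Lemma index_mean_dotvl {d : nat} (c : 'I_m -> 'cV[R]_d) tau (y : 'cV[R]_d) :
  index_mean (fun i => dotv (c (i tau)) y) = dotv (m%:R^-1 *: \sum_(j < m) c j) y.
Proof.
by rewrite (index_mean_coord (fun j => dotv (c j) y)) dotvZl dotv_suml.
Qed.

End IndexMean.

(** * Operator bounds in terms of the three radii *)

Section Radii.
Context {R : realType} {m n d t : nat} (pb : erm_data R m n d t).
Hypothesis m0 : (0 < m)%N.
Hypothesis n0 : (0 < n)%N.
Variable w : 'I_m -> 'I_n -> 'cV[R]_t.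

Let N : R := @nfun R m n.

Lemma nfun_gt0 : 0 < N. Proof. by rewrite ltr0n muln_gt0 m0. Qed.

Lemma Rmax_ge0 : 0 <= Rmax pb.
Proof. by apply: bigmax_ge_id. Qed.

Lemma Rmax_bound i tau x :
  dotv (mat pb i tau *m x) (mat pb i tau *m x) <= Rmax pb ^+ 2 * dotv x x.
Proof.
apply: (le_trans (spectral_normP _ _)); rewrite ler_wpM2r ?dotv_ge0//.
rewrite ler_sqr ?nnegrE ?spectral_norm_ge0 ?Rmax_ge0//.
apply: le_trans; last exact: (le_bigmax _ _ i).
exact: (le_bigmax _ _ tau).
Qed.

Lemma Rbar_bound tau :
  dotv (\sum_(i < m) mat pb i tau *m w i tau) (\sum_(i < m) mat pb i tau *m w i tau)
  <= m%:R * Rbar pb ^+ 2 * \sum_(i < m) dotv (w i tau) (w i tau).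
Proof.
have mR : 0 < (m%:R : R) by rewrite ltr0n.
apply: dotv_sum_lambda_max; first by rewrite mulr_ge0 ?sqr_ge0// ltW.
rewrite sqr_sqrtr; last exact: bigmax_ge_id.
rewrite -ler_pdivrMl//.
exact: (le_bigmax _ (fun tau => m%:R^-1 *
  lambda_max (\sum_(i < m) mat pb i tau *m (mat pb i tau)^T)) tau).
Qed.

Lemma Rall_bound :
  dotv (\sum_(tau < n) \sum_(i < m) mat pb i tau *m w i tau)
       (\sum_(tau < n) \sum_(i < m) mat pb i tau *m w i tau)
  <= N * Rall pb ^+ 2 * \sum_(tau < n) \sum_(i < m) dotv (w i tau) (w i tau).
Proof.
have N0 := nfun_gt0.
rewrite (pair_bigA _ (fun tau i => mat pb i tau *m w i tau)).
rewrite (pair_bigA _ (fun tau i => dotv (w i tau) (w i tau))) /=; apply: (dotv_sum_lambda_max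
  (A := fun p : 'I_n * 'I_m => mat pb p.2 p.1) (fun p => w p.2 p.1)).
  by rewrite mulr_ge0 ?sqr_ge0// ltW.
rewrite -ler_pdivrMl// -(pair_bigA _ (fun tau i => mat pb i tau *m (mat pb i tau)^T)) /=.
rewrite -/N /Rall; set x := _ * _.
(* [Num.sqrt] is 0 on negative numbers, and then the square on the right dominates trivially. *)
have [x0|x0] := leP 0 x; first by rewrite sqr_sqrtr.
by apply: le_trans (sqr_ge0 _); exact: ltW.
Qed.

End Radii.

(** * One step of the algorithm *)

Section OneStep.
Context {R : realType} {m n d t : nat} (pb : erm_data R m n d t).
Variables (gamma delta theta rho B : R).
Hypotheses (m0 : (0 < m)%N) (n0 : (0 < n)%N) (gamma0 : 0 < gamma).
Hypothesis loss_convex : forall i tau, convex_function setT (loss pb i tau).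
Hypothesis loss_smooth : forall i tau, smooth (1 / gamma) (loss pb i tau).
Hypothesis propg : propere (reg pb).
Hypothesis lscg : lower_semicontinuous (reg pb).
Hypothesis scg : strongly_convexe 1 (reg pb).
Hypotheses (delta0 : 0 < delta) (delta1 : delta < 1) (lam0 : 0 < lam pb).

Definition reg_conj (v : 'cV[R]_d) : R := fine (conjugate (reg pb) v).
Definition loss_conj i tau (y : 'cV[R]_t) : R :=
  fine (conjugate (EFin \o loss pb i tau) y).
Definition dual_real (alpha : 'I_m -> 'I_n -> 'cV[R]_t) : R :=
  - (lam pb * reg_conj (dual_average pb alpha))
  - (@nfun R m n)^-1 * \sum_(tau < n) \sum_(i < m) loss_conj i tau (- alpha i tau).
(** [fine] sends infinite values to 0, so [dual_real] agrees with [dual] only on points of this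
    kind. *)
Definition dual_finite (alpha : 'I_m -> 'I_n -> 'cV[R]_t) : Prop :=
  forall i tau, conjugate (EFin \o loss pb i tau) (- alpha i tau) =
    (loss_conj i tau (- alpha i tau))%:E.

(** The primal value at x = grad_conj_reg u, where reg x is written through the Fenchel equality as
    <u, x> - reg_conj u, which makes it a real number. *)
Definition primal_at (u : 'cV[R]_d) : R :=
  let x := grad_conj_reg pb u in
  (@nfun R m n)^-1 * \sum_(tau < n) \sum_(i < m) loss pb i tau ((mat pb i tau)^T *m x)
  + lam pb * (dotv u x - reg_conj u).

Definition target (u : 'cV[R]_d) i tau : 'cV[R]_t :=
  - gradient (loss pb i tau) ((mat pb i tau)^T *m grad_conj_reg pb u).

(** With [w] the difference target - alpha, the sampled block becomes a convex combination of itself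
    and its target, of weight theta / p = theta m. *)
Definition dual_update (alpha w : 'I_m -> 'I_n -> 'cV[R]_t)
    (i : 'I_n -> 'I_m) j tau : 'cV[R]_t :=
  if j == i tau then alpha j tau + (theta * m%:R) *: w j tau else alpha j tau.

Definition increment (w : 'I_m -> 'I_n -> 'cV[R]_t) j tau : 'cV[R]_d :=
  (lam pb * m%:R)^-1 *: (mat pb j tau *m ((theta * m%:R) *: w j tau)).

Let l := lam pb.
Let N : R := @nfun R m n.
Let mR : 0 < (m%:R : R). Proof. by rewrite ltr0n. Qed.
Let nR : 0 < (n%:R : R). Proof. by rewrite ltr0n. Qed.
Let N0 : 0 < N. Proof. exact: nfun_gt0. Qed.
Let NE : N = m%:R * n%:R. Proof. by rewrite /N /nfun natrM. Qed.

(** The conjugate of a finite function is never -oo, so a finite upper bound makes it real. *)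
Lemma loss_conj_finite i tau y a :
  (conjugate (EFin \o loss pb i tau) y <= a%:E)%E ->
  conjugate (EFin \o loss pb i tau) y = (loss_conj i tau y)%:E /\ loss_conj i tau y <= a.
Proof.
have := conjugate_ge (EFin \o loss pb i tau) 0 y; rewrite /loss_conj.
case: (conjugate _ y) => [b||] //=.
Qed.

Lemma loss_conj_target u i tau :
  conjugate (EFin \o loss pb i tau) (- target u i tau) =
    (loss_conj i tau (- target u i tau))%:E /\
  loss_conj i tau (- target u i tau) =
    - dotv (mat pb i tau *m target u i tau) (grad_conj_reg pb u)
    - loss pb i tau ((mat pb i tau)^T *m grad_conj_reg pb u).
Proof.
have g1 : 0 <= 1 / gamma by rewrite divr_ge0// ltW.
rewrite /loss_conj /target opprK (conjugate_gradient _ (loss_convex i tau) (loss_smooth i tau) g1).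
by split=> //=; rewrite dotv_mull dotvNl opprK.
Qed.

Section AtState.
Variables (alpha : 'I_m -> 'I_n -> 'cV[R]_t) (e : 'I_n -> 'cV[R]_d).
Hypothesis falpha : dual_finite alpha.
Hypotheses (theta0 : 0 < theta) (theta1 : theta * m%:R <= 1).

Let ub := dual_average pb alpha.
Let ebar : 'cV[R]_d := n%:R^-1 *: \sum_tau e tau.
(** The value of [u] along the algorithm: the dual average minus what the compressors still hold
    back (see [ec_invariant]). *)
Let u := ub - ebar.
Let x := grad_conj_reg pb u.
Let beta := target u.
Let w j tau := beta j tau - alpha j tau.
Let s := theta * m%:R.
Let s0 : 0 < s. Proof. exact: mulr_gt0. Qed.
Let s01 : 0 <= s <= 1. Proof. by rewrite ltW. Qed.

Lemma loss_conj_update j tau :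
  conjugate (EFin \o loss pb j tau) (- (alpha j tau + s *: w j tau)) =
    (loss_conj j tau (- (alpha j tau + s *: w j tau)))%:E /\
  loss_conj j tau (- (alpha j tau + s *: w j tau)) <=
  s * loss_conj j tau (- beta j tau) + (1 - s) * loss_conj j tau (- alpha j tau)
    - gamma / 2 * (s * (1 - s)) * dotv (w j tau) (w j tau).
Proof.
apply: loss_conj_finite.
have [fb _] := loss_conj_target u j tau.
have -> : - (alpha j tau + s *: w j tau) = s *: (- beta j tau) + (1 - s) *: (- alpha j tau).
  rewrite /w; move: (beta j tau) (alpha j tau) => a b.
  by apply/matrixP => p q; rewrite !mxE; ring.
have -> : dotv (w j tau) (w j tau) =
    dotv (- beta j tau - - alpha j tau) (- beta j tau - - alpha j tau).
  by rewrite -opprB opprK dotvNl dotvNr opprK /w addrC.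
apply: conjugate_strongly_convex => //.
  by rewrite fb.
by rewrite falpha.
Qed.

Lemma dual_update_finite (i : 'I_n -> 'I_m) : dual_finite (dual_update alpha w i).
Proof.
move=> j tau; rewrite /dual_update; case: ifP => _; last exact: falpha.
by case: (loss_conj_update j tau).
Qed.

(** Block j is drawn with probability 1 / m and then moves with weight s = theta m, so on average it
    moves with weight theta. *)
Lemma mean_loss_conj_update j tau :
  index_mean (fun i => loss_conj j tau (- dual_update alpha w i j tau)) <=
  loss_conj j tau (- alpha j tau) + theta * (loss_conj j tau (- beta j tau)
    - loss_conj j tau (- alpha j tau)
    - gamma / 2 * (1 - s) * dotv (w j tau) (w j tau)).
Proof.
set a := loss_conj j tau (- alpha j tau).
set b := loss_conj j tau (- (alpha j tau + s *: w j tau)).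
have -> : (fun i : {ffun 'I_n -> 'I_m} => loss_conj j tau (- dual_update alpha w i j tau))
    = (fun i => (fun k => a + (if k == j then b - a else 0)) (i tau)).
  apply/funext => i; rewrite /dual_update eq_sym; case: ifP => _; last by rewrite addr0.
  by rewrite [RHS]addrC subrK.
rewrite (index_mean_coord m0 (fun k => a + (if k == j then b - a else 0))).
have [_] := loss_conj_update j tau; rewrite -/a -/b => hb.
rewrite /coord_mean big_split /= -big_mkcond big_pred1_eq /= sumr_const card_ord.
rewrite -[a *+ m]mulr_natl mulrDr mulKf ?gt_eqF// lerD2l.
rewrite ler_pdivrMl//; move: hb; rewrite -/s.
have -> : m%:R * (theta * (loss_conj j tau (- beta j tau) - a -
   gamma / 2 * (1 - s) * dotv (w j tau) (w j tau))) =
  s * (loss_conj j tau (- beta j tau) - a -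
   gamma / 2 * (1 - s) * dotv (w j tau) (w j tau)) by rewrite /s; ring.
by lra.
Qed.

Lemma dual_average_update (i : 'I_n -> 'I_m) :
  dual_average pb (dual_update alpha w i) =
  ub + n%:R^-1 *: \sum_tau increment w (i tau) tau.
Proof.
rewrite /ub /dual_average -/l -/N.
have -> : \sum_(tau < n) \sum_(j < m) mat pb j tau *m dual_update alpha w i j tau =
   \sum_(tau < n) \sum_(j < m) mat pb j tau *m alpha j tau +
   \sum_(tau < n) mat pb (i tau) tau *m (s *: w (i tau) tau).
  rewrite -big_split; apply: eq_bigr => tau _ /=.
  rewrite (bigD1 (i tau))//= [in RHS](bigD1 (i tau))//= /dual_update eqxx mulmxDr -/s.
  rewrite addrAC; congr (_ + _ + _).
  by apply: eq_bigr => j /negbTE ->.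
rewrite scalerDr; congr (_ + _).
rewrite !scaler_sumr; apply: eq_bigr => tau _.
rewrite /increment scalerA -/s -/l; congr (_ *: _).
by rewrite NE !invfM; ring.
Qed.

Lemma incrementE j tau : increment w j tau = (theta / l) *: (mat pb j tau *m w j tau).
Proof.
rewrite /increment -scalemxAr scalerA; congr (_ *: _).
by rewrite -/l; field; rewrite !gt_eqF.
Qed.

(** [V] and [VV] are mean squared distances to the target, per worker and overall; [M] and [hbar]
    are the mean moves of one worker and of the dual average; [S] is a second moment. *)
Let V tau := m%:R^-1 * \sum_(j < m) dotv (w j tau) (w j tau).
Let VV := n%:R^-1 * \sum_tau V tau.
Let M tau : 'cV[R]_d := m%:R^-1 *: \sum_(j < m) increment w j tau.
Let hbar : 'cV[R]_d := n%:R^-1 *: \sum_tau M tau.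
Let S tau := coord_mean (fun j => dotv (increment w j tau) (increment w j tau)).

Lemma V_ge0 tau : 0 <= V tau.
Proof. by rewrite mulr_ge0 ?invr_ge0// sumr_ge0// => j _; exact: dotv_ge0. Qed.

Lemma VVE : VV = N^-1 * \sum_(tau < n) \sum_(j < m) dotv (w j tau) (w j tau).
Proof. by rewrite /VV -mulr_sumr mulrA NE invfM (mulrC m%:R^-1). Qed.

Lemma hbarE : hbar = (theta / (l * N)) *:
  \sum_(tau < n) \sum_(j < m) mat pb j tau *m w j tau.
Proof.
rewrite /hbar !scaler_sumr; apply: eq_bigr => tau _.
rewrite /M !scaler_sumr; apply: eq_bigr => j _.
rewrite incrementE !scalerA; congr (_ *: _).
by rewrite NE; field; rewrite !gt_eqF.
Qed.

Lemma hbar_bound : dotv hbar hbar <= (theta / l) ^+ 2 * Rall pb ^+ 2 * VV.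
Proof.
rewrite hbarE dotvZl dotvZr mulrA VVE.
apply: (@le_trans _ _ (theta / (l * N) * (theta / (l * N)) *
  (N * Rall pb ^+ 2 * \sum_(tau < n) \sum_(i < m) dotv (w i tau) (w i tau)))).
  by apply: ler_wpM2l; [rewrite -expr2 sqr_ge0|exact: Rall_bound].
by rewrite le_eqVlt; apply/orP; left; apply/eqP; field; rewrite !gt_eqF.
Qed.

Lemma M_bound tau : dotv (M tau) (M tau) <= (theta / l) ^+ 2 * Rbar pb ^+ 2 * V tau.
Proof.
have -> : M tau = (theta / l / m%:R) *: \sum_(j < m) mat pb j tau *m w j tau.
  rewrite /M !scaler_sumr; apply: eq_bigr => j _.
  by rewrite incrementE scalerA mulrC.
rewrite dotvZl dotvZr mulrA.
apply: (@le_trans _ _ (theta / l / m%:R * (theta / l / m%:R) *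
  (m%:R * Rbar pb ^+ 2 * \sum_(i < m) dotv (w i tau) (w i tau)))).
  by apply: ler_wpM2l; [rewrite -expr2 sqr_ge0|exact: Rbar_bound].
by rewrite /V le_eqVlt; apply/orP; left; apply/eqP; field; rewrite !gt_eqF.
Qed.

Lemma S_bound tau : S tau <= (theta / l) ^+ 2 * Rmax pb ^+ 2 * V tau.
Proof.
rewrite /S /coord_mean /V mulrCA ler_wpM2l ?invr_ge0// mulr_sumr.
apply: ler_sum => j _; rewrite incrementE dotvZl dotvZr mulrA -expr2 -(mulrA _ (Rmax pb ^+ 2)).
by apply: ler_wpM2l; [exact: sqr_ge0|exact: Rmax_bound].
Qed.

(** Smoothness of the conjugate applied to the random move of the dual average. Its second moment is
    |hbar|^2 plus variances, from which the negative terms in |M tau|^2 are dropped. *)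
Lemma mean_reg_conj_update :
  index_mean (fun i => reg_conj (dual_average pb (dual_update alpha w i))) <=
  reg_conj ub + dotv hbar (grad_conj_reg pb ub) +
  (dotv hbar hbar + n%:R^-1 ^+ 2 * \sum_tau S tau) / 2.
Proof.
pose H (i : {ffun 'I_n -> 'I_m}) : 'cV[R]_d := \sum_tau increment w (i tau) tau.
apply: (@le_trans _ _ (index_mean (fun i => reg_conj ub +
  (n%:R^-1 * dotv (H i) (grad_conj_reg pb ub) + n%:R^-1 ^+ 2 / 2 * dotv (H i) (H i))))).
  apply: index_mean_le => i; rewrite dual_average_update -/(H i).
  have := conjugate_le_gradient propg lscg scg ub (ub + n%:R^-1 *: H i).
  have -> : ub + n%:R^-1 *: H i - ub = n%:R^-1 *: H i by rewrite addrC addKr.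
  rewrite !dotvZl dotvZr -/(reg_conj _) -/(reg_conj ub).
  rewrite -/(grad_conj_reg pb ub).
  by lra.
rewrite index_meanD index_mean_cst// index_meanD !index_meanZ.
rewrite (index_mean_dotv m0 (c := fun tau j => increment w j tau) (M := M))//.
have -> : index_mean (fun i => dotv (H i) (grad_conj_reg pb ub)) =
    dotv (\sum_tau M tau) (grad_conj_reg pb ub).
  have -> : (fun i => dotv (H i) (grad_conj_reg pb ub)) = (fun i : {ffun 'I_n -> 'I_m} =>
     \sum_tau dotv (increment w (i tau) tau) (grad_conj_reg pb ub)).
    by apply/funext => i; rewrite dotv_suml.
  rewrite index_mean_sum dotv_suml; apply: eq_bigr => tau _.
  by rewrite (index_mean_dotvl m0 (fun j => increment w j tau)).
rewrite sumrB.
have : 0 <= \sum_tau dotv (M tau) (M tau) by apply: sumr_ge0 => tau _; exact: dotv_ge0.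
move=> h; have := mulr_ge0 (sqr_ge0 n%:R^-1) h.
by rewrite /hbar !dotvZl dotvZr -/(S _); lra.
Qed.

(** Only the mean move [M] meets e in the cross term, so Young's factor 2 / delta falls on [Rbar]
    and not on [Rmax]; this gives a1 / delta. The weight delta / 2 is chosen for (1 - delta) (1 +
    delta / 2) <= 1 - delta / 2. *)
Lemma mean_error_update tau :
  (1 - delta) * index_mean (fun i =>
     dotv (e tau + increment w (i tau) tau) (e tau + increment w (i tau) tau)) <=
  (1 - delta / 2) * dotv (e tau) (e tau) +
  (theta / l) ^+ 2 * a1 pb delta / delta * V tau.
Proof.
rewrite (index_mean_coord m0 (fun j => dotv (e tau + increment w j tau) (e tau + increment w j tau))).
have -> : coord_mean (fun j => dotv (e tau + increment w j tau) (e tau + increment w j tau)) =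
    dotv (e tau) (e tau) + 2 * dotv (e tau) (M tau) + S tau.
  rewrite /coord_mean; under eq_bigr do rewrite dotvDD.
  rewrite !big_split /= !mulrDr sumr_const card_ord -[dotv _ _ *+ m]mulr_natl mulKf ?gt_eqF//.
  by rewrite -mulr_sumr /M dotvZr dotv_sumr mulrCA.
have hM := M_bound tau; have hS := S_bound tau.
have y := dotv_young (e tau) (M tau) (divr_gt0 delta0 (ltr0n R 2)).
rewrite invfM invrK in y.
set E := dotv (e tau) (e tau) in y *; set MM := dotv (M tau) (M tau) in y hM *.
have E0 : 0 <= E := dotv_ge0 _.
rewrite /a1.
set q := (theta / l) ^+ 2 in hM hS *; set rb := Rbar pb ^+ 2 in hM *; set rm := Rmax pb ^+ 2 in hS *.
have h1 : 2 * dotv (e tau) (M tau) <= delta / 2 * E + delta^-1 * 2 * (q * rb * V tau).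
  apply: (le_trans y); rewrite lerD2l ler_wpM2l// mulr_ge0// invr_ge0 ltW//.
have d10 : 0 <= 1 - delta by rewrite subr_ge0 ltW.
have h2 := ler_wpM2l d10 (lerD (lerD (lexx E) h1) hS).
apply: (le_trans h2).
have -> : q * ((1 - delta) * (2 * rb + delta * rm)) / delta * V tau =
  (1 - delta) * (delta^-1 * 2 * (q * rb * V tau) + q * rm * V tau).
  by field; rewrite gt_eqF.
have : 0 <= delta * (delta * E) by rewrite !mulr_ge0// ltW.
by lra.
Qed.

(** The empirical variance of the errors is nonnegative. *)
Lemma ebar_sqr_le : dotv ebar ebar <= n%:R^-1 * \sum_tau dotv (e tau) (e tau).
Proof.
have h : 0 <= \sum_tau dotv (e tau - ebar) (e tau - ebar).
  by apply: sumr_ge0 => tau _; exact: dotv_ge0.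
have E : \sum_tau e tau = n%:R *: ebar by rewrite /ebar scalerA mulfV ?gt_eqF// scale1r.
move: h; under eq_bigr do rewrite dotvBB.
rewrite !big_split /= sumrN -mulr_sumr -dotv_suml E dotvZl sumr_const card_ord.
rewrite -[dotv _ _ *+ n]mulr_natl ler_pdivlMl//; lra.
Qed.

Hypothesis rho0 : 0 < rho.
Hypothesis BE : B = 2 * (rho + theta * l) / delta.
Hypothesis bracket :
  theta ^+ 2 / (2 * l) * Rall pb ^+ 2 + theta ^+ 2 / (2 * l * n%:R) * Rmax pb ^+ 2
  + theta ^+ 2 * Rall pb ^+ 2 / (2 * rho) + B * theta ^+ 2 * a1 pb delta / (delta * l ^+ 2)
  <= theta * gamma / 2 * (1 - theta * m%:R).

(** The error contracts by 1 - delta / 2 and half of that gain is spent: [B] is chosen so that B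
    delta / 4 = (rho + theta lambda) / 2 pays for the two terms in |ebar|^2. [bracket] compares the
    coefficients of [VV]. *)
Lemma one_step :
  index_mean (fun i => - dual_real (dual_update alpha w i) +
     B / n%:R * \sum_tau (1 - delta) *
       dotv (e tau + increment w (i tau) tau) (e tau + increment w (i tau) tau))
  + theta * primal_at u
  <= (1 - theta) * - dual_real alpha
     + (1 - delta / 4) * (B / n%:R * \sum_tau dotv (e tau) (e tau)).
Proof.
set Phi := N^-1 * \sum_(tau < n) \sum_(i < m) loss_conj i tau (- alpha i tau).
set PT := N^-1 * \sum_(tau < n) \sum_(i < m) dotv (mat pb i tau *m beta i tau) x.
set PL := N^-1 * \sum_(tau < n) \sum_(i < m) loss pb i tau ((mat pb i tau)^T *m x).
set G := n%:R^-1 * \sum_tau dotv (e tau) (e tau).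
have mean_dual : index_mean (fun i => - dual_real (dual_update alpha w i)) =
    l * index_mean (fun i => reg_conj (dual_average pb (dual_update alpha w i))) +
    N^-1 * \sum_(tau < n) \sum_(j < m)
      index_mean (fun i => loss_conj j tau (- dual_update alpha w i j tau)).
  have -> : (fun i : {ffun 'I_n -> 'I_m} => - dual_real (dual_update alpha w i)) =
     (fun i => l * reg_conj (dual_average pb (dual_update alpha w i)) +
     N^-1 * \sum_(tau < n) \sum_(j < m) loss_conj j tau (- dual_update alpha w i j tau)).
    by apply/funext => i; rewrite /dual_real opprB opprK addrC.
  rewrite index_meanD !index_meanZ index_mean_sum; congr (_ + _ * _).
  by apply: eq_bigr => tau _; rewrite index_mean_sum.
have mean_err : index_mean (fun i : {ffun 'I_n -> 'I_m} => B / n%:R * \sum_tau (1 - delta) *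
       dotv (e tau + increment w (i tau) tau) (e tau + increment w (i tau) tau)) <=
    B * ((1 - delta / 2) * G + (theta / l) ^+ 2 * a1 pb delta / delta * VV).
  rewrite index_meanZ index_mean_sum -mulrA; apply: ler_wpM2l.
    by rewrite BE divr_ge0 ?(ltW delta0)// mulr_ge0// addr_ge0 ?mulr_ge0// ltW.
  have -> : (1 - delta / 2) * G + (theta / l) ^+ 2 * a1 pb delta / delta * VV =
     n%:R^-1 * \sum_tau ((1 - delta / 2) * dotv (e tau) (e tau) +
         (theta / l) ^+ 2 * a1 pb delta / delta * V tau).
    have lin (F1 F2 : 'I_n -> R) a b : n%:R^-1 * (\sum_tau (a * F1 tau + b * F2 tau)) =
        a * (n%:R^-1 * \sum_tau F1 tau) + b * (n%:R^-1 * \sum_tau F2 tau).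
      by rewrite big_split /= -!mulr_sumr; ring.
    by rewrite lin.
  rewrite ler_wpM2l ?invr_ge0//; apply: ler_sum => tau _; rewrite index_meanZ.
  exact: mean_error_update.
have mean_loss : N^-1 * (\sum_(tau < n) \sum_(j < m)
      index_mean (fun i => loss_conj j tau (- dual_update alpha w i j tau))) <=
    Phi + theta * (- PT - PL - Phi - gamma / 2 * (1 - s) * VV).
  rewrite VVE.
  have -> : Phi + theta * (- PT - PL - Phi - gamma / 2 * (1 - s) *
       (N^-1 * \sum_(tau < n) \sum_(j < m) dotv (w j tau) (w j tau))) =
    N^-1 * \sum_(tau < n) \sum_(j < m) (loss_conj j tau (- alpha j tau) +
     theta * (- dotv (mat pb j tau *m beta j tau) x - loss pb j tau ((mat pb j tau)^T *m x)
      - loss_conj j tau (- alpha j tau) - gamma / 2 * (1 - s) * dotv (w j tau) (w j tau))).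
    under [in RHS]eq_bigr => tau _.
      rewrite big_split /= -mulr_sumr !big_split /= !sumrN -mulr_sumr.
      over.
    rewrite big_split /= -mulr_sumr !big_split /= !sumrN -mulr_sumr.
    by rewrite /Phi /PT /PL; ring.
  rewrite ler_wpM2l ?invr_ge0 ?(ltW N0)//.
  apply: ler_sum => tau _; apply: ler_sum => j _.
  have [_ h] := loss_conj_target u j tau.
  by rewrite -/x -/(beta j tau) in h; rewrite -h; exact: mean_loss_conj_update.
(* The term [PT] produced here cancels the one in [mean_loss], which comes from the Fenchel equality
   at the targets; what remains assembles into [primal_at u] and the dual value. *)
have lhx : l * dotv hbar x = theta * (PT - l * dotv ub x).
  rewrite hbarE dotvZl /ub /dual_average dotvZl.
  have -> : \sum_(tau < n) \sum_(j < m) mat pb j tau *m w j tau =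
     \sum_(tau < n) \sum_(j < m) mat pb j tau *m beta j tau -
     \sum_(tau < n) \sum_(j < m) mat pb j tau *m alpha j tau.
    rewrite -sumrB; apply: eq_bigr => tau _; rewrite -sumrB; apply: eq_bigr => j _.
    by rewrite /w mulmxBr.
  rewrite dotvDl dotvNl /PT.
  have -> : \sum_(tau < n) \sum_(i < m) dotv (mat pb i tau *m beta i tau) x =
      dotv (\sum_(tau < n) \sum_(i < m) mat pb i tau *m beta i tau) x.
    by rewrite dotv_suml; apply: eq_bigr => tau _; rewrite dotv_suml.
  by rewrite -/l -/N; field; rewrite !gt_eqF.
(* The descent direction is the gradient of the conjugate at [ub], but the targets were computed
   from [x], its gradient at [u]; the Lipschitz bound turns the mismatch into |ebar|^2. *)
have cross : l * dotv hbar (grad_conj_reg pb ub - x) <=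
    rho / 2 * dotv ebar ebar + l ^+ 2 / (2 * rho) * dotv hbar hbar.
  have y := dotv_young (grad_conj_reg pb ub - x) (l *: hbar) rho0.
  have := gradient_conjugate_lipschitz propg lscg scg ub u.
  rewrite -/(grad_conj_reg pb ub) -/(grad_conj_reg pb u) -/x.
  have -> : ub - u = ebar by rewrite /u opprB addrC subrK.
  move=> /(ler_wpM2l (ltW rho0)) lip.
  rewrite (dotvZl l hbar) !(dotvZr l) (dotvC _ hbar) in y.
  have -> : l ^+ 2 / (2 * rho) * dotv hbar hbar = rho^-1 * (l * (l * dotv hbar hbar)) / 2.
    by field; rewrite gt_eqF.
  by move: lip y; lra.
have hub : dotv ub x = dotv u x + dotv ebar x.
  by rewrite /u dotvDl dotvNl subrK.
(* Second cost of the compression: [primal_at] involves reg_conj at [u], the dual value at [ub]. *)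
have hgu : reg_conj ub <= reg_conj u + dotv ebar x + dotv ebar ebar / 2.
  have := conjugate_le_gradient propg lscg scg u ub.
  by have -> : ub - u = ebar by rewrite /u opprB addrC subrK.
have hreg := mean_reg_conj_update.
rewrite -[grad_conj_reg pb ub](subrK x) dotvDr in hreg.
have hS : n%:R^-1 ^+ 2 * (\sum_tau S tau) <= (theta / l) ^+ 2 * Rmax pb ^+ 2 / n%:R * VV.
  have h : \sum_tau S tau <= (theta / l) ^+ 2 * Rmax pb ^+ 2 * \sum_tau V tau.
    by rewrite mulr_sumr; apply: ler_sum => tau _; exact: S_bound.
  apply: (le_trans (ler_wpM2l (sqr_ge0 _) h)).
  by rewrite le_eqVlt; apply/orP; left; apply/eqP; rewrite /VV; field; rewrite !gt_eqF.
have VV0 : 0 <= VV.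
  by rewrite mulr_ge0 ?invr_ge0// sumr_ge0// => tau _; exact: V_ge0.
have hG := ebar_sqr_le.
rewrite -/G in hG.
have hh := hbar_bound.
have l0 : 0 < l := lam0.
have br := ler_wpM2r VV0 bracket.
rewrite index_meanD mean_dual.
have k1 := ler_wpM2l (ltW l0) hreg.
have k2 := ler_wpM2l (ltW l0) hS.
have k3 := ler_wpM2l (ltW l0) hh.
have k4 : l ^+ 2 / (2 * rho) * dotv hbar hbar <= theta ^+ 2 * Rall pb ^+ 2 / (2 * rho) * VV.
  have c0 : 0 <= l ^+ 2 / (2 * rho) by rewrite divr_ge0 ?sqr_ge0// mulr_ge0// ltW.
  apply: (le_trans (ler_wpM2l c0 hh)).
  by rewrite le_eqVlt; apply/orP; left; apply/eqP; field; rewrite !gt_eqF.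
have k5 := ler_wpM2l (ltW (mulr_gt0 theta0 l0)) hgu.
have rt0 : 0 <= rho + theta * l by rewrite addr_ge0 ?mulr_ge0// ltW.
have k6 := ler_wpM2l rt0 hG.
have eB : B / n%:R * (\sum_tau dotv (e tau) (e tau)) = B * G by rewrite mulrA.
have eBd : B * (delta / 4 * G) = (rho + theta * l) / 2 * G.
  by rewrite BE; field; rewrite gt_eqF.
have e2 : l * ((theta / l) ^+ 2 * Rall pb ^+ 2 * VV) = theta ^+ 2 / l * Rall pb ^+ 2 * VV.
  by field; rewrite gt_eqF.
have e3 : l * ((theta / l) ^+ 2 * Rmax pb ^+ 2 / n%:R * VV) =
    theta ^+ 2 / (l * n%:R) * Rmax pb ^+ 2 * VV.
  by field; rewrite !gt_eqF.
have e4 : B * ((theta / l) ^+ 2 * a1 pb delta / delta * VV) =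
   B * theta ^+ 2 * a1 pb delta / (delta * l ^+ 2) * VV.
  by field; rewrite !gt_eqF.
rewrite e2 in k3; rewrite e3 in k2.
rewrite mulrDr e4 in mean_err.
have br' : theta ^+ 2 / l * Rall pb ^+ 2 * VV / 2 + theta ^+ 2 / (l * n%:R) * Rmax pb ^+ 2 * VV / 2 +
   theta ^+ 2 * Rall pb ^+ 2 / (2 * rho) * VV + B * theta ^+ 2 * a1 pb delta / (delta * l ^+ 2) * VV
   <= theta * (gamma / 2 * (1 - s) * VV).
  apply: le_trans (le_trans br _); rewrite le_eqVlt; apply/orP; left; apply/eqP.
    by field; rewrite !gt_eqF// ?mulr_gt0//.
  by rewrite /s; ring.
rewrite /primal_at -/x -/N -/PL eB /dual_real -/ub -/l -/N -/Phi.
rewrite hub in lhx.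
move: mean_loss lhx cross k1 k2 k3 k4 k5 k6 eBd mean_err br'.
move: (N^-1 * (\sum_(tau < n) _)) (index_mean _) (index_mean _) => I1 I2 I3.
move: (n%:R^-1 ^+ 2 * _) (dotv hbar _) (dotv hbar hbar) (dotv hbar x) => q1 q2 q3 q4.
move: (theta ^+ 2 / l * _ * VV) (theta ^+ 2 / (l * n%:R) * _ * VV) => p1 p2.
move: (B * theta ^+ 2 * _ / _ * VV) (_ / (2 * rho) * VV) (_ / (2 * rho) * q3) => p3 p4 p5.
move: (dotv u x) (dotv ebar x) (dotv ebar ebar) (reg_conj ub) (reg_conj u) => r1 r2 r3 r4 r5.
move: Phi PT PL G VV s {mean_dual hub hgu hreg hS VV0 hG hh br e2 e3 e4 eB} => c1 c2 c3 c4 c5 c6.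
by lra.
Qed.

End AtState.
End OneStep.

(** * Step size and rate *)

Section StepSize.
Context {R : realType} {m n d t : nat} (pb : erm_data R m n d t).
Variables gamma delta : R.
Hypotheses (m0 : (0 < m)%N) (n0 : (0 < n)%N) (gamma0 : 0 < gamma).
Hypotheses (delta0 : 0 < delta) (delta1 : delta < 1) (lam0 : 0 < lam pb).
Hypothesis lamR : lam pb <= Rall pb ^+ 2 / gamma.

Let l := lam pb.
Let N : R := @nfun R m n.
Let Ra := Rall pb.
Let Rm := Rmax pb.
Let Rb := Rbar pb.
Let q := Num.sqrt (a1 pb delta).
Let mR : 0 < (m%:R : R). Proof. by rewrite ltr0n. Qed.
Let nR : 0 < (n%:R : R). Proof. by rewrite ltr0n. Qed.
Let NE : N = m%:R * n%:R. Proof. by rewrite /N /nfun natrM. Qed.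
Let l0 : 0 < l. Proof. by []. Qed.

Lemma lam_gamma_le : l * gamma <= Ra ^+ 2.
Proof. by move: lamR; rewrite ler_pdivlMr. Qed.

Lemma Rall_gt0 : 0 < Ra.
Proof.
have := lt_le_trans (mulr_gt0 l0 gamma0) lam_gamma_le.
have : 0 <= Ra by exact: sqrtr_ge0.
by rewrite le_eqVlt => /predU1P[<-|//]; rewrite expr0n ltxx.
Qed.

(** If [Rmax] were 0, all matrices would vanish and so would [Rall], against [Rall_gt0]. *)
Lemma Rmax_gt0 : 0 < Rm.
Proof.
have : 0 <= Rm := Rmax_ge0 pb.
rewrite le_eqVlt => /predU1P[Rm0|//]; exfalso.
have A0 i tau : mat pb i tau = 0.
  apply/matrixP => a b.
  have := Rmax_bound pb i tau (delta_mx b 0).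
  rewrite -/Rm -Rm0 expr0n mul0r => h.
  have : mat pb i tau *m (delta_mx b 0 : 'cV[R]_t) = 0.
    by apply/eqP; rewrite -dotv_eq0 eq_le h dotv_ge0.
  by rewrite -colE => /matrixP /(_ a 0); rewrite !mxE.
have := Rall_gt0; apply/negP; rewrite -leNgt /Ra /Rall.
have -> : \sum_(tau < n) \sum_(i < m) mat pb i tau *m (mat pb i tau)^T = 0.
  by rewrite big1// => tau _; rewrite big1// => i _; rewrite A0 mul0mx.
suff -> : lambda_max (0 : 'M[R]_d) = 0 by rewrite mulr0 sqrtr0.
rewrite /lambda_max; have sub : [set a : R | eigenvalue (0 : 'M[R]_d) a] `<=` [set 0].
  move=> a /= /eigenvalueP[v]; rewrite mulmx0 => av v0'; apply/eqP.
  by move/esym/eqP: av; rewrite scaler_eq0 (negbTE v0') orbF.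
have /subset_set1[->|->] := sub; [exact: sup0|exact: sup1].
Qed.

(** Makes the divisions by the square root of [a1], as in [rho], genuine. It uses delta < 1. *)
Lemma a1_gt0 : 0 < a1 pb delta.
Proof.
rewrite /a1 mulr_gt0 ?subr_gt0// ltr_wpDl//.
  by rewrite mulr_ge0// sqr_ge0.
by rewrite mulr_gt0// exprn_gt0// Rmax_gt0.
Qed.

Let q0 : 0 < q. Proof. by rewrite sqrtr_gt0 a1_gt0. Qed.
Let qq : q ^+ 2 = a1 pb delta. Proof. by rewrite sqr_sqrtr// ltW// a1_gt0. Qed.

Lemma rho_gt0 : 0 < rho pb delta.
Proof. by rewrite /rho !(divr_gt0, mulr_gt0)// Rall_gt0. Qed.

Let D := delta * l * gamma.
Let D0 : 0 < D. Proof. by rewrite !mulr_gt0. Qed.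
Let S := Num.sqrt (delta ^+ 2 * l ^+ 2 * gamma ^+ 2 * m%:R ^+ 2 + 48 * l * gamma * a1 pb delta).
Let S0 : 0 <= S. Proof. exact: sqrtr_ge0. Qed.
Let SS : S ^+ 2 = D ^+ 2 * m%:R ^+ 2 + 48 * l * gamma * q ^+ 2.
Proof.
have e : delta ^+ 2 * l ^+ 2 * gamma ^+ 2 * m%:R ^+ 2 + 48 * l * gamma * a1 pb delta =
    D ^+ 2 * m%:R ^+ 2 + 48 * l * gamma * q ^+ 2 by rewrite qq /D; ring.
have lg : 0 <= 48 * l * gamma by rewrite !mulr_ge0// ltW.
rewrite /S e sqr_sqrtr//; apply: addr_ge0; apply: mulr_ge0 => //; exact: sqr_ge0.
Qed.
Let v0 : 0 <= eso_v pb.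
Proof. by apply: addr_ge0; [exact: sqr_ge0|apply: mulr_ge0 => //; exact: sqr_ge0]. Qed.
Let th := theta_choice pb gamma delta.

Let Nl0 : 0 < N * l * gamma.
Proof. by rewrite !mulr_gt0// nfun_gt0. Qed.
Let p1 : 0 < D * m%:R + S.
Proof. by rewrite ltr_wpDr// mulr_gt0. Qed.
Let p2 : 0 < 3 * eso_v pb + N * l * gamma.
Proof. by rewrite ltr_wpDl// mulr_ge0. Qed.
Let Raq0 : 0 < Ra * q.
Proof. by rewrite mulr_gt0// Rall_gt0. Qed.
Let p3 : 0 < D * m%:R + 12 * Ra * q.
Proof. by rewrite addr_gt0 ?mulr_gt0// Rall_gt0. Qed.

Lemma theta_choice_gt0 : 0 < th.
Proof.
rewrite /th /theta_choice !lt_min /prob_idx -/N -/l -/D -/S -/q -/Ra.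
apply/and3P; split; apply: divr_gt0 => //; first by rewrite !mulr_gt0.
by rewrite mulr_gt0// invr_gt0.
Qed.

Lemma theta_choice_bounds :
  [/\ th * (D * m%:R + S) <= 2 * D, th * (3 * eso_v pb + N * l * gamma) <= n%:R * l * gamma
    & th * (D * m%:R + 12 * Ra * q) <= D].
Proof.
have : th <= th by [].
rewrite {2}/th /theta_choice !le_min /prob_idx -/N -/l -/D -/S -/q -/Ra.
move=> /and3P[h1 h2 h3]; split; rewrite -ler_pdivlMr//.
- by apply: (le_trans h1); rewrite /D !mulrA.
- have <- : N * l * gamma / m%:R = n%:R * l * gamma by rewrite NE; field; rewrite gt_eqF.
  by [].
Qed.

(** With the denominators cleared, an upper bound [c] on 1 / theta only has to be checked on each of
    the three candidates. *)
Lemma theta_choice_ge (c : R) : 0 < c ->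
  D * m%:R + S <= c * (2 * D) -> 3 * eso_v pb + N * l * gamma <= c * (n%:R * l * gamma) ->
  D * m%:R + 12 * Ra * q <= c * D -> 1 <= c * th.
Proof.
move=> c0 h1 h2 h3; rewrite mulrC -ler_pdivrMr// mul1r /th /theta_choice !le_min.
rewrite /prob_idx -/N -/l -/D -/S -/q -/Ra.
have quot num den : 0 < den -> den <= c * num -> c^-1 <= num / den.
  by move=> den0 h; rewrite ler_pdivlMr// ler_pdivrMl.
apply/and3P; split; apply: quot => //.
- by move: h1; rewrite /D !mulrA.
- have -> : N * l * gamma / m%:R = n%:R * l * gamma by rewrite NE; field; rewrite gt_eqF.
  by [].
Qed.

Lemma theta_choice_m : th * m%:R <= 1.
Proof.
have [_ h _] := theta_choice_bounds.
have Nl : 0 < n%:R * l * gamma by rewrite !mulr_gt0.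
rewrite -(ler_pM2r Nl) mul1r; apply: le_trans h.
have : 0 <= th * (3 * eso_v pb) by rewrite !mulr_ge0// ltW// theta_choice_gt0.
by rewrite NE; lra.
Qed.

(** In units of theta gamma (1 - theta m), the terms take 1/6 for [eso_v], 1/12 for each of the two
    terms in [rho] and 1/6 for the part theta lambda of the error weight: exactly 1/2 in total. *)
Lemma theta_choice_bracket :
  th ^+ 2 / (2 * l) * Ra ^+ 2 + th ^+ 2 / (2 * l * n%:R) * Rm ^+ 2
  + th ^+ 2 * Ra ^+ 2 / (2 * rho pb delta)
  + 2 * (rho pb delta + th * l) / delta * th ^+ 2 * a1 pb delta / (delta * l ^+ 2)
  <= th * gamma / 2 * (1 - th * m%:R).
Proof.
have t0 := theta_choice_gt0; have t1 := theta_choice_m.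
have [hS hv hq] := theta_choice_bounds.
(* The first candidate is the positive root of 12 a1 X^2 = delta^2 lambda gamma (1 - m X), with its
   numerator rationalised. *)
have h1 : 12 * th ^+ 2 * q ^+ 2 <= delta ^+ 2 * l * gamma * (1 - th * m%:R).
  have hS' : th * S <= 2 * D - th * m%:R * D by lra.
  have r0 : 0 <= 2 * D - th * m%:R * D.
    by rewrite -mulrBl mulr_ge0 ?(ltW D0)//; lra.
  have : (th * S) ^+ 2 <= (2 * D - th * m%:R * D) ^+ 2.
    by rewrite ler_sqr ?nnegrE// mulr_ge0// ltW.
  rewrite exprMn SS => h.
  have lg : 0 < 4 * (l * gamma) by rewrite !mulr_gt0.
  rewrite -(ler_pM2l lg).
  have e : 4 * (l * gamma) * (delta ^+ 2 * l * gamma * (1 - th * m%:R)) =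
    4 * D ^+ 2 * (1 - th * m%:R) by rewrite /D; ring.
  by rewrite e; lra.
have h2 : 3 * th * eso_v pb <= n%:R * l * gamma * (1 - th * m%:R).
  by move: hv; rewrite NE; lra.
have h3 : 12 * th * (Ra * q) <= D * (1 - th * m%:R) by lra.
have Ra0 := Rall_gt0.
have e1 : th ^+ 2 / (2 * l) * Ra ^+ 2 + th ^+ 2 / (2 * l * n%:R) * Rm ^+ 2 =
    th / (6 * l * n%:R) * (3 * th * eso_v pb).
  by rewrite /eso_v -/Ra -/Rm; field; rewrite !gt_eqF.
have e2 : th ^+ 2 * Ra ^+ 2 / (2 * rho pb delta) = th / (12 * (delta * l)) * (12 * th * (Ra * q)).
  by rewrite /rho -/l -/Ra -/q; field; rewrite !gt_eqF.
have e3 : 2 * (rho pb delta + th * l) / delta * th ^+ 2 * a1 pb delta / (delta * l ^+ 2) =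
   th / (12 * (delta * l)) * (12 * th * (Ra * q)) +
   th / (6 * (delta ^+ 2 * l)) * (12 * th ^+ 2 * q ^+ 2).
  by rewrite /rho -/l -/Ra -/q -qq; field; rewrite !gt_eqF.
rewrite e1 e2 e3.
have i1 : th / (6 * l * n%:R) * (3 * th * eso_v pb) <=
    th / (6 * l * n%:R) * (n%:R * l * gamma * (1 - th * m%:R)).
  by rewrite ler_pM2l// divr_gt0// !mulr_gt0.
have i2 : th / (12 * (delta * l)) * (12 * th * (Ra * q)) <=
    th / (12 * (delta * l)) * (D * (1 - th * m%:R)).
  by rewrite ler_pM2l// divr_gt0// !mulr_gt0.
have i3 : th / (6 * (delta ^+ 2 * l)) * (12 * th ^+ 2 * q ^+ 2) <=
    th / (6 * (delta ^+ 2 * l)) * (delta ^+ 2 * l * gamma * (1 - th * m%:R)).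
  by rewrite ler_pM2l// divr_gt0// !mulr_gt0// exprn_gt0.
have f1 : th / (6 * l * n%:R) * (n%:R * l * gamma * (1 - th * m%:R)) =
  th * gamma / 6 * (1 - th * m%:R) by field; rewrite !gt_eqF.
have f2 : th / (12 * (delta * l)) * (D * (1 - th * m%:R)) =
  th * gamma / 12 * (1 - th * m%:R) by rewrite /D; field; rewrite !gt_eqF.
have f3 : th / (6 * (delta ^+ 2 * l)) * (delta ^+ 2 * l * gamma * (1 - th * m%:R)) =
  th * gamma / 6 * (1 - th * m%:R) by field; rewrite !gt_eqF.
rewrite f1 in i1; rewrite f2 in i2; rewrite f3 in i3.
by lra.
Qed.

Let r := rate pb gamma delta.

Lemma rate_bounds : [/\ 0 < r, r < 1, 1 - th <= r & 1 - delta / 4 <= r].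
Proof.
have d1 := delta1; have t0 := theta_choice_gt0; rewrite /r /rate -/th.
have mn : Num.min th (delta / 4) <= delta / 4 by rewrite ge_min lexx orbT.
have mn' : Num.min th (delta / 4) <= th by rewrite ge_min lexx.
have d4 : 0 < delta / 4 by rewrite divr_gt0.
have mp : 0 < Num.min th (delta / 4) by rewrite lt_min t0.
by split; lra.
Qed.

(** The constant is dictated by the third candidate: D m <= D X and Ra q <= 2 D X give D m + 12 Ra q
    <= 25 D X. The other candidates and delta / 4 need less. *)
Lemma complexity_bound : 1 <= 25 * complexity pb gamma delta * (1 - r).
Proof.
have Ra0 := Rall_gt0; have Rm0 := Rmax_gt0; have Rb0 : 0 <= Rb := sqrtr_ge0 _.
set sd := Num.sqrt (1 - delta).
have sd0 : 0 <= sd := sqrtr_ge0 _.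
have sd2 : sd ^+ 2 = 1 - delta by rewrite sqr_sqrtr// subr_ge0 ltW.
set de := Num.sqrt delta.
have de0 : 0 < de by rewrite sqrtr_gt0.
have de2 : de ^+ 2 = delta by rewrite sqr_sqrtr// ltW.
(* Splitting the square root of [a1] produces the last two terms of the complexity. *)
have qle : q <= sd * (2 * Rb + de * Rm).
  have rhs0 : 0 <= sd * (2 * Rb + de * Rm).
    by rewrite mulr_ge0// addr_ge0// mulr_ge0// ltW.
  rewrite -ler_sqr ?nnegrE ?(ltW q0)// qq /a1 exprMn sd2 -/Rb -/Rm.
  rewrite ler_wpM2l ?subr_ge0 ?(ltW delta1)//.
  rewrite -[X in X * Rm ^+ 2]de2.
  have : 0 <= Rb * (de * Rm) by rewrite !mulr_ge0// ltW.
  have : 0 <= Rb ^+ 2 by exact: sqr_ge0.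
  by lra.
(* Here the hypothesis lambda <= R^2 / gamma enters: it bounds lambda gamma a1 by (Ra q)^2, and 48
   <= 7^2. *)
have SleD : S <= D * m%:R + 7 * (Ra * q).
  have rhs0 : 0 <= D * m%:R + 7 * (Ra * q).
    by rewrite addr_ge0// mulr_ge0// ltW.
  rewrite -ler_sqr ?nnegrE// SS.
  have : l * gamma * q ^+ 2 <= Ra ^+ 2 * q ^+ 2.
    by rewrite ler_wpM2r ?sqr_ge0// lam_gamma_le.
  have : 0 <= D * m%:R * (Ra * q) by rewrite !mulr_ge0// ltW.
  have : 0 <= Ra ^+ 2 * q ^+ 2 by rewrite mulr_ge0// sqr_ge0.
  by lra.
pose X1 := delta^-1.
pose X3 := Rm ^+ 2 / (n%:R * l * gamma).
pose X4 := Ra ^+ 2 / (l * gamma).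
pose X5 := sd * Ra * Rb / (delta * l * gamma).
pose X6 := sd * Ra * Rm / (l * gamma * de).
have X1p : 1 <= X1 by rewrite invf_ge1// ltW.
have X3p : 0 <= X3 by rewrite divr_ge0 ?sqr_ge0// !mulr_ge0// ltW.
have X4p : 0 <= X4 by rewrite divr_ge0 ?sqr_ge0// !mulr_ge0// ltW.
have X5p : 0 <= X5 by rewrite divr_ge0 ?mulr_ge0// ltW// !mulr_gt0.
have X6p : 0 <= X6 by rewrite divr_ge0 ?mulr_ge0// ltW// !mulr_gt0.
have mp : 0 <= (m%:R : R) by [].
set X := complexity pb gamma delta.
have XE : X = X1 + m%:R + X3 + X4 + X5 + X6 by [].
have X0 : 0 < X by lra.
have Raqle : Ra * q <= 2 * (D * X).
  have e5 : D * X5 = sd * Ra * Rb by rewrite /X5 /D; field; rewrite !gt_eqF.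
  have e6 : D * X6 = sd * Ra * Rm * de.
    by rewrite /X6 /D -de2; field; rewrite !gt_eqF.
  have : Ra * q <= Ra * (sd * (2 * Rb + de * Rm)) by rewrite ler_pM2l.
  have -> : Ra * (sd * (2 * Rb + de * Rm)) = 2 * (D * X5) + D * X6.
    by rewrite e5 e6; ring.
  have h6 := mulr_ge0 (ltW D0) X6p.
  have X56 : X5 + X6 <= X by lra.
  have := ler_wpM2l (ltW D0) X56; rewrite mulrDr.
  by lra.
have DmX : D * m%:R <= D * X by rewrite ler_pM2l//; lra.
have DX0 : 0 < D * X by rewrite mulr_gt0.
have hth : 1 <= 25 * X * th.
  apply: theta_choice_ge; first by lra.
  - by lra.
  - have -> : 3 * eso_v pb + N * l * gamma =
        n%:R * l * gamma * (m%:R + 3 * X3 + 3 * X4).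
      by rewrite NE /X3 /X4 /eso_v -/Ra -/Rm; field; rewrite !gt_eqF.
    rewrite mulrC ler_pM2r ?mulr_gt0//; lra.
  - by lra.
rewrite /r /rate -/th opprB addrC subrK.
rewrite /Num.min; case: ifP => _ //.
have : X1 * (25 * delta) <= X * (25 * delta) by rewrite ler_pM2r ?mulr_gt0//; lra.
have -> : X1 * (25 * delta) = 25 by rewrite /X1; field; rewrite gt_eqF.
by lra.
Qed.

End StepSize.

(** * Independence of blocks of random elements *)

Section Independence.
Context {R : realType} {dO : measure_display} {Omega : measurableType dO}.
Variable Pr : probability Omega R.

(** For fixed [T] both sides are finite measures in [S]; agreeing on a pi-system that contains the
    whole space, they agree on the generated sigma-algebra. *)
Lemma pi_system_independent (G : set (set Omega)) (T : set Omega) :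
  G `<=` measurable -> setI_closed G -> G setT -> measurable T ->
  (forall S, G S -> Pr (S `&` T) = (Pr S * Pr T)%E) ->
  forall S, <<s G >> S -> Pr (S `&` T) = (Pr S * Pr T)%E.
Proof.
move=> Gm GI GT mT h S GS.
have c0 : 0 <= fine (Pr T) by rewrite fine_ge0// measure_ge0.
pose m2 : {measure set Omega -> \bar R} := mscale (NngNum c0) Pr.
pose m1 : {measure set Omega -> \bar R} := mrestr Pr mT.
have cE : ((fine (Pr T))%:E = Pr T)%E by rewrite fineK// fin_num_measure.
have m2E U : m2 U = (Pr U * Pr T)%E.
  by rewrite -cE muleC.
rewrite -m2E -[LHS]/(m1 S).
apply: (g_sigma_algebra_measure_unique G Gm (fun=> setT)) => //.
- by rewrite bigcup_const//; exists 0%N.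
- by move=> U GU; rewrite m2E; exact: h.
move=> _; rewrite -[ltLHS]/(Pr (setT `&` T)) setTI.
by apply: (le_lt_trans (probability_le1 Pr mT)); rewrite ltry.
Qed.

Context {I : choiceType} (F : I -> set_system Omega).
Hypothesis Fm : forall j S, F j S -> measurable S.
Hypothesis FT : forall j, F j setT.
Hypothesis FI : forall j S T, F j S -> F j T -> F j (S `&` T).
Hypothesis indep : mutually_independent Pr F.

(** Finite intersections of events, at most one per variable of the block [A]: unlike the single
    events, they form a pi-system. *)
Definition cylinder (A : set I) : set (set Omega) :=
  [set S | exists J : {fset I}, exists E : I -> set Omega,
    [/\ forall j, j \in J -> A j, forall j, F j (E j) &
      S = \bigcap_(j in [set` J]) E j]].

Lemma cylinder1 (A : set I) j S : A j -> F j S -> cylinder A S.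
Proof.
move=> Aj FS; exists [fset j]%fset, (fun i => if i == j then S else setT); split.
- by move=> i /fset1P ->.
- by move=> i; case: eqP => [->|_].
apply/seteqP; split => [w Sw i /= /fset1P ->|w /(_ j)]; first by rewrite eqxx.
by rewrite /= eqxx; apply; exact/fset1P.
Qed.

Lemma cylinder_measurable A : cylinder A `<=` measurable.
Proof.
move=> S [J [E [_ FE ->]]]; apply: fin_bigcap_measurable; first exact: finite_fset.

by move=> j _; exact: Fm (FE j).
Qed.

Lemma cylinderT A : cylinder A setT.
Proof.
exists fset0, (fun=> setT); split => //.
by apply/seteqP; split.
Qed.

Lemma cylinderI A : setI_closed (cylinder A).
Proof.
move=> S T [J1 [E1 [AJ1 FE1 ->]]] [J2 [E2 [AJ2 FE2 ->]]].
exists (J1 `|` J2)%fset, (fun j => (if j \in J1 then E1 j else setT) `&`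
  (if j \in J2 then E2 j else setT)); split.
- by move=> j /fsetUP[/AJ1|/AJ2].
- by move=> j; apply: FI; case: ifP.
apply/seteqP; split => [w [h1 h2] j /= _|w h].
  by split; case: ifPn => // jJ; [exact: h1|exact: h2].
split=> j /= jJ.
  by have := h j; rewrite /= inE jJ => /(_ isT) [].
by have := h j; rewrite /= inE jJ orbT => /(_ isT) [].
Qed.

Lemma cylinder_independent A B S T : [disjoint A & B]%classic ->
  cylinder A S -> cylinder B T -> Pr (S `&` T) = (Pr S * Pr T)%E.
Proof.
move=> AB [J1 [E1 [AJ1 FE1 ->]]] [J2 [E2 [AJ2 FE2 ->]]].
have J12 j : j \in J2 -> j \notin J1.
  move=> j2; apply/negP => j1; move/disj_setPS : AB => /(_ j); apply.
  by split; [exact: AJ1|exact: AJ2].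
pose E j := if j \in J1 then E1 j else E2 j.
have -> : (\bigcap_(j in [set` J1]) E1 j) `&` (\bigcap_(j in [set` J2]) E2 j) =
    \bigcap_(j in [set` (J1 `|` J2)%fset]) E j.
  apply/seteqP; split => [w [h1 h2] j /=|w h].
    rewrite inE /E; case: ifPn => [j1 _|_ /= j2]; first exact: h1.
    exact: h2.
  split=> j /= jJ.
    by have := h j; rewrite /= inE jJ /E jJ => /(_ isT).
  by have := h j; rewrite /= inE jJ orbT /E (negbTE (J12 _ jJ)) => /(_ isT).
rewrite indep; last by move=> j _; rewrite /E; case: ifP.
have pJ : perm_eq (J1 `|` J2)%fset (J1 ++ J2).
  apply: uniq_perm => [||j]; first exact: fset_uniq.
    rewrite cat_uniq !fset_uniq andbT; apply/hasPn => j j2; exact: J12.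
  by rewrite inE mem_cat.
rewrite !indep// (perm_big _ pJ) big_cat /=; congr (_ * _)%E.
  by apply: eq_big_seq => j j1; rewrite /E j1.
by apply: eq_big_seq => j /J12 /negbTE j1; rewrite /E j1.
Qed.

Lemma sigma_cylinder_measurable A : <<s cylinder A >> `<=` @measurable _ Omega.
Proof.
by apply: smallest_sub; [exact: sigma_algebra_measurable|exact: cylinder_measurable].
Qed.

Lemma sigma_cylinder_independent A B S T : [disjoint A & B]%classic ->
  <<s cylinder A >> S -> <<s cylinder B >> T -> Pr (S `&` T) = (Pr S * Pr T)%E.
Proof.
move=> AB sS sT.
have mT : measurable T := sigma_cylinder_measurable sT.
have mC := @cylinder_measurable.
apply: (pi_system_independent (@mC A) (@cylinderI A) (cylinderT A) mT) => // U AU.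
rewrite setIC muleC.
apply: (pi_system_independent (@mC B) (@cylinderI B) (cylinderT B)) => // [|V BV].
  exact: mC AU.
by rewrite setIC muleC; exact: cylinder_independent AU BV.
Qed.

(** The same space with a smaller sigma-algebra. Measurability on this type encodes dependence on
    the noise of the block [A] only. *)
Definition sigma_cylinder (A : set I) : measurableType _ := g_sigma_algebraType (cylinder A).

Lemma measurable_id_sigma_cylinder (A : set I) :
  measurable_fun [set: Omega] (id : Omega -> sigma_cylinder A).
Proof. by move=> _ S mS; rewrite setTI; apply: (sigma_cylinder_measurable mS). Qed.

Lemma measurable_fun_sigma_cylinder (A : set I) d' (T : measurableType d') (f : Omega -> T) :
  measurable_fun [set: sigma_cylinder A] (f : sigma_cylinder A -> T) ->
  measurable_fun [set: Omega] f.
Proof.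
move=> mf _ S mS; rewrite setTI.
by have := mf measurableT S mS; rewrite setTI; exact: sigma_cylinder_measurable.
Qed.

Lemma sigma_cylinder_subset (A B : set I) : A `<=` B ->
  @measurable _ (sigma_cylinder A) `<=` @measurable _ (sigma_cylinder B).
Proof.
move=> AB; apply: sub_smallest2r; first exact: smallest_sigma_algebra.
by move=> S [J [E [AJ FE ->]]]; exists J, E; split => // j /AJ /AB.
Qed.

Lemma measurable_fun_sigma_subset (A B : set I) d' (T : measurableType d') (f : Omega -> T) :
  A `<=` B -> measurable_fun [set: sigma_cylinder A] (f : sigma_cylinder A -> T) ->
  measurable_fun [set: sigma_cylinder B] (f : sigma_cylinder B -> T).
Proof.
move=> AB mf _ S mS; rewrite setTI.
by have := mf measurableT S mS; rewrite setTI; exact: sigma_cylinder_subset.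
Qed.

(** Independence says that the diagonal w -> (w, w) pushes [Pr] to the product of its restrictions
    to the two sigma-algebras, so Tonelli applies. It plays the role of conditioning on the block
    [A]. *)
Lemma sigma_cylinder_tonelli (A B : set I)
    (f : (sigma_cylinder A * sigma_cylinder B)%type -> \bar R) :
  [disjoint A & B]%classic ->
  measurable_fun setT f -> (forall w, (0 <= f w)%E) ->
  (\int[Pr]_w f (w, w) = \int[Pr]_w \int[Pr]_w' f (w, w'))%E.
Proof.
move=> AB mf f0.
have mA := @measurable_id_sigma_cylinder A.
have mB := @measurable_id_sigma_cylinder B.
have mAB : measurable_fun [set: Omega]
    ((fun w => (w, w)) : Omega -> sigma_cylinder A * sigma_cylinder B).
  exact: measurable_fun_pair mA mB.
pose XA : {RV Pr >-> sigma_cylinder A} := HB.pack (id : Omega -> sigma_cylinder A)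
  (isMeasurableFun.Build _ _ _ _ _ mA).
pose XB : {RV Pr >-> sigma_cylinder B} := HB.pack (id : Omega -> sigma_cylinder B)
  (isMeasurableFun.Build _ _ _ _ _ mB).
pose XAB : {RV Pr >-> (sigma_cylinder A * sigma_cylinder B)%type} :=
  HB.pack ((fun w => (w, w)) : Omega -> sigma_cylinder A * sigma_cylinder B)
  (isMeasurableFun.Build _ _ _ _ _ mAB).
have E1 := ge0_integral_distribution XAB mf f0.
rewrite -[LHS]E1.
rewrite (eq_measure_integral (distribution Pr XA \x distribution Pr XB)%E); last first.
  move=> S mS _; apply/esym.
  apply: product_measure_unique => // U V mU mV.
  exact: (sigma_cylinder_independent AB mU mV).
rewrite fubini_tonelli1//.
rewrite (ge0_integral_distribution XA); last 2 first.
- exact: measurable_fun_fubini_tonelli_F.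
- by move=> w; exact: integral_ge0.
apply: eq_integral => w _ /=.
rewrite /fubini_F (ge0_integral_distribution XB)//.
exact: measurableT_comp mf (measurable_pair1 _).
Qed.

End Independence.

(** * Measurability of vector-valued maps *)

Local Notation borel_vec R d := (g_sigma_algebraType (@open 'cV[R]_d)).

Lemma continuous_borel_vec (R : realType) d (h : 'cV[R]_d -> R) :
  continuous h -> measurable_fun [set: borel_vec R d] (h : borel_vec R d -> R).
Proof.
move=> /continuousP ch.
apply: (@measurability _ _ (borel_vec R d) _ _ _ _ (RGenOpens.measurableE R)).
move=> _ [_ [a [b ->] <-]]; rewrite setTI; apply: sub_sigma_algebra.
exact/ch/interval_open.
Qed.

Lemma enorm_near (R : realType) d (x : 'cV[R]_d) (e : R) : 0 < e ->
  \forall y \near x, enorm (x - y) < e.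
Proof.
move=> e0; have d0 : 0 < (d%:R + 1 : R) by rewrite ltr_wpDl.
(* The ball is that of the max norm; d / (d + 1)^2 < 1 gives a strict bound, also for d = 0. *)
apply/nbhs_ballP; exists (e / (d%:R + 1)) => [|y [_ xy]] /=; first by rewrite divr_gt0.
rewrite -ltr_sqr ?nnegrE ?enorm_ge0 ?(ltW e0)// enorm_sqr.
apply: (@le_lt_trans _ _ (d%:R * (e / (d%:R + 1)) ^+ 2)).
  rewrite mulr_natl -[X in _ *+ X]card_ord -sumr_const.
  apply: ler_sum => j _; rewrite -expr2 -real_normK ?num_real// !mxE.
  by rewrite ler_sqr ?nnegrE ?divr_ge0 ?(ltW e0) ?(ltW d0)// ltW//; exact: xy.
rewrite exprMn mulrCA gtr_pMr ?exprn_gt0// exprVn ltr_pdivrMr ?exprn_gt0// mul1r.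
have : (0 : R) <= d%:R ^+ 2 by rewrite sqr_ge0.
have : (0 : R) <= d%:R by [].
by lra.
Qed.

Lemma lipschitz_continuous (R : realType) d (L : R) (h : 'cV[R]_d -> R) : 0 <= L ->
  (forall x y, `|h x - h y| <= L * enorm (x - y)) -> continuous h.
Proof.
move=> L0 hL x; have FF : Filter (nbhs x) := nbhs_filter x.
apply/cvgrPdist_lt => e e0.
have L1 : 0 < L + 1 by lra.
near=> y; have : enorm (x - y) < e / (L + 1).
  by near: y; apply: enorm_near; exact: divr_gt0.
rewrite ltr_pdivlMr// => xy; apply: (le_lt_trans (hL x y)); apply: le_lt_trans xy.
by rewrite mulrC ler_wpM2l ?enorm_ge0//; lra.
Unshelve. all: by end_near. Qed.

Lemma dotv_continuous (R : realType) d (x : 'cV[R]_d) : continuous (fun y => dotv y x).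
Proof.
apply: (lipschitz_continuous (enorm_ge0 x)) => y z.
rewrite -dotvNl -dotvDl ler_norml mulrC dotv_le_enorm andbT lerNl -dotvNl.
apply: (le_trans (dotv_le_enorm _ _)).
by rewrite -scaleN1r enormZ normrN1 mul1r.
Qed.

(** A supremum of affine functions is lower semicontinuous: its superlevel sets are unions of open
    half-spaces, whatever g is. *)
Lemma conjugate_borel_vec (R : realType) d (g : 'cV[R]_d -> \bar R) :
  measurable_fun [set: borel_vec R d] (fun y : borel_vec R d => conjugate g y).
Proof.
apply: (@measurability _ _ (borel_vec R d) _ _ _ _ (ErealGenOInfty.measurableE R)).
move=> /= _ [_ [a ->]] <-; rewrite setTI; apply: sub_sigma_algebra.
have -> : (conjugate g) @^-1` `]a%:E, +oo[%classic =
    \bigcup_x [set y : 'cV[R]_d | (a%:E < (dotv y x)%:E - g x)%E].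
  rewrite preimage_itvoy; apply/seteqP; split => [y /= /ereal_sup_gt[_ [x _ <-]]|y [x _ /= h]].
    by exists x.
  by apply: (lt_le_trans h); exact: conjugate_ge.
apply: bigcup_open => x _.
case: (g x) => [b||]; last 2 first.
- by rewrite (_ : [set _ | _] = set0); [exact: open0|apply/seteqP; split => y].
- rewrite (_ : [set _ | _] = setT); [exact: openT|apply/seteqP; split => y //= _].
  by rewrite ltry.
have -> : [set y : 'cV[R]_d | (a%:E < (dotv y x)%:E - b%:E)%E] =
    (fun y => dotv y x) @^-1` [set r : R | a + b < r].
  by apply/seteqP; split => y /=; rewrite -EFinB lte_fin ltrBrDr.
by apply: open_comp => [y _|]; [exact: dotv_continuous|exact: open_gt].
Qed.

Section VectorMeasurability.
Context {R : realType} {d0 : measure_display} {P : measurableType d0}.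

(** Coordinatewise measurability suits algebraic operations; the Borel form, needed for composition
    with [Q] or with continuous maps, is equivalent by the next two lemmas. *)
Definition measurable_vec {d : nat} (f : P -> 'cV[R]_d) : Prop :=
  forall j, measurable_fun [set: P] (fun w => f w j 0).

(** An open set is a countable union of boxes with rational centre and radius, and preimages of
    boxes are finite intersections of coordinate events. *)
Lemma measurable_vec_borel {d : nat} (f : P -> 'cV[R]_d) :
  measurable_vec f -> measurable_fun [set: P] (f : P -> borel_vec R d).
Proof.
move=> mf; apply: (@measurability _ _ P (borel_vec R d) setT f (@open 'cV[R]_d)) => // _ [U oU <-].
rewrite setTI.
pose box (c : 'cV[rat]_d * rat) : set 'cV[R]_d :=
  [set y | forall j, `|y j 0 - ratr (c.1 j 0)| < ratr c.2].
have -> : f @^-1` U = \bigcup_c [set w | box c `<=` U /\ box c (f w)].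
  apply/seteqP; split => [w Uw|w [c _ [cU h]]]; last exact: cU.
  have [e /= e0 eU] := (nbhs_ballP _ _).1 (open_nbhs_nbhs (conj oU Uw)).
  (* With q < e / 2, a box of half-width q whose centre is within q of the point stays in the
     e-ball. *)
  have [q /[!in_itv]/= /andP[q0 qe]] := rat_in_itvoo (divr_gt0 e0 (ltr0n R 2)).
  have ex j : exists c : rat, `|f w j 0 - ratr c| < ratr q.
    have lt : f w j 0 - ratr q < f w j 0 + ratr q by lra.
    have [c /[!in_itv]/= /andP[c1 c2]] := rat_in_itvoo lt.
    by exists c; rewrite ltr_distlC; apply/andP; split; lra.
  exists (\col_j sval (cid (ex j)), q) => //=; split; last first.
    by move=> j /=; rewrite mxE; case: cid.
  move=> y yb; apply: eU; split=> // j k; rewrite ord1 /ball /=.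
  have := yb j; rewrite /= mxE; case: cid => c hc /= h.
  rewrite -(subrK (ratr c) (f w j 0)) -addrA; apply: (le_lt_trans (ler_normD _ _)).
  by rewrite (distrC (ratr c)); lra.
apply: countable_bigcupT_measurable => [|c]; first exact: countableP.
have [cU|cU] := pselect (box c `<=` U); last first.
  by rewrite (_ : [set _ | _] = set0)//; apply/seteqP; split => w // -[].
rewrite (_ : [set _ | _] = f @^-1` (box c)); last by apply/seteqP; split => w // -[].
have -> : f @^-1` (box c) =
    \bigcap_(j in [set: 'I_d]) ((fun w => f w j 0) @^-1` [set x | `|x - ratr (c.1 j 0)| < ratr c.2]).
  by apply/seteqP; split => [w h j _|w h j]; [exact: h|exact: h].
apply: fin_bigcap_measurable => // j _.
rewrite -[X in measurable X]setTI; apply: mf => //.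
apply: open_measurable.
have -> : [set x : R | `|x - ratr (c.1 j 0)| < ratr c.2] =
    ball (ratr (c.1 j 0) : R) (ratr c.2).
  by apply/seteqP; split => x; rewrite /ball /= distrC.
exact: ball_open.
Qed.

Lemma measurable_borel_vec {d : nat} (f : P -> 'cV[R]_d) :
  measurable_fun [set: P] (f : P -> borel_vec R d) -> measurable_vec f.
Proof.
move=> mf j.
apply: (@measurableT_comp _ _ _ P (borel_vec R d) _ (fun x : 'cV[R]_d => x j 0) setT f) => //.
by apply: continuous_borel_vec; exact: coord_continuous.
Qed.

Lemma measurable_vec_cst d (c : 'cV[R]_d) : measurable_vec (fun=> c).
Proof. by move=> j; exact: measurable_cst. Qed.

Lemma measurable_vecD d (f g : P -> 'cV[R]_d) :
  measurable_vec f -> measurable_vec g -> measurable_vec (fun w => f w + g w).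
Proof.
move=> mf mg j; under eq_fun do rewrite mxE; exact: measurable_funD.
Qed.

Lemma measurable_vecZ d (a : R) (f : P -> 'cV[R]_d) :
  measurable_vec f -> measurable_vec (fun w => a *: f w).
Proof.
move=> mf j; under eq_fun do rewrite mxE.
by apply: measurable_funM => //; exact: measurable_cst.
Qed.

Lemma measurable_vecN d (f : P -> 'cV[R]_d) :
  measurable_vec f -> measurable_vec (fun w => - f w).
Proof.
move=> mf; under eq_fun do rewrite -scaleN1r; exact: measurable_vecZ.
Qed.

Lemma measurable_vecB d (f g : P -> 'cV[R]_d) :
  measurable_vec f -> measurable_vec g -> measurable_vec (fun w => f w - g w).
Proof. by move=> mf mg; apply: measurable_vecD => //; exact: measurable_vecN. Qed.

Lemma measurable_vec_sum d (I : Type) (r : seq I) (f : I -> P -> 'cV[R]_d) :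
  (forall i, measurable_vec (f i)) -> measurable_vec (fun w => \sum_(i <- r) f i w).
Proof.
move=> mf j; under eq_fun do rewrite summxE.
by apply: measurable_sum => i; exact: mf.
Qed.

Lemma measurable_vec_mulmx p q (A : 'M[R]_(p, q)) (f : P -> 'cV[R]_q) :
  measurable_vec f -> measurable_vec (fun w => A *m f w).
Proof.
move=> mf j; under eq_fun do rewrite mxE.
by apply: measurable_sum => i; apply: measurable_funM => //; exact: measurable_cst.
Qed.

Lemma measurable_dotv d (f g : P -> 'cV[R]_d) :
  measurable_vec f -> measurable_vec g ->
  measurable_fun [set: P] (fun w => dotv (f w) (g w)).
Proof.
by move=> mf mg; apply: measurable_sum => j; apply: measurable_funM.
Qed.

Lemma measurable_fun_choice d' (T : measurableType d') (I : finType) (idx : P -> I)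
    (g : I -> P -> T) :
  (forall i, measurable (idx @^-1` [set i])) ->
  (forall i, measurable_fun [set: P] (g i)) ->
  measurable_fun [set: P] (fun w => g (idx w) w).
Proof.
move=> mi mg _ B mB; rewrite setTI.
have -> : (fun w => g (idx w) w) @^-1` B =
    \bigcup_i (idx @^-1` [set i] `&` (g i) @^-1` B).
  apply/seteqP; split => [w h|w [i _ [/= <-]]//].
  by exists (idx w).
apply: countable_bigcupT_measurable => [|i]; first exact: countableP.
apply: measurableI => //.
by have := mg i measurableT B mB; rewrite setTI.
Qed.

Lemma measurable_vec_choice d (I : finType) (idx : P -> I) (g : I -> P -> 'cV[R]_d) :
  (forall i, measurable (idx @^-1` [set i])) ->
  (forall i, measurable_vec (g i)) -> measurable_vec (fun w => g (idx w) w).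
Proof.
move=> mi mg j; apply: (measurable_fun_choice (g := fun i w => g i w j 0)) => // i.
exact: mg.
Qed.

Lemma measurable_continuous_vec d (h : 'cV[R]_d -> R) (f : P -> 'cV[R]_d) :
  continuous h -> measurable_vec f -> measurable_fun [set: P] (fun w => h (f w)).
Proof.
move=> ch mf; apply: (@measurableT_comp _ _ _ P (borel_vec R d) _ h setT f).
  exact: continuous_borel_vec.
exact: measurable_vec_borel.
Qed.

Lemma measurable_vec_lipschitz p q (L : R) (G : 'cV[R]_p -> 'cV[R]_q) (f : P -> 'cV[R]_p) :
  0 <= L -> (forall x y, enorm (G x - G y) <= L * enorm (x - y)) ->
  measurable_vec f -> measurable_vec (fun w => G (f w)).
Proof.
move=> L0 hG mf j; apply: (measurable_continuous_vec (h := fun x => G x j 0)) => //.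
apply: (lipschitz_continuous L0) => x y; apply: le_trans (hG x y).
rewrite -sqrtr_sqr /enorm ler_wsqrtr// /dotv (bigD1 j)//= -expr2 !mxE lerDl.
by apply: sumr_ge0 => k _; rewrite -expr2 sqr_ge0.
Qed.

Lemma measurable_fine_conjugate d (g : 'cV[R]_d -> \bar R) (f : P -> 'cV[R]_d) :
  measurable_vec f -> measurable_fun [set: P] (fun w => fine (conjugate g (f w))).
Proof.
move=> mf.
apply: (@measurableT_comp _ _ _ P _ _ (fine : \bar R -> R) setT (fun w => conjugate g (f w))).
  exact: fine_measurable.
apply: (@measurableT_comp _ _ _ P (borel_vec R d) _ (conjugate g) setT f).
  exact: conjugate_borel_vec.
exact: measurable_vec_borel.
Qed.

End VectorMeasurability.

(** * Duality and the trajectory *)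

Section Trajectory.
Context {R : realType} {m n d t : nat} (pb : erm_data R m n d t).
Variables (gamma theta : R).
Hypotheses (m0 : (0 < m)%N) (n0 : (0 < n)%N) (gamma0 : 0 < gamma).
Hypothesis loss_convex : forall i tau, convex_function setT (loss pb i tau).
Hypothesis loss_smooth : forall i tau, smooth (1 / gamma) (loss pb i tau).
Hypothesis propg : propere (reg pb).
Hypothesis lscg : lower_semicontinuous (reg pb).
Hypothesis cg : convexe (reg pb).
Hypothesis scg : strongly_convexe 1 (reg pb).
Hypothesis lam0 : 0 < lam pb.

Let N : R := @nfun R m n.
Let N0 : 0 < N. Proof. exact: nfun_gt0. Qed.

Lemma dual_finiteE alpha : dual_finite pb alpha -> dual pb alpha = (dual_real pb alpha)%:E.
Proof.
move=> fa; rewrite /dual (conjugate_fine propg lscg scg).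
under eq_bigr => tau _ do under eq_bigr => i _ do rewrite fa.
under eq_bigr => tau _ do rewrite sumEFin.
by rewrite sumEFin.
Qed.

Lemma loss_conj_neqNy i tau y : conjugate (EFin \o loss pb i tau) y != -oo%E.
Proof.
by have := conjugate_ge (EFin \o loss pb i tau) 0 y; case: (conjugate _ y).
Qed.

(** Serves twice: an optimal dual point must be finite, and an initial point that is not makes the
    claimed bounds vacuous or trivial. *)
Lemma dual_infinite alpha : ~ dual_finite pb alpha -> dual pb alpha = -oo%E.
Proof.
move=> nfa; rewrite /dual (conjugate_fine propg lscg scg).
have [i [tau E]] : exists i tau, conjugate (EFin \o loss pb i tau) (- alpha i tau) = +oo%E.
  apply: contrapT => h; apply: nfa => i tau; rewrite /loss_conj.
  have := loss_conj_neqNy i tau (- alpha i tau).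
  by case E : (conjugate _ _) => [r||]// _; exfalso; apply: h; exists i, tau.
have -> : (\sum_(tau < n) \sum_(i < m) conjugate (EFin \o loss pb i tau) (- alpha i tau) = +oo)%E.
  apply/esum_eqyP => [tau' _|]; last first.
    exists tau; split => //; apply/esum_eqyP => [i' _|]; first exact: loss_conj_neqNy.
    by exists i; split.
  by apply/eqP => /esum_eqNyP[i' [_ _ /eqP]]; apply/negP; exact: loss_conj_neqNy.
rewrite gt0_muley; last by rewrite lte_fin invr_gt0.
by [].
Qed.

Definition loss_mean (x : 'cV[R]_d) : R :=
  N^-1 * \sum_(tau < n) \sum_(i < m) loss pb i tau ((mat pb i tau)^T *m x).

Lemma weak_duality alpha x b : dual_finite pb alpha -> reg pb x = b%:E ->
  dual_real pb alpha <= loss_mean x + lam pb * b.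
Proof.
move=> fa gx; rewrite /dual_real /loss_mean -/N.
have h1 : dotv (dual_average pb alpha) x - b <= reg_conj pb (dual_average pb alpha).
  rewrite -lee_fin EFinB -gx /reg_conj -(conjugate_fine propg lscg scg).
  exact: conjugate_ge.
have h2 : - (lam pb * dotv (dual_average pb alpha) x) - loss_mean x <=
    N^-1 * \sum_(tau < n) \sum_(i < m) loss_conj pb i tau (- alpha i tau).
  have -> : lam pb * dotv (dual_average pb alpha) x =
      N^-1 * \sum_(tau < n) \sum_(i < m) dotv (mat pb i tau *m alpha i tau) x.
    rewrite /dual_average dotvZl dotv_suml.
    under eq_bigr do rewrite dotv_suml.
    by rewrite -/N mulrA invfM mulVKf ?gt_eqF.
  rewrite /loss_mean -mulrN -mulrBr ler_wpM2l ?invr_ge0 ?(ltW N0)//.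
  rewrite -!sumrN -big_split /=; apply: ler_sum => tau _.
  rewrite -!sumrN -big_split /=; apply: ler_sum => i _.
  rewrite -lee_fin -fa dotv_mull -dotvNl EFinB.
  exact: (conjugate_ge (EFin \o loss pb i tau)).
have := ler_wpM2l (ltW lam0) h1; rewrite /loss_mean in h2.
by lra.
Qed.

Lemma primal_finiteE x b : reg pb x = b%:E -> primal pb x = (loss_mean x + lam pb * b)%:E.
Proof. by move=> gx; rewrite /primal gx. Qed.

Lemma primal_atE u : primal pb (grad_conj_reg pb u) = (primal_at pb u)%:E.
Proof. exact: primal_finiteE (reg_gradient_conjugate propg lscg scg u). Qed.

Lemma primal_finite x a : (primal pb x <= a%:E)%E ->
  exists b, reg pb x = b%:E /\ loss_mean x + lam pb * b <= a.
Proof.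
have [n0g _] := propg; move: (n0g x); rewrite /primal.
case: (reg pb x) => [b _||]//; last by rewrite gt0_muley// lte_fin.
by rewrite lee_fin => h; exists b.
Qed.

Lemma loss_mean_convex x y s : 0 <= s <= 1 ->
  loss_mean (s *: x + (1 - s) *: y) <= s * loss_mean x + (1 - s) * loss_mean y.
Proof.
move=> s01; rewrite /loss_mean !(mulrCA _ N^-1) -mulrDr ler_wpM2l ?invr_ge0 ?(ltW N0)//.
rewrite !mulr_sumr -big_split /=; apply: ler_sum => tau _.
rewrite !mulr_sumr -big_split /=; apply: ler_sum => i _.
by rewrite mulmxDr -!scalemxAr; exact: convex_functionP.
Qed.

Lemma primal_convex x y a b s : 0 <= s <= 1 ->
  (primal pb x <= a%:E)%E -> (primal pb y <= b%:E)%E ->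
  (primal pb (s *: x + (1 - s) *: y) <= (s * a + (1 - s) * b)%:E)%E.
Proof.
move=> s01 /primal_finite[p [gx xa]] /primal_finite[q [gy yb]].
have := cg x y s01; rewrite gx gy -!EFinM -EFinD => /(reg_finite propg)[r gr rle].
rewrite (primal_finiteE gr) lee_fin; have := loss_mean_convex x y s01.
have := ler_wpM2l (ltW lam0) rle; move: s01 => /andP[s0 s1].
have := ler_wpM2l s0 xa; have s1' : 0 <= 1 - s by lra.
have := ler_wpM2l s1' yb.
by lra.
Qed.

(** Real majorants [b i] replace the primal values, so the induction never meets infinite
    arithmetic. Sums start at 1, where the arbitrary initial [x] is left out, and run to k + 1 so
    that they are nonempty. *)
Lemma primal_jensen (w : nat -> R) (x : nat -> 'cV[R]_d) (b : nat -> R) k :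
  (forall i, 0 < w i) -> (forall i, (0 < i)%N -> (primal pb (x i) <= (b i)%:E)%E) ->
  (primal pb ((\sum_(1 <= i < k.+2) w i)^-1 *: \sum_(1 <= i < k.+2) w i *: x i) <=
   ((\sum_(1 <= i < k.+2) w i)^-1 * \sum_(1 <= i < k.+2) w i * b i)%:E)%E.
Proof.
move=> w0 hb; elim: k => [|k IH].
  by rewrite !big_nat1 scalerA mulrA mulVf ?gt_eqF// scale1r mul1r; exact: hb.
rewrite [\sum_(1 <= i < k.+3) w i]big_nat_recr//= [\sum_(1 <= i < k.+3) w i *: x i]big_nat_recr//=.
rewrite [\sum_(1 <= i < k.+3) w i * b i]big_nat_recr//=.
set W := \sum_(1 <= i < k.+2) w i in IH *.
have W0 : 0 < W.
  rewrite /W big_nat_recl//= ltr_wpDr//; apply: sumr_ge0 => i _; exact: ltW.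
have WW : 0 < W + w k.+2 by rewrite addr_gt0.
set s := w k.+2 / (W + w k.+2).
have s01 : 0 <= s <= 1.
  rewrite divr_ge0 ?(ltW WW) ?(ltW (w0 _))//= ler_pdivrMr// mul1r; have := W0; lra.
have := primal_convex s01 (hb k.+2 isT) IH.
have s1 : (1 - s) * W^-1 = (W + w k.+2)^-1.
  by rewrite /s; field; rewrite !gt_eqF.
have s2 : s = (W + w k.+2)^-1 * w k.+2 by rewrite /s mulrC.
set Sx := \sum_(1 <= i < k.+2) w i *: x i; set Sb := \sum_(1 <= i < k.+2) w i * b i.
have -> : s *: x k.+2 + (1 - s) *: (W^-1 *: Sx) = (W + w k.+2)^-1 *: (Sx + w k.+2 *: x k.+2).
  by rewrite scalerA s1 s2 -scalerA -scalerDr [Sx + _]addrC.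
suff -> : s * b k.+2 + (1 - s) * (W^-1 * Sb) = (W + w k.+2)^-1 * (Sb + w k.+2 * b k.+2) by [].
by rewrite mulrA s1 s2; ring.
Qed.

Context {Z : Type} (Q : Z -> 'cV[R]_d -> 'cV[R]_d).
Hypotheses (theta0 : 0 < theta) (theta1 : theta * m%:R <= 1).

Definition direction (s : @ec_state R m n d t) j tau : 'cV[R]_t :=
  target pb (st_u s) j tau - st_alpha s j tau.

Definition message (s : @ec_state R m n d t) (i : 'I_n -> 'I_m) tau : 'cV[R]_d :=
  st_e s tau + increment pb theta (direction s) (i tau) tau.

(** Normal form of a step: the dual move points to the target, and the new error is what [Q] loses
    on the message. *)
Lemma ec_stepE (i : 'I_n -> 'I_m) (z : 'I_n -> Z) s :
  ec_step pb Q theta i z s =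
  EcState (dual_update theta (st_alpha s) (direction s) i) (grad_conj_reg pb (st_u s))
    (st_u s + n%:R^-1 *: \sum_(tau < n) Q (z tau) (message s i tau))
    (fun tau => message s i tau - Q (z tau) (message s i tau)).
Proof.
have D tau : - (theta * (@prob_idx R m)^-1) *: st_alpha s (i tau) tau -
    (theta * (@prob_idx R m)^-1) *: gradient (loss pb (i tau) tau)
      ((mat pb (i tau) tau)^T *m grad_conj_reg pb (st_u s)) =
    (theta * m%:R) *: direction s (i tau) tau.
  rewrite /prob_idx invrK /direction /target.
  by rewrite scalerBr scalerN scaleNr addrC.
rewrite /ec_step /message /increment; congr EcState.
- apply/funext => j; apply/funext => tau; rewrite D /dual_update.
  by case: eqP => [->|].
- by congr (_ + _ *: _); apply: eq_bigr => tau _; rewrite D addrC.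
by apply/funext => tau; rewrite D [_ *: _ + st_e s tau]addrC.
Qed.

(** Error feedback loses nothing: whatever is not yet in [st_u] is stored in the errors, so the dual
    average is a virtual uncompressed iterate. *)
Definition ec_invariant (s : @ec_state R m n d t) : Prop :=
  dual_finite pb (st_alpha s) /\
  st_u s = dual_average pb (st_alpha s) - n%:R^-1 *: \sum_tau st_e s tau.

Lemma ec_invariant_init alpha0 x0 : dual_finite pb alpha0 ->
  ec_invariant (ec_init pb alpha0 x0).
Proof. by move=> f0; split => //=; rewrite big1// scaler0 subr0. Qed.

Lemma directionE s : ec_invariant s -> direction s =
  (fun j tau => target pb (dual_average pb (st_alpha s) -
     n%:R^-1 *: \sum_tau st_e s tau) j tau - st_alpha s j tau).
Proof. by move=> [_ uE]; rewrite -uE. Qed.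

Lemma ec_invariant_step i z s : ec_invariant s -> ec_invariant (ec_step pb Q theta i z s).
Proof.
move=> inv; have [fs uE] := inv; rewrite ec_stepE; split => /=.
  rewrite directionE//.
  exact: (dual_update_finite m0 gamma0 loss_convex loss_smooth _ fs theta0 theta1).
rewrite [in RHS]directionE// dual_average_update// -directionE// uE.
rewrite -!addrA; congr (_ + _).
rewrite -!scalerN -!scalerDr; congr (_ *: _).
rewrite -!sumrN -!big_split /=; apply: eq_bigr => tau _.
rewrite /message; move: (Q _ _) => a.
move: (increment _ _ _ _ _) (st_e s tau) => b c.
by apply/matrixP => p q; rewrite !mxE; ring.
Qed.

Lemma ec_invariant_sdca idx seed alpha0 x0 k : dual_finite pb alpha0 ->
  ec_invariant (ec_sdca pb Q theta idx seed (ec_init pb alpha0 x0) k).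
Proof.
by move=> f0; elim: k => [|k IH] /=; [exact: ec_invariant_init|exact: ec_invariant_step].
Qed.

End Trajectory.

(** * Integrals over the noise *)

(** The integral of a nonnegative function is a supremum over the simple functions below it, hence
    monotone without measurability. It is applied to inner integrals and to the primal value at the
    averaged iterate. *)
Lemma ge0_le_integral_nonmeasurable d (T : measurableType d) (R : realType)
    (mu : {measure set T -> \bar R}) (f g : T -> \bar R) :
  (forall x, (0 <= f x)%E) -> (forall x, (f x <= g x)%E) ->
  (\int[mu]_x f x <= \int[mu]_x g x)%E.
Proof.
move=> f0 fg; have g0 x : (0 <= g x)%E by exact: le_trans (fg x).
rewrite !ge0_integralTE//; apply: le_ereal_sup => _ [h /= hf <-].
by exists h => //= x; exact: le_trans (fg x).
Qed.

Section Noise.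
Context {R : realType} {m n : nat} {dO dZ : measure_display}
  {Omega : measurableType dO} {Z : measurableType dZ}.
Variables (Pr : probability Omega R) (mu : probability Z R).
Variables (idx : nat -> 'I_n -> Omega -> 'I_m) (seed : nat -> 'I_n -> Omega -> Z).
Hypothesis rnd : ec_randomness Pr mu idx seed.

Definition noise (j : (nat * 'I_n) + (nat * 'I_n)) : set_system Omega :=
  match j with
  | inl (k, tau) => [set idx k tau @^-1` B | B in [set: set 'I_m]]
  | inr (k, tau) => [set seed k tau @^-1` B | B in @measurable _ Z]
  end.

Lemma noise_measurable j S : noise j S -> measurable S.
Proof.
case: rnd => mi _ ms _ _; case: j => [[k tau] [B _ <-]|[k tau] [B mB <-]].
  have -> : idx k tau @^-1` B = \bigcup_(i in B) (idx k tau @^-1` [set i]).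
    by apply/seteqP; split => [w Bw|w [i Bi /= ->]//]; exists (idx k tau w).
  by apply: fin_bigcup_measurable => //; exact: finite_finset.
by rewrite -[X in measurable X]setTI; exact: ms.
Qed.

Lemma noiseT j : noise j setT.
Proof. by case: j => [[k tau]|[k tau]]; exists setT. Qed.

Lemma noiseI j S T : noise j S -> noise j T -> noise j (S `&` T).
Proof.
case: j => [[k tau] [B _ <-] [C _ <-]|[k tau] [B mB <-] [C mC <-]].
  by exists (B `&` C).
by exists (B `&` C) => //; exact: measurableI.
Qed.

Lemma noise_independent : mutually_independent Pr noise.
Proof. by case: rnd. Qed.

Local Notation sigma A := (sigma_cylinder noise A).

Lemma measurable_idx (A : set _) k tau i : A (inl (k, tau)) ->
  @measurable _ (sigma A) (idx k tau @^-1` [set i]).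
Proof.
move=> Aj; apply: sub_sigma_algebra; apply: (cylinder1 noiseT Aj).
by exists [set i].
Qed.

Lemma measurable_seed (A : set _) k tau : A (inr (k, tau)) ->
  measurable_fun [set: sigma A] (seed k tau : sigma A -> Z).
Proof.
move=> Aj _ B mB; rewrite setTI; apply: sub_sigma_algebra.
by apply: (cylinder1 noiseT Aj); exists B.
Qed.

Lemma integral_seed k tau (f : Z -> \bar R) :
  measurable_fun [set: Z] f -> (forall z, (0 <= f z)%E) ->
  (\int[Pr]_w f (seed k tau w) = \int[mu]_z f z)%E.
Proof.
case: rnd => _ _ ms law _ mf f0.
pose X : {RV Pr >-> Z} := HB.pack (seed k tau) (isMeasurableFun.Build _ _ _ _ _ (ms k tau)).
rewrite -[LHS](ge0_integral_distribution X mf f0).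
by apply: eq_measure_integral => B mB _; exact: law.
Qed.

Definition index_event k (i : {ffun 'I_n -> 'I_m}) : set Omega :=
  [set w | [ffun tau => idx k tau w] = i].

Lemma index_eventE k i : index_event k i =
  \bigcap_(tau in [set: 'I_n]) (idx k tau @^-1` [set i tau]).
Proof.
apply/seteqP; split => [w /= <- tau _|w h]; first by rewrite /= ffunE.
by apply/ffunP => tau; rewrite ffunE; exact: h.
Qed.

Lemma measurable_index_event (A : set _) k i : (forall tau, A (inl (k, tau))) ->
  @measurable _ (sigma A) (index_event k i).
Proof.
move=> hA; rewrite index_eventE; apply: fin_bigcap_measurable; first exact: finite_finset.
by move=> tau _; exact: measurable_idx.
Qed.

(** Mutual independence is applied to the finite family of draws of iteration k. *)
Lemma index_event_prob k i : Pr (index_event k i) = ((m%:R^-1 ^+ n)%:E : \bar R).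
Proof.
case: rnd => mi pi _ _ ind.
pose J : {fset (nat * 'I_n) + (nat * 'I_n)} := [fset inl (k, tau) | tau : 'I_n]%fset.
pose E (j : (nat * 'I_n) + (nat * 'I_n)) : set Omega :=
  if j is inl (k', tau) then idx k' tau @^-1` [set i tau] else setT.
have -> : index_event k i = \bigcap_(j in [set` J]) E j.
  rewrite index_eventE; apply/seteqP; split => [w h _ /imfsetP[tau _ ->]|w h tau _].
    exact: h.
  by apply: (h (inl (k, tau))); apply/imfsetP; exists tau.
rewrite ind; last first.
  move=> _ /imfsetP[tau _ ->] /=.
  by exists [set i tau].
rewrite big_imfset /=; last by move=> a b _ _ [].
rewrite (eq_bigr (fun=> (m%:R^-1)%:E)); last by move=> tau _; exact: pi.
rewrite big_enum /= prodEFin.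
by rewrite prodr_const card_ord.
Qed.

Lemma integral_index k (h : ('I_n -> 'I_m) -> R) : (forall i, 0 <= h i) ->
  (\int[Pr]_w (h (fun tau => idx k tau w))%:E =
   (index_mean (fun i : {ffun 'I_n -> 'I_m} => h i))%:E)%E.
Proof.
move=> h0.
have mev i : measurable (index_event k i).
  apply: (sigma_cylinder_measurable noise_measurable (A := setT)).
  exact: measurable_index_event.
transitivity (\int[Pr]_w (\sum_(i : {ffun 'I_n -> 'I_m}) (h i)%:E * (\1_(index_event k i) w)%:E))%E.
  apply: eq_integral => w _.
  rewrite (bigD1 [ffun tau => idx k tau w])//= indicE mem_set// mule1.
  rewrite big1 ?adde0.
    by congr (h _)%:E; apply/funext => tau; rewrite ffunE.
  move=> i ne; rewrite indicE memNset ?mule0//= => e.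
  by rewrite /index_event /= in e; rewrite e eqxx in ne.
rewrite ge0_integral_sum//; last 2 first.
- move=> i; apply: measurable_funeM; apply/measurable_EFinP.
  exact: measurable_indic.
- by move=> i w _; rewrite mule_ge0// lee_fin.
rewrite /index_mean -sumEFin; apply: eq_bigr => i _.
rewrite ge0_integralZl//; last first.
- by rewrite lee_fin.
- by apply/measurable_EFinP; exact: measurable_indic.
rewrite integral_indic// setIT mulrC EFinM; congr (_ * _)%E.
exact: index_event_prob.
Qed.

End Noise.

(** * Measurability of the state and of the quantities read off it *)

Section StateMeasurability.
Context {R : realType} {m n d t : nat} (pb : erm_data R m n d t).
Variables (gamma theta : R).
Hypotheses (gamma0 : 0 < gamma).
Hypothesis loss_smooth : forall i tau, smooth (1 / gamma) (loss pb i tau).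
Hypothesis propg : propere (reg pb).
Hypothesis lscg : lower_semicontinuous (reg pb).
Hypothesis scg : strongly_convexe 1 (reg pb).
Context {d0 dZ : measure_display} {P : measurableType d0} {Z : measurableType dZ}.
Variable Q : Z -> 'cV[R]_d -> 'cV[R]_d.
Hypothesis mQ : measurable_fun [set: Z * g_sigma_algebraType (@open 'cV[R]_d)]
  (fun zx => Q zx.1 zx.2 : g_sigma_algebraType (@open 'cV[R]_d)).

(** The next state is a function of these three components and of the fresh noise. *)
Definition measurable_state (S : P -> @ec_state R m n d t) : Prop :=
  [/\ forall j tau, measurable_vec (fun w => st_alpha (S w) j tau),
      measurable_vec (fun w => st_u (S w)) &
      forall tau, measurable_vec (fun w => st_e (S w) tau)].

Lemma measurable_compressor (z : P -> Z) (v : P -> 'cV[R]_d) :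
  measurable_fun [set: P] z -> measurable_vec v -> measurable_vec (fun w => Q (z w) (v w)).
Proof.
move=> mz mv; apply: measurable_borel_vec.
pose B := g_sigma_algebraType (@open 'cV[R]_d).
have mzv : measurable_fun [set: P] (fun w => (z w, v w : B)).
  by apply: measurable_fun_pair => //; exact: measurable_vec_borel.
exact: (measurableT_comp mQ mzv).
Qed.

Lemma measurable_grad_conj_reg (u : P -> 'cV[R]_d) :
  measurable_vec u -> measurable_vec (fun w => grad_conj_reg pb (u w)).
Proof.
apply: (measurable_vec_lipschitz (L := 1)) => // x y.
by rewrite mul1r enorm_le; exact: gradient_conjugate_lipschitz.
Qed.

Lemma measurable_target (u : P -> 'cV[R]_d) j tau :
  measurable_vec u -> measurable_vec (fun w => target pb (u w) j tau).
Proof.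
move=> mu; apply: measurable_vecN.
apply: (measurable_vec_lipschitz (L := 1 / gamma)
  (f := fun w => (mat pb j tau)^T *m grad_conj_reg pb (u w))).
- by rewrite divr_ge0// ltW.
- by case: (loss_smooth j tau).
- by apply: measurable_vec_mulmx; exact: measurable_grad_conj_reg.
Qed.

Section OneState.
Variable S : P -> @ec_state R m n d t.
Hypothesis mS : measurable_state S.

Lemma measurable_direction j tau : measurable_vec (fun w => direction pb (S w) j tau).
Proof.
case: mS => ma mu _; apply: measurable_vecB; last exact: ma.
exact: measurable_target.
Qed.

Lemma measurable_message (i : P -> 'I_n -> 'I_m) tau :
  (forall a, measurable ((fun w => i w tau) @^-1` [set a])) ->
  measurable_vec (fun w => message pb theta (S w) (i w) tau).
Proof.
case: mS => _ _ me mi; apply: measurable_vecD; first exact: me.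
apply: measurable_vecZ.
apply: (measurable_vec_choice (idx := fun w => i w tau)
  (g := fun a w => mat pb a tau *m ((theta * m%:R) *: direction pb (S w) a tau))) => // a.
by apply: measurable_vec_mulmx; apply: measurable_vecZ; exact: measurable_direction.
Qed.

Lemma measurable_dual_update (i : P -> 'I_n -> 'I_m) j tau :
  (forall tau a, measurable ((fun w => i w tau) @^-1` [set a])) ->
  measurable_vec (fun w => dual_update theta (st_alpha (S w)) (direction pb (S w)) (i w) j tau).
Proof.
case: mS => ma _ _ mi; rewrite /dual_update.
apply: (measurable_vec_choice (idx := fun w => i w tau) (g := fun a w =>
  if j == a then st_alpha (S w) j tau + (theta * m%:R) *: direction pb (S w) j tau
  else st_alpha (S w) j tau)) => // a.
case: eqP => _; last exact: ma.
by apply: measurable_vecD; [exact: ma|apply: measurable_vecZ; exact: measurable_direction].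
Qed.

Lemma measurable_state_step (i : P -> 'I_n -> 'I_m) (z : P -> 'I_n -> Z) :
  (forall tau a, measurable ((fun w => i w tau) @^-1` [set a])) ->
  (forall tau, measurable_fun [set: P] (fun w => z w tau)) ->
  measurable_state (fun w => ec_step pb Q theta (i w) (z w) (S w)).
Proof.
move=> mi mz; have [ma mu me] := mS.
have -> : (fun w => ec_step pb Q theta (i w) (z w) (S w)) = (fun w =>
  EcState (dual_update theta (st_alpha (S w)) (direction pb (S w)) (i w))
    (grad_conj_reg pb (st_u (S w)))
    (st_u (S w) + n%:R^-1 *: \sum_(tau < n) Q (z w tau) (message pb theta (S w) (i w) tau))
    (fun tau => message pb theta (S w) (i w) tau -
       Q (z w tau) (message pb theta (S w) (i w) tau))).
  by apply/funext => w; rewrite ec_stepE.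
split=> /= [j tau||tau].
- exact: measurable_dual_update.
- apply: measurable_vecD => //; apply: measurable_vecZ; apply: measurable_vec_sum => tau.
  by apply: measurable_compressor => //; exact: measurable_message.
- apply: measurable_vecB; first exact: measurable_message.
  by apply: measurable_compressor => //; exact: measurable_message.
Qed.

End OneState.

Lemma measurable_dual_real (a : P -> 'I_m -> 'I_n -> 'cV[R]_t) :
  (forall j tau, measurable_vec (fun w => a w j tau)) ->
  measurable_fun [set: P] (fun w => dual_real pb (a w)).
Proof.
move=> ma; apply: measurable_funB.
  apply: measurableT_comp => //; apply: measurable_funM; first exact: measurable_cst.
  apply: (measurable_fine_conjugate (reg pb) (f := fun w => dual_average pb (a w))).
  apply: measurable_vecZ; apply: measurable_vec_sum => tau.
  by apply: measurable_vec_sum => i; exact: measurable_vec_mulmx.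
apply: measurable_funM; first exact: measurable_cst.
apply: measurable_sum => tau; apply: measurable_sum => i.
apply: (measurable_fine_conjugate _ (f := fun w => - a w i tau)).
exact: measurable_vecN.
Qed.

Lemma measurable_primal_at (u : P -> 'cV[R]_d) :
  measurable_vec u -> measurable_fun [set: P] (fun w => primal_at pb (u w)).
Proof.
move=> mu; have mx := measurable_grad_conj_reg mu.
apply: measurable_funD; apply: measurable_funM; try exact: measurable_cst.
  apply: measurable_sum => tau; apply: measurable_sum => i.
  apply: (measurable_continuous_vec (h := loss pb i tau)
    (f := fun w => (mat pb i tau)^T *m grad_conj_reg pb (u w))).
    by move=> x; apply: differentiable_continuous; case: (loss_smooth i tau).
  exact: measurable_vec_mulmx.
apply: measurable_funB; first exact: measurable_dotv.
exact: measurable_fine_conjugate.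
Qed.

End StateMeasurability.

(** * Expected decrease *)

Section ExpectedStep.
Context {R : realType} {m n d t : nat} (pb : erm_data R m n d t).
Variables (gamma delta : R).
Context {dO dZ : measure_display} {Omega : measurableType dO} {Z : measurableType dZ}.
Variables (Pr : probability Omega R) (mu : probability Z R).
Variable Q : Z -> 'cV[R]_d -> 'cV[R]_d.
Variables (idx : nat -> 'I_n -> Omega -> 'I_m) (seed : nat -> 'I_n -> Omega -> Z).
Hypotheses (m0 : (0 < m)%N) (n0 : (0 < n)%N) (gamma0 : 0 < gamma).
Hypothesis loss_convex : forall i tau, convex_function setT (loss pb i tau).
Hypothesis loss_smooth : forall i tau, smooth (1 / gamma) (loss pb i tau).
Hypothesis propg : propere (reg pb).
Hypothesis lscg : lower_semicontinuous (reg pb).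
Hypothesis scg : strongly_convexe 1 (reg pb).
Hypotheses (delta0 : 0 < delta) (delta1 : delta < 1) (lam0 : 0 < lam pb).
Hypothesis lamR : lam pb <= Rall pb ^+ 2 / gamma.
Hypothesis compQ : contraction_compressor mu delta Q.
Hypothesis rnd : ec_randomness Pr mu idx seed.

Let theta := theta_choice pb gamma delta.
Let r := rate pb gamma delta.
Let theta0 : 0 < theta. Proof. exact: theta_choice_gt0. Qed.
Let theta1 : theta * m%:R <= 1. Proof. exact: theta_choice_m. Qed.

Definition error_weight : R := 2 * (rho pb delta + theta * lam pb) / (delta * n%:R).

Lemma error_weight_ge0 : 0 <= error_weight.
Proof.
have rho0 : 0 < rho pb delta by exact: (rho_gt0 gamma0 delta0 delta1 lam0 lamR).
have tl : 0 < theta * lam pb by rewrite mulr_gt0.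
apply: divr_ge0; apply: mulr_ge0 => //; last exact: ltW.
by apply: addr_ge0; exact: ltW.
Qed.

Variable Dstar : R.
Hypothesis dual_opt : forall alpha, dual_finite pb alpha -> dual_real pb alpha <= Dstar.
Hypothesis dual_weak : forall u, Dstar <= primal_at pb u.

Definition lyapunov (s : @ec_state R m n d t) : R :=
  Dstar - dual_real pb (st_alpha s) +
  error_weight * \sum_tau dotv (st_e s tau) (st_e s tau).

Definition gap (u : 'cV[R]_d) : R := primal_at pb u - Dstar.

(* bounds the conditional expectation of the next Lyapunov value given the
   drawn indices, the compression error being replaced by its mean bound *)
Definition lyapunov_proxy (s : @ec_state R m n d t) (i : 'I_n -> 'I_m) : R :=
  Dstar - dual_real pb (dual_update theta (st_alpha s) (direction pb s) i) +
  error_weight * \sum_tau (1 - delta) *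
    dotv (message pb theta s i tau) (message pb theta s i tau).

(** Both parts of the Lyapunov value are nonnegative, so the factors 1 - theta and 1 - delta / 4 of
    [one_step] can be replaced by their common bound [r]. *)
Lemma mean_lyapunov_proxy s : ec_invariant pb s ->
  index_mean (lyapunov_proxy s) + theta * gap (st_u s) <= r * lyapunov s.
Proof.
move=> inv; have [fs uE] := inv.
have rho0 : 0 < rho pb delta by exact: (rho_gt0 gamma0 delta0 delta1 lam0 lamR).
have br := theta_choice_bracket m0 n0 gamma0 delta0 delta1 lam0 lamR.
have := one_step m0 n0 gamma0 loss_convex loss_smooth propg lscg scg delta0 delta1 lam0
  (st_e s) fs theta0 theta1 rho0 erefl br.
rewrite -directionE// -uE.
have -> : 2 * (rho pb delta + theta * lam pb) / delta / n%:R = error_weight.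
  by rewrite /error_weight invfM mulrA.
have [r0 r1 rt rd] := rate_bounds m0 n0 gamma0 delta0 delta1 lam0 lamR.
rewrite -/r -/theta in rt rd.
move=> step; have := dual_opt fs; set D := dual_real pb (st_alpha s) in step * => Dopt.
have E0 : 0 <= error_weight * \sum_tau dotv (st_e s tau) (st_e s tau).
  by rewrite mulr_ge0 ?error_weight_ge0// sumr_ge0// => tau _; exact: dotv_ge0.
have h1 : (1 - theta) * (Dstar - D) <= r * (Dstar - D) by rewrite ler_wpM2r// subr_ge0.
have h2 := ler_wpM2r E0 rd.
rewrite /lyapunov /gap -/D.
set F := fun i : {ffun 'I_n -> 'I_m} => _ in step.
have -> : index_mean (lyapunov_proxy s) = Dstar + index_mean F.
  rewrite -[in RHS](index_mean_cst m0 Dstar n0) -index_meanD.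
  by congr index_mean; apply/funext => i; rewrite /lyapunov_proxy /F addrA.
by move: step h1 h2; lra.
Qed.

(** Two counters, since within an iteration the indices are drawn before the compressors act: the
    message of iteration k depends on [past k.+1 k]. *)
Definition past (k k' : nat) : set ((nat * 'I_n) + (nat * 'I_n)) :=
  [set j | match j with inl p => (p.1 < k)%N | inr p => (p.1 < k')%N end].

Lemma past_subset k k' l l' : (k <= l)%N -> (k' <= l')%N -> past k k' `<=` past l l'.
Proof.
by move=> kl kl' [p|p] /= h; [exact: leq_trans kl|exact: leq_trans kl'].
Qed.

Local Notation sigma A := (sigma_cylinder (noise idx seed) A).
Let mQ := compQ.1.

Variables (alpha0 : 'I_m -> 'I_n -> 'cV[R]_t) (x0 : 'cV[R]_d).
Hypothesis falpha0 : dual_finite pb alpha0.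

Definition ec_path k (w : Omega) : @ec_state R m n d t :=
  ec_sdca pb Q theta (fun j tau => idx j tau w) (fun j tau => seed j tau w)
    (ec_init pb alpha0 x0) k.

Lemma ec_pathS k w : ec_path k.+1 w =
  EcState (dual_update theta (st_alpha (ec_path k w)) (direction pb (ec_path k w)) (idx k ^~ w))
    (grad_conj_reg pb (st_u (ec_path k w)))
    (st_u (ec_path k w) + n%:R^-1 *: \sum_(tau < n)
       Q (seed k tau w) (message pb theta (ec_path k w) (idx k ^~ w) tau))
    (fun tau => message pb theta (ec_path k w) (idx k ^~ w) tau -
       Q (seed k tau w) (message pb theta (ec_path k w) (idx k ^~ w) tau)).
Proof. exact: ec_stepE. Qed.

Lemma ec_path_invariant k w : ec_invariant pb (ec_path k w).
Proof.
exact: (ec_invariant_sdca m0 gamma0 loss_convex loss_smooth Q theta0 theta1).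
Qed.

Lemma measurable_state_subset (A B : set _) (S : Omega -> @ec_state R m n d t) : A `<=` B ->
  measurable_state (S : sigma A -> _) -> measurable_state (S : sigma B -> _).
Proof.
move=> AB [ma mu' me]; split.
- by move=> j tau k; apply: (measurable_fun_sigma_subset AB); exact: ma.
- by move=> k; apply: (measurable_fun_sigma_subset AB); exact: mu'.
- by move=> tau k; apply: (measurable_fun_sigma_subset AB); exact: me.
Qed.

Lemma measurable_ec_path k : measurable_state (ec_path k : sigma (past k k) -> _).
Proof.
elim: k => [|k IH].
  by split=> [j tau||tau]; exact: measurable_vec_cst.
apply: (measurable_state_step (P := sigma (past k.+1 k.+1)) theta gamma0 loss_smooth propg
  lscg scg mQ (S := ec_path k) _ (i := fun w tau => idx k tau w) (z := fun w tau => seed k tau w)).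
- by apply: measurable_state_subset IH; exact: past_subset.
- by move=> tau a; apply: measurable_idx => /=.
- by move=> tau; apply: measurable_seed => /=.
Qed.

Lemma measurable_path_message k tau :
  measurable_vec ((fun w => message pb theta (ec_path k w) (fun s => idx k s w) tau)
    : sigma (past k.+1 k) -> _).
Proof.
apply: (measurable_message (P := sigma (past k.+1 k)) theta gamma0 loss_smooth propg lscg scg
  (S := ec_path k) _ (i := fun w s => idx k s w)).
  by apply: measurable_state_subset (measurable_ec_path k); exact: past_subset.
by move=> a; apply: measurable_idx => /=.
Qed.

Let measurable_sigma (A : set _) (f : Omega -> R) :
  measurable_fun [set: sigma A] (f : sigma A -> R) -> measurable_fun [set: Omega] f.
Proof. exact: (measurable_fun_sigma_cylinder (noise_measurable rnd)). Qed.

(** The message is frozen, being a function of [past k.+1 k], and the compressor property is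
    integrated over the single fresh seed (k, tau). *)
Lemma mean_compression_error k tau :
  (\int[Pr]_w (dotv (st_e (ec_path k.+1 w) tau) (st_e (ec_path k.+1 w) tau))%:E <=
   \int[Pr]_w ((1 - delta) * dotv (message pb theta (ec_path k w) (fun s => idx k s w) tau)
     (message pb theta (ec_path k w) (fun s => idx k s w) tau))%:E)%E.
Proof.
pose M w := message pb theta (ec_path k w) (fun s => idx k s w) tau.
pose A := past k.+1 k; pose B : set ((nat * 'I_n) + (nat * 'I_n)) := [set inr (k, tau)].
have AB : [disjoint A & B]%classic.
  by apply/disj_setPS => j [/= + jE]; rewrite jE /= ltnn.
pose G (x : 'cV[R]_d) z := dotv (x - Q z x) (x - Q z x).
pose f (w : (sigma A * sigma B)%type) : \bar R := (G (M w.1) (seed k tau w.2))%:E.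
have mf : measurable_fun setT f.
  apply/measurable_EFinP.
  have mM : measurable_vec (fun w : (sigma A * sigma B)%type => M w.1).
    move=> j; apply: (measurableT_comp (f := fun w : sigma A => M w j 0)) => //.
    exact: measurable_path_message.
  have mz : measurable_fun [set: (sigma A * sigma B)%type]
      (fun w : (sigma A * sigma B)%type => seed k tau w.2).
    by apply: (measurableT_comp (f := seed k tau : sigma B -> Z)) => //; exact: measurable_seed.
  have mG : measurable_vec (fun w : (sigma A * sigma B)%type => M w.1 - Q (seed k tau w.2) (M w.1)).
    by apply: measurable_vecB => //; exact: measurable_compressor.
  exact: measurable_dotv.
have -> : (\int[Pr]_w (dotv (st_e (ec_path k.+1 w) tau) (st_e (ec_path k.+1 w) tau))%:E =
    \int[Pr]_w f (w, w))%E.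
  by apply: eq_integral => w _; rewrite /f /G ec_pathS.
rewrite (sigma_cylinder_tonelli (noise_measurable rnd) (noiseT idx seed) (@noiseI _ _ _ _ _ _ idx seed)
  (noise_independent rnd) AB mf); last first.
  by move=> w; rewrite lee_fin dotv_ge0.
apply: ge0_le_integral_nonmeasurable => w; first by apply: integral_ge0 => w' _; rewrite lee_fin dotv_ge0.
have mGz : measurable_fun [set: Z] (fun z => (G (M w) z)%:E).
  apply/measurable_EFinP.
  have mG : measurable_vec (fun z : Z => M w - Q z (M w)).
    have mc : measurable_vec (fun _ : Z => M w) by move=> j; exact: measurable_cst.
    apply: measurable_vecB => //.
    by apply: (measurable_compressor mQ (z := id) (v := fun=> M w)).
  exact: measurable_dotv.
rewrite /f /= (integral_seed rnd k tau mGz); last by move=> z; rewrite lee_fin dotv_ge0.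
have := compQ.2 (M w); rewrite enorm_sqr; apply: le_trans.
by under [leRHS]eq_integral do rewrite enorm_sqr.
Qed.

Let dual_term k w : R := Dstar - dual_real pb (st_alpha (ec_path k w)).
Let error_term k w tau : R := dotv (st_e (ec_path k w) tau) (st_e (ec_path k w) tau).

Let dual_term_ge0 k w : 0 <= dual_term k w.
Proof. by rewrite subr_ge0; apply: dual_opt; case: (ec_path_invariant k w). Qed.

Let measurable_dual_term k : measurable_fun [set: Omega] (dual_term k).
Proof.
apply: (@measurable_sigma (past k k)); apply: measurable_funB; first exact: measurable_cst.
by apply: measurable_dual_real; case: (measurable_ec_path k).
Qed.

Let measurable_error_term k tau : measurable_fun [set: Omega] (fun w => error_term k w tau).
Proof.
apply: (@measurable_sigma (past k k)).
by apply: measurable_dotv; case: (measurable_ec_path k).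
Qed.

Let message_term k w tau : R := (1 - delta) *
  dotv (message pb theta (ec_path k w) (fun s => idx k s w) tau)
     (message pb theta (ec_path k w) (fun s => idx k s w) tau).

Let measurable_message_term k tau : measurable_fun [set: Omega] (fun w => message_term k w tau).
Proof.
apply: (@measurable_sigma (past k.+1 k)); apply: measurable_funM; first exact: measurable_cst.
by apply: measurable_dotv; exact: measurable_path_message.
Qed.

Let message_term_ge0 k w tau : 0 <= message_term k w tau.
Proof. by rewrite mulr_ge0 ?dotv_ge0// subr_ge0 ltW. Qed.

Lemma lyapunov_ge0 k w : 0 <= lyapunov (ec_path k w).
Proof.
apply: addr_ge0; first exact: dual_term_ge0.
by rewrite mulr_ge0 ?error_weight_ge0// sumr_ge0// => tau _; exact: dotv_ge0.
Qed.

Lemma gap_ge0 u : 0 <= gap u.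
Proof. by rewrite subr_ge0. Qed.

Lemma measurable_gap_path k :
  measurable_fun [set: Omega] (fun w => gap (st_u (ec_path k w))).
Proof.
apply: (@measurable_sigma (past k k)); apply: measurable_funB; last exact: measurable_cst.
have [_ mu' _] := measurable_ec_path k.
exact: (measurable_primal_at loss_smooth propg lscg scg mu').
Qed.

Lemma integral_dual_plus_errors (D : Omega -> R) (E : Omega -> 'I_n -> R) :
  measurable_fun [set: Omega] D -> (forall w, 0 <= D w) ->
  (forall tau, measurable_fun [set: Omega] (E ^~ tau)) -> (forall w tau, 0 <= E w tau) ->
  (\int[Pr]_w (D w + error_weight * \sum_tau E w tau)%:E =
   \int[Pr]_w (D w)%:E + error_weight%:E * \sum_tau \int[Pr]_w (E w tau)%:E)%E.
Proof.
move=> mD D0 mE E0.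
have mS : measurable_fun [set: Omega] (fun w => \sum_tau E w tau) by exact: measurable_sum.
under eq_integral do rewrite EFinD.
rewrite ge0_integralD//; last 4 first.
- by move=> w _; rewrite lee_fin.
- exact/measurable_EFinP.
- by move=> w _; rewrite lee_fin mulr_ge0 ?error_weight_ge0// sumr_ge0.
- by apply/measurable_EFinP; apply: measurable_funM => //; exact: measurable_cst.
congr (_ + _)%E; under eq_integral do rewrite EFinM.
rewrite ge0_integralZl//; last 3 first.
- exact/measurable_EFinP.
- by move=> w _; rewrite lee_fin sumr_ge0.
- by rewrite lee_fin error_weight_ge0.
congr (_ * _)%E; under eq_integral do rewrite -sumEFin.
rewrite ge0_integral_sum//.
- by move=> tau; exact/measurable_EFinP.
- by move=> tau w _; rewrite lee_fin.
Qed.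

(** The new dual point ignores the seeds of iteration k, so both sides share the dual term and the
    error terms are compared worker by worker. The joint law of the seeds does not enter. *)
Lemma integral_lyapunov_step k :
  (\int[Pr]_w (lyapunov (ec_path k.+1 w))%:E <=
   \int[Pr]_w (lyapunov_proxy (ec_path k w) (fun tau => idx k tau w))%:E)%E.
Proof.
have -> : (\int[Pr]_w (lyapunov (ec_path k.+1 w))%:E =
    \int[Pr]_w (dual_term k.+1 w + error_weight * \sum_tau error_term k.+1 w tau)%:E)%E by [].
have -> : (\int[Pr]_w (lyapunov_proxy (ec_path k w) (fun tau => idx k tau w))%:E =
    \int[Pr]_w (dual_term k.+1 w + error_weight * \sum_tau message_term k w tau)%:E)%E.
  by apply: eq_integral => w _; rewrite /dual_term ec_pathS.
rewrite !integral_dual_plus_errors//; last by move=> w tau; exact: dotv_ge0.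
rewrite leeD2l// lee_wpmul2l ?lee_fin ?error_weight_ge0//.
by apply: lee_sum => tau _; exact: mean_compression_error.
Qed.

Let proxy_ge0 k w i : 0 <= lyapunov_proxy (ec_path k w) i.
Proof.
apply: addr_ge0.
  have inv := ec_path_invariant k w; have [fs uE] := inv.
  rewrite subr_ge0; apply: dual_opt; rewrite directionE//.
  exact: (dual_update_finite m0 gamma0 loss_convex loss_smooth _ fs theta0 theta1).
rewrite mulr_ge0 ?error_weight_ge0// sumr_ge0// => tau _.
by rewrite mulr_ge0 ?dotv_ge0// subr_ge0 ltW.
Qed.

Let mproxy k (i : 'I_n -> 'I_m) : measurable_fun [set: sigma (past k k)]
  ((fun w => lyapunov_proxy (ec_path k w) i) : sigma (past k k) -> R).
Proof.
have mi tau a : @measurable _ (sigma (past k k)) ((fun w : sigma (past k k) => i tau) @^-1` [set a]).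
  have [<-|ne] := eqVneq (i tau) a.
    by rewrite (_ : _ @^-1` _ = setT)//; apply/seteqP; split.
  rewrite (_ : _ @^-1` _ = set0)//; apply/seteqP; split => // w /= e.
  by rewrite e eqxx in ne.
have mS := measurable_ec_path k.
apply: measurable_funD.
  apply: measurable_funB; first exact: measurable_cst.
  apply: measurable_dual_real => j tau.
  exact: (measurable_dual_update theta gamma0 loss_smooth propg lscg scg mS (i := fun=> i)).
apply: measurable_funM; first exact: measurable_cst.
apply: measurable_sum => tau; apply: measurable_funM; first exact: measurable_cst.
by apply: measurable_dotv;
  apply: (measurable_message theta gamma0 loss_smooth propg lscg scg mS (i := fun=> i)).
Qed.

(** The state depends on [past k k], disjoint from the index draws of iteration k, over which the
    inner integral is the finite mean. *)
Lemma integral_lyapunov_proxy k :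
  (\int[Pr]_w (lyapunov_proxy (ec_path k w) (fun tau => idx k tau w))%:E =
   \int[Pr]_w (index_mean (lyapunov_proxy (ec_path k w)))%:E)%E.
Proof.
pose A := past k k; pose B : set ((nat * 'I_n) + (nat * 'I_n)) :=
  [set j | match j with inl p => p.1 == k | inr _ => false end].
have AB : [disjoint A & B]%classic.
  apply/disj_setPS => -[p|p] [/= h e] //=.
  by rewrite (eqP e) ltnn in h.
pose f (w : (sigma A * sigma B)%type) : \bar R :=
  (lyapunov_proxy (ec_path k w.1) (fun tau => idx k tau w.2))%:E.
have mf : measurable_fun setT f.
  apply/measurable_EFinP.
  pose h (i : {ffun 'I_n -> 'I_m}) (w : (sigma A * sigma B)%type) := lyapunov_proxy (ec_path k w.1) i.
  pose ix (w : (sigma A * sigma B)%type) := [ffun tau => idx k tau w.2].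
  have -> : (fun w : (sigma A * sigma B)%type =>
      lyapunov_proxy (ec_path k w.1) (fun tau => idx k tau w.2)) = (fun w => h (ix w) w).
    apply/funext => w; rewrite /h; congr (lyapunov_proxy _ _).
    by apply/funext => tau; rewrite ffunE.
  apply: measurable_fun_choice => i.
    have -> : ix @^-1` [set i] = snd @^-1` (index_event idx k i) by [].
    rewrite -[X in measurable X]setTI; apply: measurable_snd => //.
    by apply: measurable_index_event => tau /=.
  exact: (measurableT_comp (@mproxy k i) measurable_fst).
have f0 w : (0 <= f w)%E by rewrite lee_fin; exact: proxy_ge0.
rewrite -[LHS]/(\int[Pr]_w f (w, w))%E.
rewrite (sigma_cylinder_tonelli (noise_measurable rnd) (noiseT idx seed) (@noiseI _ _ _ _ _ _ idx seed)
  (noise_independent rnd) AB mf f0).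
apply: eq_integral => w _; rewrite /f /=.
exact: (integral_index rnd k (h := lyapunov_proxy (ec_path k w))).
Qed.

Lemma integral_step k :
  (\int[Pr]_w (lyapunov (ec_path k.+1 w))%:E +
   theta%:E * \int[Pr]_w (gap (st_u (ec_path k w)))%:E <=
   r%:E * \int[Pr]_w (lyapunov (ec_path k w))%:E)%E.
Proof.
pose P w := index_mean (lyapunov_proxy (ec_path k w)).
have P0 w : 0 <= P w.
  apply: sumr_ge0 => i _; apply: mulr_ge0; last exact: proxy_ge0.
  by rewrite exprn_ge0.
have mP : measurable_fun [set: Omega] P.
  apply: (@measurable_sigma (past k k)); apply: measurable_sum => i.
  by apply: measurable_funM; [exact: measurable_cst|exact: mproxy].
apply: (@le_trans _ _ (\int[Pr]_w (P w)%:E +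
    theta%:E * \int[Pr]_w (gap (st_u (ec_path k w)))%:E)%E).
  by rewrite leeD2r// -integral_lyapunov_proxy; exact: integral_lyapunov_step.
have mgap := measurable_gap_path k.
have mtgap : measurable_fun [set: Omega] (fun w => theta * gap (st_u (ec_path k w))).
  by apply: measurable_funM => //; exact: measurable_cst.
have mL : measurable_fun [set: Omega] (fun w => lyapunov (ec_path k w)).
  apply: measurable_funD; first exact: measurable_dual_term.
  apply: measurable_funM; first exact: measurable_cst.
  by apply: measurable_sum => tau; exact: measurable_error_term.
have [r0 r1 _ _] := rate_bounds m0 n0 gamma0 delta0 delta1 lam0 lamR.
rewrite -!ge0_integralZl//; last 6 first.
- exact/measurable_EFinP.
- by move=> w _; rewrite lee_fin lyapunov_ge0.
- by rewrite lee_fin ltW.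
- exact/measurable_EFinP.
- by move=> w _; rewrite lee_fin gap_ge0.
- by rewrite lee_fin ltW.
rewrite -ge0_integralD//; last 4 first.
- by move=> w _; rewrite lee_fin.
- exact/measurable_EFinP.
- by move=> w _; rewrite -EFinM lee_fin mulr_ge0 ?gap_ge0// ltW.
- by under eq_fun do rewrite -EFinM; exact/measurable_EFinP.
apply: ge0_le_integral_nonmeasurable => w; rewrite -!EFinM -EFinD lee_fin.
  by rewrite addr_ge0// mulr_ge0 ?gap_ge0// ltW.
exact: mean_lyapunov_proxy (ec_path_invariant k w).
Qed.

(** Replaces extended integrals by real sequences, so that the telescoping below is real
    arithmetic. *)
Lemma expected_path : exists A G : nat -> R,
  [/\ A 0%N = Dstar - dual_real pb alpha0,
      forall k, 0 <= A k /\ 0 <= G k,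
      forall k, (\int[Pr]_w (lyapunov (ec_path k w))%:E = (A k)%:E)%E,
      forall k, (\int[Pr]_w (gap (st_u (ec_path k w)))%:E = (G k)%:E)%E &
      forall k, A k.+1 + theta * G k <= r * A k].
Proof.
pose IL k := (\int[Pr]_w (lyapunov (ec_path k w))%:E)%E.
pose IG k := (\int[Pr]_w (gap (st_u (ec_path k w)))%:E)%E.
have IL0 k : (0 <= IL k)%E by apply: integral_ge0 => w _; rewrite lee_fin lyapunov_ge0.
have IG0 k : (0 <= IG k)%E by apply: integral_ge0 => w _; rewrite lee_fin gap_ge0.
have tIG0 k : (0 <= theta%:E * IG k)%E by rewrite mule_ge0// lee_fin ltW.
have [r0 r1 _ _] := rate_bounds m0 n0 gamma0 delta0 delta1 lam0 lamR.
have start : IL 0%N = (Dstar - dual_real pb alpha0)%:E.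
  rewrite /IL (_ : (fun w => (lyapunov (ec_path 0 w))%:E) = cst (Dstar - dual_real pb alpha0)%:E).
    rewrite integral_cst// -[RHS]mule1; congr (_ * _)%E; exact: probability_setT.
  apply/funext => w; rewrite /lyapunov /= big1 ?mulr0 ?addr0// => tau _.
  by rewrite dotv0l.
(* Finiteness propagates from the deterministic start through [integral_step], whose right side is
   finite; the gap integrals follow because theta > 0. *)
have fL k : IL k \is a fin_num.
  elim: k => [|k IH]; first by rewrite start.
  rewrite ge0_fin_numE//.
  apply: (@le_lt_trans _ _ (IL k.+1 + theta%:E * IG k)%E); first by rewrite leeDl.
  apply: (le_lt_trans (integral_step k)).
  by rewrite -/(IL k) -(fineK IH) -EFinM ltry.
have fG k : IG k \is a fin_num.
  rewrite ge0_fin_numE//.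
  have : (theta%:E * IG k < +oo)%E.
    apply: (@le_lt_trans _ _ (IL k.+1 + theta%:E * IG k)%E); first by rewrite leeDr.
    apply: (le_lt_trans (integral_step k)).
    by rewrite -/(IL k) -(fineK (fL k)) -EFinM ltry.
  have := IG0 k; case: (IG k) => [g _ _||//]; first by rewrite ltry.
  by rewrite gt0_muley// lte_fin.
exists (fun k => fine (IL k)), (fun k => fine (IG k)); split.
- by rewrite start.
- by move=> k; split; exact: fine_ge0.
- by move=> k; rewrite fineK.
- by move=> k; rewrite fineK.
move=> k; rewrite -lee_fin EFinD !EFinM !fineK//.
exact: integral_step.
Qed.

End ExpectedStep.

(** * Telescoping *)

Section Telescoping.
Context {R : realType}.
Variables (A G : nat -> R) (r theta : R).
Hypotheses (A0 : forall k, 0 <= A k) (G0 : forall k, 0 <= G k).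
Hypotheses (r0 : 0 < r) (r1 : r < 1) (rt : 1 - r <= theta).
Hypothesis step : forall k, A k.+1 + theta * G k <= r * A k.

Let theta0 : 0 < theta.
Proof. by apply: lt_le_trans rt; rewrite subr_gt0. Qed.

Lemma geometric_decay k : A k <= r ^+ k * A 0%N.
Proof.
elim: k => [|k IH]; first by rewrite mul1r.
rewrite exprS -mulrA; apply: (@le_trans _ _ (r * A k)); last by rewrite ler_pM2l.
by apply: le_trans (step k); rewrite lerDl mulr_ge0// ltW.
Qed.

(** The step inequality divided by r^(k+1) telescopes. The shift [i.-1] appears because x^i is
    computed from u^(i-1). *)
Lemma weighted_gap_sum k :
  theta * (\sum_(1 <= i < k.+1) (r ^+ i)^-1 * G i.-1) + (r ^+ k)^-1 * A k <= A 0%N.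
Proof.
elim: k => [|k IH]; first by rewrite big_geq// mulr0 add0r invr1 mul1r.
rewrite big_nat_recr//= mulrDr -addrA; apply: le_trans IH; rewrite lerD2l.
have rk : 0 < r ^+ k by rewrite exprn_gt0.
have -> : theta * ((r ^+ k.+1)^-1 * G k) + (r ^+ k.+1)^-1 * A k.+1 =
    (r ^+ k.+1)^-1 * (A k.+1 + theta * G k) by ring.
apply: (@le_trans _ _ ((r ^+ k.+1)^-1 * (r * A k))).
  by rewrite ler_wpM2l// invr_ge0 exprn_ge0// ltW.
rewrite exprS le_eqVlt; apply/orP; left; apply/eqP; field.
by rewrite expf_neq0 ?gt_eqF.
Qed.

Lemma weight_sum k : (1 - r) * (\sum_(1 <= i < k.+1) (r ^+ i)^-1) = (r ^+ k)^-1 - 1.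
Proof.
elim: k => [|k IH]; first by rewrite big_geq// mulr0 invr1 subrr.
rewrite big_nat_recr//= mulrDr IH exprS; field.
by rewrite expf_neq0 ?gt_eqF.
Qed.

(** The geometric sum gives (1 - r) W = r^(-k) - 1, and 1 - r <= theta lets theta W absorb it. *)
Lemma weighted_gap_mean k : (0 < k)%N ->
  (\sum_(1 <= i < k.+1) (r ^+ i)^-1)^-1 * (\sum_(1 <= i < k.+1) (r ^+ i)^-1 * G i.-1) <=
  r ^+ k / (1 - r ^+ k) * A 0%N.
Proof.
move=> k0; have W := weight_sum k; have S := weighted_gap_sum k.
set w := \sum_(1 <= i < k.+1) (r ^+ i)^-1 in W *.
set g := \sum_(1 <= i < k.+1) _ * G _ in S *.
have rk : 0 < r ^+ k by rewrite exprn_gt0.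
have rk1 : r ^+ k < 1 by rewrite exprn_ilt1// ?(ltW r0)// -lt0n.
have w0 : 0 < w.
  have d1 : 0 < 1 - r by rewrite subr_gt0.
  by rewrite -(pmulr_rgt0 _ d1) W subr_gt0 invf_gt1.
have tg : theta * g <= A 0%N.
  by apply: le_trans S; rewrite lerDl mulr_ge0// invr_ge0 ltW.
have tw : (r ^+ k)^-1 - 1 <= theta * w by rewrite -W ler_wpM2r// ltW.
rewrite ler_pdivrMl// -(ler_pM2l theta0); apply: (le_trans tg).
have -> : theta * (w * (r ^+ k / (1 - r ^+ k) * A 0%N)) =
    (theta * w) * (r ^+ k / (1 - r ^+ k)) * A 0%N by ring.
rewrite -[leLHS]mul1r ler_wpM2r//.
apply: (@le_trans _ _ (((r ^+ k)^-1 - 1) * (r ^+ k / (1 - r ^+ k)))).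
  rewrite le_eqVlt; apply/orP; left; apply/eqP; field.
  have nz : 1 - r ^+ k != 0 by rewrite gt_eqF// subr_gt0.
  have nz' : r ^+ k != 0 by rewrite gt_eqF.
  by rewrite nz nz'.
by rewrite ler_wpM2r// divr_ge0 ?(ltW rk)// subr_ge0 ltW.
Qed.

(** From r <= exp (- (1 - r)) the logarithm of r^k is at most - k (1 - r), and 75 = 3 * 25 makes
    this at most 3 ln eps. *)
Lemma geometric_le_cube (X eps : R) k : 1 <= 25 * X * (1 - r) -> 0 < eps -> eps < 1 ->
  75 * X * ln (1 / eps) <= k%:R -> r ^+ k <= eps ^+ 3.
Proof.
move=> hX e0 e1 hk.
have L0 : 0 < ln (1 / eps) by rewrite ln_gt0// ltr_pdivlMr// mul1r.
have h1 : r <= expR (- (1 - r)).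
  by have := expR_ge1Dx (- (1 - r)); lra.
have h2 : 3 * ln (1 / eps) <= k%:R * (1 - r).
  have d1 : 0 < 1 - r by rewrite subr_gt0.
  have := ler_wpM2r (ltW d1) hk; have := ler_wpM2r (ltW L0) hX.
  by lra.
have -> : eps ^+ 3 = expR (- (3 * ln (1 / eps))).
  rewrite div1r lnV ?posrE// mulrN opprK.
  by rewrite expRM_natl lnK ?posrE.
apply: (@le_trans _ _ (expR (- (1 - r)) ^+ k)).
  by rewrite lerXn2r// ?nnegrE ?expR_ge0 ?(ltW r0).
by rewrite -expRM_natl ler_expR mulrN lerN2.
Qed.

End Telescoping.

(* [C] is the absolute constant hidden in the O of the iteration complexity.
   Since the bound has ln (1/eps) and not ln (Psi^0/eps), it is read for eps
   small: eps < 1 (resp. eps <= 1/2) and Psi^0 <= 1/eps. *)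
Theorem theorem3p5 (R : realType) :
  exists C : R, 0 < C /\
  forall (m n d t : nat) (pb : erm_data R m n d t) (gamma delta : R)
    (dO dZ : measure_display) (Omega : measurableType dO)
    (Z : measurableType dZ) (Pr : probability Omega R) (mu : probability Z R)
    (Q : Z -> 'cV[R]_d -> 'cV[R]_d)
    (idx : nat -> 'I_n -> Omega -> 'I_m) (seed : nat -> 'I_n -> Omega -> Z)
    (xs x0 : 'cV[R]_d) (alphas alpha0 : 'I_m -> 'I_n -> 'cV[R]_t),
  (0 < m)%N -> (0 < n)%N -> (0 < d)%N -> (0 < t)%N ->
  0 < gamma ->
  (forall i tau, convex_function setT (loss pb i tau)) ->
  (forall i tau, smooth (1 / gamma) (loss pb i tau)) ->
  propere (reg pb) -> lower_semicontinuous (reg pb) -> convexe (reg pb) ->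
  strongly_convexe 1 (reg pb) ->
  (forall x, (primal pb xs <= primal pb x)%E) ->
  (forall alpha, (dual pb alpha <= dual pb alphas)%E) ->
  0 < delta -> delta < 1 ->
  contraction_compressor mu delta Q ->
  0 < lam pb -> lam pb <= Rall pb ^+ 2 / gamma ->
  ec_randomness Pr mu idx seed ->
  let theta := theta_choice pb gamma delta in
  let q := rate pb gamma delta in
  let s0 := ec_init pb alpha0 x0 in
  let s k w := ec_sdca pb Q theta (fun j tau => idx j tau w)
                 (fun j tau => seed j tau w) s0 k in
  let Psi := Psi3 pb gamma delta alphas in
  let xb k w := xbar pb gamma delta (fun j => st_x (s j w)) k in
  let K eps := C * complexity pb gamma delta * ln (1 / eps) in
  [/\ forall k, (\int[Pr]_w Psi (s k w) <= (q ^+ k)%:E * Psi s0)%E,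
      forall eps, 0 < eps -> eps < 1 -> (Psi s0 <= (1 / eps)%:E)%E ->
        forall k : nat, K eps <= k%:R ->
        (\int[Pr]_w Psi (s k w) <= eps%:E)%E,
      forall k, (0 < k)%N ->
        (\int[Pr]_w (primal pb (xb k w) - primal pb xs) <=
           (q ^+ k / (1 - q ^+ k))%:E * epsD pb alphas alpha0)%E
    & forall eps, 0 < eps -> eps <= 1 / 2 -> (Psi s0 <= (1 / eps)%:E)%E ->
        (eps%:E <= epsD pb alphas alpha0)%E ->
        forall k : nat, K eps <= k%:R ->
        (\int[Pr]_w (primal pb (xb k w) - primal pb xs) <= eps%:E)%E].
Proof.
(* 25 is the constant of [complexity_bound]. The factor 3 gives q^k <= eps^3: one power of eps pays
   for Psi s0 <= 1 / eps, and a second one leaves room for the denominator 1 - q^k. *)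
exists 75; split=> // m n d t pb gamma delta dO dZ Omega Z Pr mu Q idx seed xs x0
  alphas alpha0 m0 n0 d0 t0 gamma0 loss_convex loss_smooth propg lscg cg scg xs_opt
  alphas_opt delta0 delta1 compQ lam0 lamR rnd theta q s0 s Psi xb K.
(* The targets computed from u = 0 form a point with finite dual value, so a maximiser cannot have
   value -oo. *)
have falphas : dual_finite pb alphas.
  apply: contrapT => /(dual_infinite m0 n0 propg lscg scg) nf.
  pose a i tau := target pb 0 i tau.
  have fa : dual_finite pb a.
    move=> i tau.
    by have [] := loss_conj_target gamma0 loss_convex loss_smooth 0 i tau.
  by have := alphas_opt a; rewrite nf (dual_finiteE propg lscg scg fa).
pose Dstar := dual_real pb alphas.
have dualE : dual pb alphas = Dstar%:E by exact: dual_finiteE.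
have dual_opt alpha : dual_finite pb alpha -> dual_real pb alpha <= Dstar.
  by move=> fa; rewrite -lee_fin -dualE -(dual_finiteE propg lscg scg fa).
have dual_weak u : Dstar <= primal_at pb u.
  apply: (weak_duality m0 n0 propg lscg scg lam0 falphas).
  exact: (reg_gradient_conjugate propg lscg scg u).
have [r0 r1 rt rd] := rate_bounds m0 n0 gamma0 delta0 delta1 lam0 lamR.
rewrite -/theta -/q in r0 r1 rt rd.
have rt' : 1 - q <= theta by lra.
have cX := complexity_bound m0 n0 gamma0 delta0 delta1 lam0 lamR.
rewrite -/q in cX.
(* If the initial dual value is -oo, both right-hand sides are +oo and the premise on [Psi s0] of
   the two complexity claims fails. *)
have [fa0|nfa0] := pselect (dual_finite pb alpha0); last first.
  have D0 := dual_infinite m0 n0 propg lscg scg nfa0.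
  have eD : epsD pb alphas alpha0 = +oo%E by rewrite /epsD dualE D0.
  have Psi0 : Psi s0 = +oo%E by rewrite /Psi /Psi3 /s0 /= eD.
  split=> [k|eps e0 e1|k k0|eps e0 e1].
  - by rewrite Psi0 gt0_muley ?leey// lte_fin exprn_gt0.
  - by rewrite Psi0.
  - rewrite eD gt0_muley ?leey// lte_fin divr_gt0 ?exprn_gt0// subr_gt0.
    by rewrite exprn_ilt1// ?(ltW r0)// -lt0n.
  - by rewrite Psi0.
have [A [G [A0E AG0 intL intG AG]]] := expected_path m0 n0 gamma0 loss_convex loss_smooth
  propg lscg scg delta0 delta1 lam0 lamR compQ rnd dual_opt dual_weak x0 fa0.
have A0 k : 0 <= A k by case: (AG0 k).
have G0 k : 0 <= G k by case: (AG0 k).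
have inv k w : ec_invariant pb (s k w).
  exact: (ec_path_invariant Q idx seed m0 n0 gamma0 loss_convex loss_smooth delta0 delta1
    lam0 lamR x0 fa0 k w).
have PsiE k w : Psi (s k w) = (lyapunov pb gamma delta Dstar (s k w))%:E.
  have [fs _] := inv k w.
  rewrite /Psi /Psi3 /epsD dualE (dual_finiteE propg lscg scg fs) -EFinB -EFinD.
  rewrite /lyapunov /error_weight; congr (_ + _ * _)%:E.
  by apply: eq_bigr => tau _; rewrite enorm_sqr.
have epsDE : epsD pb alphas alpha0 = (A 0%N)%:E.
  by rewrite A0E /epsD dualE (dual_finiteE propg lscg scg fa0).
have intPsi k : (\int[Pr]_w Psi (s k w) = (A k)%:E)%E.
  by rewrite -intL; apply: eq_integral => w _; exact: PsiE.
have Psi0 : Psi s0 = (A 0%N)%:E.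
  rewrite /Psi /Psi3 /s0 /= epsDE -EFinD big1 ?mulr0 ?addr0// => tau _.
  by rewrite enorm_sqr dotv0l.
have decay := geometric_decay G0 r0 r1 rt' AG.
have decay_eps eps k : 0 < eps -> eps < 1 -> K eps <= k%:R -> q ^+ k <= eps ^+ 3.
  by move=> e0 e1; exact: (geometric_le_cube r0 r1 cX e0 e1).
(* Optimality against the finite value [primal_at pb 0] makes reg finite at [xs]. *)
have [b [gxs xs_le]] : exists b, reg pb xs = b%:E /\ loss_mean pb xs + lam pb * b <= primal_at pb 0.
  apply: (primal_finite propg lam0).
  by rewrite -(primal_atE propg lscg scg); exact: xs_opt.
have primal_xs := primal_finiteE gxs.
set Pstar := loss_mean pb xs + lam pb * b in primal_xs.
have DP : Dstar <= Pstar.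
  exact: (weak_duality m0 n0 propg lscg scg lam0 falphas gxs).
have primal_bound k : (0 < k)%N ->
    (\int[Pr]_w (primal pb (xb k w) - primal pb xs) <= (q ^+ k / (1 - q ^+ k) * A 0%N)%:E)%E.
  move=> k0.
  pose W := \sum_(1 <= i < k.+1) (q ^+ i)^-1.
  pose gp i w := gap pb Dstar (st_u (s i.-1 w)).
  have W0 : 0 < W.
    case: k k0 @W => // k _; rewrite big_nat_recl//= ltr_wpDr//; last first.
      by rewrite invr_gt0 exprn_gt0.
    by apply: sumr_ge0 => i _; rewrite invr_ge0 exprn_ge0// ltW.
  have gp0 i w : 0 <= gp i w by exact: gap_ge0.
  have mgp i : measurable_fun [set: Omega] (gp i).
    exact: (measurable_gap_path gamma0 loss_smooth propg lscg scg compQ rnd Dstar alpha0 x0 i.-1).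
  apply: (@le_trans _ _ (\int[Pr]_w (W^-1 * \sum_(1 <= i < k.+1) (q ^+ i)^-1 * gp i w)%:E)%E).
    apply: ge0_le_integral_nonmeasurable => w.
      by rewrite sube_ge0 ?xs_opt// primal_xs.
    have wq i : 0 < (q ^+ i)^-1 by rewrite invr_gt0 exprn_gt0.
    have jen := primal_jensen m0 n0 loss_convex propg cg lam0 (x := fun j => st_x (s j w))
      (* The majorant for x^i is [primal_at] of the previous [u]; x^i is exactly the gradient there,
         for i > 0. *)
      (b := fun i => primal_at pb (st_u (s i.-1 w))) k.-1 wq.
    rewrite (prednK k0) in jen.
    have {jen} := jen _; rewrite -/W => jen.
    rewrite primal_xs leeBlDr// -EFinD.
    apply: (le_trans (jen _)) => [[//|i] _|].
      by rewrite /s /= (primal_atE propg lscg scg).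
    rewrite lee_fin; apply: (@le_trans _ _ (W^-1 * (\sum_(1 <= i < k.+1) (q ^+ i)^-1 * gp i w) + Dstar)).
      rewrite le_eqVlt; apply/orP; left; apply/eqP.
      rewrite /gp /gap; under [in RHS]eq_bigr do rewrite mulrBr.
      by rewrite sumrB -mulr_suml -/W mulrBr mulrA mulVf ?gt_eqF// mul1r subrK.
    by rewrite lerD2l.
  have -> : (\int[Pr]_w (W^-1 * \sum_(1 <= i < k.+1) (q ^+ i)^-1 * gp i w)%:E =
      (W^-1 * \sum_(1 <= i < k.+1) (q ^+ i)^-1 * G i.-1)%:E)%E.
    have mt i : measurable_fun [set: Omega] (fun w => (q ^+ i)^-1 * gp i w).
      by apply: measurable_funM => //; exact: measurable_cst.
    have t0' i w : 0 <= (q ^+ i)^-1 * gp i w.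
      by rewrite mulr_ge0// invr_ge0 exprn_ge0// ltW.
    under eq_integral do rewrite EFinM.
    rewrite ge0_integralZl//; last 3 first.
    - by apply/measurable_EFinP; exact: measurable_sum.
    - by move=> w _; rewrite lee_fin sumr_ge0.
    - by rewrite lee_fin invr_ge0 ltW.
    rewrite EFinM; congr (_ * _)%E.
    under eq_integral do rewrite -sumEFin.
    rewrite ge0_integral_sum//; last 2 first.
    - by move=> i; exact/measurable_EFinP.
    - by move=> i w _; rewrite lee_fin.
    rewrite -sumEFin; apply: eq_bigr => i _.
    under eq_integral do rewrite EFinM.
    rewrite ge0_integralZl//; last 3 first.
    - exact/measurable_EFinP.
    - by move=> w _; rewrite lee_fin.
    - by rewrite lee_fin invr_ge0 exprn_ge0// ltW.
    by rewrite EFinM -intG.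
  by rewrite lee_fin; exact: (weighted_gap_mean A0 r0 r1 rt' AG).
split=> [k|eps e0 e1 Peps k hk|k k0|eps e0 e1 Peps _ k hk].
- by rewrite intPsi Psi0 -EFinM lee_fin.
- rewrite intPsi lee_fin; apply: (le_trans (decay k)).
  move: Peps; rewrite Psi0 lee_fin div1r => Peps.
  apply: (@le_trans _ _ (eps ^+ 3 * eps^-1)).
    by apply: ler_pM; rewrite ?exprn_ge0 ?(ltW r0)//; exact: decay_eps.
  rewrite exprSr mulfK ?gt_eqF// expr2 ger_pMr//; exact: ltW.
- by rewrite epsDE -EFinM; exact: primal_bound.
have e1' : eps < 1 by lra.
(* The averaged bound needs a positive k; [K eps] is positive since eps < 1 and the complexity
   is. *)
have k0 : (0 < k)%N.
  rewrite lt0n; apply/eqP => k0; move: hk; rewrite k0 leNgt => /negP; apply.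
  have d1 : 0 < 1 - q by rewrite subr_gt0.
  have X0 : 0 < complexity pb gamma delta.
    have h : 0 < 25 * complexity pb gamma delta by rewrite -(pmulr_lgt0 _ d1); apply: lt_le_trans cX.
    by lra.
  by rewrite mulr_gt0// ?mulr_gt0// ln_gt0// ltr_pdivlMr// mul1r.
apply: (le_trans (primal_bound k k0)); rewrite lee_fin.
have qk := decay_eps eps k e0 e1' hk.
have e2 : eps ^+ 2 <= eps / 2 by rewrite expr2 ler_pM2l//; lra.
have e3 : eps ^+ 3 <= eps ^+ 2 by rewrite exprSr ger_pMr ?exprn_gt0// ltW.
have q1 : 0 < 1 - q ^+ k by lra.
rewrite mulrAC ler_pdivrMr//.
have : q ^+ k * A 0%N <= eps ^+ 2.
  move: Peps; rewrite Psi0 lee_fin div1r => Peps.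
  apply: (@le_trans _ _ (eps ^+ 3 * eps^-1)).
    by apply: ler_pM; rewrite ?exprn_ge0 ?(ltW r0).
  by rewrite exprSr mulfK ?gt_eqF.
(* q^k A 0 <= eps^2 <= eps / 2 <= eps (1 - q^k), where q^k <= 1 / 2. *)
have : eps * q ^+ k <= eps * (1 / 2) by rewrite ler_pM2l//; lra.
by lra.
Qed.
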